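(* Let $n\ge 1$ be an integer, $0<\alpha,\beta<\min\{2,n\}$, let $k,l\ge 0$ be integers, and let $a,b,p,q\ge 0$ be real numbers with $p,q\ge 1$. Let $(u,v)$ be a solution (in the sense specified in the context) of $$(-\Delta)^{k+\frac{\alpha}{2}}u(x)=|x|^a v^p(x),\qquad (-\Delta)^{l+\frac{\beta}{2}}v(x)=|x|^b u^q(x),\qquad u(x)\ge 0,\ v(x)\ge 0,\qquad x\in\mathbb{R}^n.$$ Then $(u,v)=(0,0)$ if one of the following three conditions holds: (i) $p=q=1$; (ii) $pq>1$ and $\frac{2k+\alpha+a+p(2l+\beta+b)}{pq-1}>n-2k-\alpha$; (iii) $pq>1$ and $\frac{2l+\beta+b+q(2k+\alpha+a)}{pq-1}>n-2l-\beta$.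
   Context: For $t\in\mathbb{R}$, $[t]$ is the integer part of $t$ and $\{t\}:=t-[t]$. For $0<\alpha<2$, $\mathcal{L}_\alpha(\mathbb{R}^n):=\{u:\mathbb{R}^n\to\mathbb{R} \mid \int_{\mathbb{R}^n}\frac{|u(x)|}{1+|x|^{n+\alpha}}\,dx<\infty\}$. For $u\in C^{[\alpha],\{\alpha\}+\epsilon}_{loc}(\mathbb{R}^n)\cap\mathcal{L}_\alpha(\mathbb{R}^n)$ with some (arbitrarily small) $\epsilon>0$, the fractional Laplacian is defined pointwise by $$(-\Delta)^{\frac{\alpha}{2}}u(x)=C_{n,\alpha}\lim_{\varepsilon\to 0}\int_{|y-x|\ge\varepsilon}\frac{u(x)-u(y)}{|x-y|^{n+\alpha}}\,dy,$$ where $C_{n,\alpha}>0$ is the usual normalization constant. For an integer $m\ge 0$ and $f\in C^{2m+[\alpha],\{\alpha\}+\epsilon}_{loc}(\mathbb{R}^n)\cap\mathcal{L}_\alpha(\mathbb{R}^n)$, $(-\Delta)^{m+\frac{\alpha}{2}}f:=(-\Delta)^m(-\Delta)^{\frac{\alpha}{2}}f$ (under this regularity $(-\Delta)^{\frac{\alpha}{2}}f\in C^{2m}(\mathbb{R}^n)$). A solution $(u,v)$ of the system is a pair of functions with $u\in C^{2k+[\alpha],\{\alpha\}+\epsilon}_{loc}(\mathbb{R}^n)\cap\mathcal{L}_\alpha(\mathbb{R}^n)$ and $v\in C^{2l+[\beta],\{\beta\}+\epsilon}_{loc}(\mathbb{R}^n)\cap\mathcal{L}_\beta(\mathbb{R}^n)$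 for some arbitrarily small $\epsilon>0$, satisfying the equations and sign conditions pointwise in all of $\mathbb{R}^n$. *)

(* Defs.v *)
From HB Require Import structures.
From mathcomp Require Import all_boot all_order all_algebra.
From mathcomp Require Import all_classical all_reals all_analysis.

Set Implicit Arguments.
Unset Strict Implicit.
Unset Printing Implicit Defensive.

Import Order.TTheory GRing.Theory Num.Theory.
Import numFieldNormedType.Exports.

Local Open Scope classical_set_scope.
Local Open Scope ring_scope.

(** ['rV[R]_n] carries the sigma-algebra generated by the coordinates, i.e. the
    Borel sigma-algebra; [lebesgue_rV] below is, like [lebesgue_measure], not
    completed. *)

Section rV_measurable.
Variables (R : realType) (n : nat).

Let coord : 'I_n -> 'rV[R]_n -> measurableTypeR R := fun i v => v ord0 i.

Let rV_set0 : g_sigma_preimage coord set0.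
Proof. exact: sigma_algebra0. Qed.

Let rV_setC A : g_sigma_preimage coord A -> g_sigma_preimage coord (~` A).
Proof. exact: sigma_algebraC. Qed.

Let rV_bigcup (F : (set 'rV[R]_n)^nat) :
  (forall i, g_sigma_preimage coord (F i)) ->
  g_sigma_preimage coord (\bigcup_i F i).
Proof. exact: sigma_algebra_bigcup. Qed.

HB.instance Definition _ := @isMeasurable.Build default_measure_display
  'rV[R]_n (g_sigma_preimage coord) rV_set0 rV_setC rV_bigcup.

Lemma measurable_rV_coord (i : 'I_n) :
  measurable_fun [set: 'rV[R]_n] (fun v => v ord0 i : measurableTypeR R).
Proof.
move=> _ Y mY; rewrite setTI; apply: sub_sigma_algebra => /=.
rewrite -bigcup_seq/=; exists i => /=; first by rewrite mem_index_enum.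
by exists Y => //; rewrite setTI.
Qed.

Lemma measurable_fun_rVP d (T : measurableType d) (f : T -> 'rV[R]_n) :
  (forall i, measurable_fun [set: T] (fun t => f t ord0 i : measurableTypeR R)) ->
  measurable_fun [set: T] f.
Proof.
move=> mf _ A mA; rewrite setTI.
suff : preimage_set_system setT f (g_sigma_preimage coord) `<=` measurable.
  by apply; exists A => //; rewrite setTI.
rewrite -g_sigma_preimage_comp; apply: smallest_sub.
  exact: sigma_algebra_measurable.
move=> B; rewrite -bigcup_seq => -[i _] [C mC <-]; exact: mf.
Qed.

End rV_measurable.

Section lebesgue_rV.
Variable R : realType.

Definition cons_rV n (z : measurableTypeR R * 'rV[R]_n) : 'rV[R]_n.+1 :=
  row_mx (z.1)%:M z.2.

Lemma cons_rV0 n z : @cons_rV n z ord0 ord0 = z.1.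
Proof.
rewrite /cons_rV mxE; case: splitP => // j _.
by rewrite (ord1 j) mxE.
Qed.

Lemma cons_rVS n z j : @cons_rV n z ord0 (lift ord0 j) = z.2 ord0 j.
Proof.
rewrite /cons_rV mxE; case: splitP => [[k k1] /= E|k /= [E]].
  by move: k1; rewrite -E.
by congr (z.2 _ _); exact/val_inj.
Qed.

Lemma measurable_cons_rV n : measurable_fun [set: _] (@cons_rV n).
Proof.
apply: measurable_fun_rVP => i; case: (unliftP ord0 i) => [j|] ->.
- under eq_fun do rewrite cons_rVS.
  exact: (measurableT_comp (measurable_rV_coord j)).
- under eq_fun do rewrite cons_rV0.
  exact: measurable_fst.
Qed.

Let uncons_rV n (v : 'rV[R]_n.+1) : measurableTypeR R * 'rV[R]_n :=
  (v ord0 ord0, \row_j v ord0 (lift ord0 j)).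

Let measurable_uncons_rV n : measurable_fun [set: _] (@uncons_rV n).
Proof.
apply/measurable_fun_pairP; split; first exact: measurable_rV_coord.
apply: measurable_fun_rVP => i.
under eq_fun do rewrite mxE.
exact: measurable_rV_coord.
Qed.

Let cons_rVK n : cancel (@cons_rV n) (@uncons_rV n).
Proof.
move=> [x v]; rewrite /uncons_rV cons_rV0; congr pair.
by apply/rowP => j; rewrite mxE cons_rVS.
Qed.

Section step.
Variables (n : nat) (mu : {sigma_finite_measure set 'rV[R]_n -> \bar R}).

Definition lebesgue_rV_step : set 'rV[R]_n.+1 -> \bar R :=
  pushforward (@lebesgue_measure R \x mu)%E (@cons_rV n).

Let step0 : lebesgue_rV_step set0 = 0%E.
Proof. by rewrite /lebesgue_rV_step /pushforward preimage_set0 measure0. Qed.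

Let step_ge0 A : (0 <= lebesgue_rV_step A)%E.
Proof. by rewrite /lebesgue_rV_step /pushforward measure_ge0. Qed.

Let step_sigma_additive : semi_sigma_additive lebesgue_rV_step.
Proof.
have mcons A : measurable A -> measurable (@cons_rV n @^-1` A).
  by move=> mA; rewrite -[X in measurable X]setTI; exact: measurable_cons_rV.
move=> F mF tF mUF; rewrite /lebesgue_rV_step /pushforward preimage_bigcup.
apply: measure_semi_sigma_additive.
- by move=> i; exact: mcons.
- apply/trivIsetP => /= i j _ _ ij; rewrite -preimage_setI.
  by move/trivIsetP : tF => /(_ _ _ _ _ ij) ->//; rewrite preimage_set0.
- by rewrite -preimage_bigcup; exact: mcons.
Qed.

HB.instance Definition _ := isMeasure.Build _ _ _ lebesgue_rV_step
  step0 step_ge0 step_sigma_additive.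

Let step_sigma_finite : sigma_finite setT lebesgue_rV_step.
Proof.
have /sigma_finiteP[F [FT ndF Foo]] := sigma_finiteT (@lebesgue_measure R).
have /sigma_finiteP[G [GT ndG Goo]] := sigma_finiteT mu.
exists (fun i => @uncons_rV n @^-1` (F i `*` G i)).
  apply/seteqP; split=> // v _.
  have [i _ Fi] : (\bigcup_i F i) (v ord0 ord0) by rewrite -FT.
  have [j _ Gj] : (\bigcup_i G i) (@uncons_rV n v).2 by rewrite -GT.
  exists (maxn i j) => //; split => /=.
  - by move: Fi; exact/subsetPset/ndF/leq_maxl.
  - by move: Gj; exact/subsetPset/ndG/leq_maxr.
move=> i; have [mF Fi] := Foo i; have [mG Gi] := Goo i; split.
  rewrite -[X in measurable X]setTI; apply: measurable_uncons_rV => //.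
  exact: measurableX.
rewrite /lebesgue_rV_step /pushforward -comp_preimage.
rewrite (_ : _ \o _ = id) ?preimage_id; last exact/funext/cons_rVK.
by rewrite product_measure1E// lte_mul_pinfty// ge0_fin_numE.
Qed.

HB.instance Definition _ := Measure_isSigmaFinite.Build _ _ _ lebesgue_rV_step
  step_sigma_finite.

End step.

(** Iterated product of [lebesgue_measure]; on the one-point space R^0 it is
    the unit mass. *)
Fixpoint lebesgue_rV n : {sigma_finite_measure set 'rV[R]_n -> \bar R} :=
  match n with
  | 0 => @dirac _ 'rV[R]_0 0 R
  | n'.+1 => lebesgue_rV_step (lebesgue_rV n')
  end.

End lebesgue_rV.

Section fractional_laplacian.
Variables (R : realType) (n : nat).
Implicit Types (x y : 'rV[R]_n) (f : 'rV[R]_n -> R) (alpha gamma : R).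

(** Euclidean norm; the library's norm on ['rV[R]_n] is the sup norm. *)
Definition enorm x : R := Num.sqrt (\sum_(i < n) x ord0 i ^+ 2).

Definition partial (i : 'I_n) f : 'rV[R]_n -> R :=
  fun x => 'D_(delta_mx ord0 i) f x.

Definition partials (s : seq 'I_n) f : 'rV[R]_n -> R := foldr partial f s.

(** ['D_v f x] is a total operator, so that existence of the partial
    derivatives has to be required separately. *)
Definition Ck (k : nat) f : Prop :=
  forall s : seq 'I_n, (size s <= k)%N ->
    continuous (partials s f) /\
    ((size s < k)%N ->
      forall i x, derivable (partials s f) x (delta_mx ord0 i)).

Definition holder_loc gamma f : Prop :=
  forall K : set 'rV[R]_n, compact K ->
    exists C : R, forall x y, K x -> K y ->
      `|f x - f y| <= C * enorm (x - y) `^ gamma.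

Definition Ckh_loc (k : nat) gamma f : Prop :=
  Ck k f /\ forall s : seq 'I_n, size s = k -> holder_loc gamma (partials s f).

(** [C^{m+[alpha],{alpha}+eps}_loc] for some [eps > 0].  These classes shrink
    as [eps] grows, so "arbitrarily small" only says that the Hoelder exponent
    may be taken below 1.  For [0 <= alpha], [Num.truncn alpha] is the integer
    part of [alpha]. *)
Definition frac_regular (m : nat) alpha f : Prop :=
  let fpart := alpha - (Num.truncn alpha)%:R in
  exists eps : R, [/\ 0 < eps, fpart + eps < 1 &
    Ckh_loc (m + Num.truncn alpha) (fpart + eps) f].

Definition L_alpha alpha f : Prop :=
  (lebesgue_rV R n).-integrable setT
    (fun x => (f x / (1 + enorm x `^ (n%:R + alpha)))%:E).

(** Euler's Gamma function, for [0 < s]. *)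
Definition Gamma (s : R) : R :=
  \int[@lebesgue_measure R]_(t in `]0, +oo[) (t `^ (s - 1) * expR (- t)).

(** The constant for which [(-Delta)^{alpha/2}] has Fourier symbol
    [|xi|^alpha], i.e. [2^alpha Gamma((n+alpha)/2) / (pi^{n/2}
    |Gamma(-alpha/2)|)], where [|Gamma(-alpha/2)| = Gamma(1-alpha/2) /
    (alpha/2)] since [0 < alpha < 2]. *)
Definition C_frac alpha : R :=
  alpha * 2 `^ (alpha - 1) * Gamma ((n%:R + alpha) / 2) /
  (pi `^ (n%:R / 2) * Gamma (1 - alpha / 2)).

Definition truncated_fraclap alpha f x (e : R) : R :=
  \int[lebesgue_rV R n]_(y in [set y | e <= enorm (y - x)])
    ((f x - f y) / enorm (x - y) `^ (n%:R + alpha)).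

(** [(-Delta)^{alpha/2}]; the limit exists when
    [frac_regular 0 alpha f] and [L_alpha alpha f]. *)
Definition fraclap alpha f : 'rV[R]_n -> R :=
  fun x => C_frac alpha * lim (truncated_fraclap alpha f x e @[e --> 0^'+]).

Definition neglap f : 'rV[R]_n -> R :=
  fun x => - \sum_(i < n) partial i (partial i f) x.

Definition hfraclap (m : nat) alpha f : 'rV[R]_n -> R :=
  iter m neglap (fraclap alpha f).

Definition is_solution (k l : nat) (alpha beta a b p q : R)
    (u v : 'rV[R]_n -> R) : Prop :=
  [/\ frac_regular (2 * k) alpha u /\ L_alpha alpha u,
      frac_regular (2 * l) beta v /\ L_alpha beta v,
      forall x, hfraclap k alpha u x = enorm x `^ a * v x `^ p,
      forall x, hfraclap l beta v x = enorm x `^ b * u x `^ q &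
      forall x, 0 <= u x /\ 0 <= v x].

End fractional_laplacian.

(* Main.v *)
(** Write [s = 2k + alpha] and [s' = 2l + beta].  If [(-Delta)^{s/2} u = f >= 0],
    testing the equation with [psi (x / t)], [psi] a bump, and moving the whole
    operator onto the bump gives
      [\int_{|x| <= t} f <= C t^{-s} \int u (1 + |x| / t)^{-n-alpha}],
    because [(-Delta)^{alpha/2}] of a test function decays like
    [|x|^{-n-alpha}].  Hence if [u (1 + |x|)^{-g}] is integrable with
    [0 <= g <= n + alpha], then [\int_{|x| <= t} f = O(t^{g - s})]: either
    [g < s], which forces [f = 0], or [f (1 + |x|)^{-e}] is integrable for all
    [e > g - s].  Since [f = |x|^a v^p] with [p >= 1], the latter makes
    [v (1 + |x|)^{-g'}] integrable as soon as
    [p g' > g - s - a + n (p - 1)].  Running the same step for the second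
    equation sends the exponent [g] to [h] with
    [pq h > g - s - a - p (s' + b) + n (pq - 1)], and each of the conditions (i)
    and (ii) says exactly that this map lowers every [g >= s] by a fixed amount;
    (iii) is (ii) with the two equations exchanged.  As [g = n + alpha] is
    admissible by hypothesis, finitely many rounds reach [g < s].  No
    super-polyharmonic property or integral representation is needed. *)

Require Import Defs.
From mathcomp Require Import all_boot all_order all_algebra.
From mathcomp Require Import all_classical all_reals all_analysis measurable_realfun.
From mathcomp Require Import ring lra.
Import Order.TTheory GRing.Theory Num.Theory.
Import numFieldNormedType.Exports.
Set Implicit Arguments.
Unset Strict Implicit.
Unset Printing Implicit Defensive.
Local Open Scope classical_set_scope.
Local Open Scope ring_scope.

(** * Affine maps and Lebesgue measure on row vectors *)

(** Moving the operator onto the bump takes two separate exchanges. The [k] Laplacians move by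
    integration by parts, which requires [flap u] to have [2k] classical partial derivatives
    although nothing is known of the derivatives of [u] at infinity. The fractional part moves by
    Fubini on the symmetrised double integral, which converges absolutely because the operator
    applied to a compactly supported function decays like the weight of [L_alpha]. That decay rate
    is also why every exponent of the iteration has to stay at most [n + alpha], or [n + beta]. The
    bump is [(1 - |x|^2)_+ ^ (2k + 3)]: it has the [2k] derivatives spent on the Laplacians and two
    more, for the second differences under the fractional operator. Radial profiles are functions of
    [|x|^2], so that their derivatives stay sums of products of coordinates and profiles. Weights
    use the sup norm, since cubes have an explicit measure under an iterated product, and weighted
    integrability is read off from growth on dyadic cubes. *)

Lemma scaled_pushforward_measure d d' (T1 : measurableType d)
    (T2 : measurableType d') (R : realType) (r : {nonneg R})
    (m : {measure set T1 -> \bar R}) (f : T1 -> T2) :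
  measurable_fun setT f ->
  exists m' : {measure set T2 -> \bar R},
    forall A, m' A = (r%:num%:E * m (f @^-1` A))%E.
Proof. by move=> mf; unshelve eexists (mscale r (pushforward m f)). Qed.

Section affine.
Context {R : realType}.

(** Uniqueness of Lebesgue measure: the scaled pushforward agrees with it on half-open intervals.
    For [c < 0] the preimage is closed on the left instead of the right, with the same length. *)
Lemma lebesgue_measure_affine (c z : R) (A : set (measurableTypeR R)) :
  c != 0 -> measurable A ->
  lebesgue_measure A =
    (`|c|%:E * lebesgue_measure
      ((fun t : measurableTypeR R => ((c * t + z)%R : measurableTypeR R)) @^-1` A))%E.
Proof.
move=> c0 mA.
pose f (t : measurableTypeR R) : measurableTypeR R := c * t + z.
have mf : measurable_fun setT f.
  by apply: measurable_funD => //; exact: measurable_funM.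
have [m mE] := scaled_pushforward_measure `|c|%:nng (@lebesgue_measure R) mf.
rewrite (@lebesgue_measure_unique R m) ?mE // => _ [[a b] _ <-] /=.
rewrite mE /=.
have [c_gt0|c_lt0] : 0 < c \/ c < 0 by move: c0; rewrite neq_lt => /orP[]; [right|left].
- have -> : f @^-1` `]a, b] = `](a - z) / c, (b - z) / c]%classic.
    apply/seteqP; split => t /=; rewrite !in_itv /= /f ltr_pdivrMr // ler_pdivlMr //.
      by move=> /andP[h1 h2]; apply/andP; split; lra.
    by move=> /andP[h1 h2]; apply/andP; split; lra.
  rewrite !lebesgue_measure_itv /= !lte_fin.
  rewrite ltr_pM2r ?invr_gt0 // ltrD2r; case: ifP => _; last by rewrite mule0.
  rewrite -!EFinB -EFinM gtr0_norm //; congr (_%:E).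
  by field.
- have -> : f @^-1` `]a, b] = `[(b - z) / c, (a - z) / c[%classic.
    apply/seteqP; split => t /=; rewrite !in_itv /= /f ler_ndivrMr // ltr_ndivlMr //.
      by move=> /andP[h1 h2]; apply/andP; split; lra.
    by move=> /andP[h1 h2]; apply/andP; split; lra.
  rewrite !lebesgue_measure_itv /= !lte_fin.
  rewrite ltr_nM2r ?invr_lt0 // ltrD2r; case: ifP => _; last by rewrite mule0.
  rewrite -!EFinB -EFinM ltr0_norm //; congr (_%:E).
  by field.
Qed.

Definition affrV n (c : R) (z : 'rV[R]_n) : 'rV[R]_n -> 'rV[R]_n :=
  fun x => c *: x + z.

Lemma measurable_affrV n c z : measurable_fun setT (@affrV n c z).
Proof.
apply: measurable_fun_rVP => i.
under eq_fun do rewrite !mxE.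
apply: measurable_funD => //; apply: measurable_funM => //.
exact: measurable_rV_coord.
Qed.

(** Induction on the dimension through uniqueness of the product measure: on a rectangle the map
    acts separately on the first coordinate and on the tail, which contribute the factors [|c|] and
    [|c ^+ n|]. *)
Lemma lebesgue_rV_affine n (c : R) (z : 'rV[R]_n) (A : set 'rV[R]_n) :
  c != 0 -> measurable A ->
  lebesgue_rV R n A = (`|c ^+ n|%:E * lebesgue_rV R n (affrV c z @^-1` A))%E.
Proof.
move=> c0; elim: n z A => [|n IH] z A mA.
  rewrite /= normr1 mul1e; congr (dirac _ _).
  by apply/seteqP; split => x; rewrite /= (_ : affrV c z x = x) //; apply/rowP => -[].
pose z' : 'rV[R]_n := \row_j z ord0 (lift ord0 j).
pose f (t : measurableTypeR R) : measurableTypeR R := c * t + z ord0 ord0.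
have mf : measurable_fun setT f.
  by apply: measurable_funD => //; exact: measurable_funM.
pose S (p : measurableTypeR R * 'rV[R]_n) : measurableTypeR R * 'rV[R]_n :=
  (f p.1, affrV c z' p.2).
have mS : measurable_fun setT S.
  apply/measurable_fun_pairP; split.
    exact: (measurableT_comp mf measurable_fst).
  exact: (measurableT_comp (@measurable_affrV n c z') measurable_snd).
have SE p : cons_rV (S p) = affrV c z (cons_rV p).
  apply/rowP => j; case: (unliftP ord0 j) => [i|] ->.
    by rewrite cons_rVS [RHS]mxE [X in _ = X + _]mxE cons_rVS !mxE.
  by rewrite cons_rV0 [RHS]mxE [X in _ = X + _]mxE cons_rV0.
have [m mE] := scaled_pushforward_measure `|c ^+ n.+1|%:nng
  (@lebesgue_measure R \x lebesgue_rV R n)%E mS.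
rewrite /= /lebesgue_rV_step /pushforward.
have mcA : measurable (@cons_rV R n @^-1` A).
  by rewrite -[X in measurable X]setTI; exact: measurable_cons_rV.
rewrite (@product_measure_unique _ _ _ _ _ _ _ m) //; last first.
  move=> B C mB mC; rewrite mE /=.
  have -> : S @^-1` (B `*` C) = (f @^-1` B) `*` (affrV c z' @^-1` C) by [].
  have mfB : measurable (f @^-1` B) by rewrite -[X in measurable X]setTI; exact: mf.
  have maC : measurable (affrV c z' @^-1` C).
    by rewrite -[X in measurable X]setTI; exact: measurable_affrV.
  rewrite product_measure1E // (IH z' C mC) (@lebesgue_measure_affine c (z ord0 ord0) B) //.
  rewrite exprS normrM EFinM -/f.
  by rewrite -!muleA; congr (_ * _)%E; rewrite muleCA.
rewrite mE /=; congr (_ * _)%E.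
by congr (_ _); apply/seteqP; split => p; rewrite /= SE.
Qed.

End affine.

Section cov.
Context {R : realType} (n : nat).
Local Notation mu := (lebesgue_rV R n).
Local Notation E := 'rV[R]_n.
Implicit Types (c : R) (z : E).

Lemma ge0_integral_affrV c z (f : E -> \bar R) :
  c != 0 -> measurable_fun setT f -> (forall x, 0 <= f x)%E ->
  (\int[mu]_x f x = `|c ^+ n|%:E * \int[mu]_x f (c *: x + z)%R)%E.
Proof.
move=> c0 mf f0.
have maff := @measurable_affrV R n c z.
have [m mE] : exists m : {measure set E -> \bar R},
    m = pushforward mu (affrV c z) :> (set E -> \bar R).
  by unshelve eexists (pushforward mu (affrV c z)).
have -> : (\int[mu]_x f x = \int[mscale (`|c ^+ n|%:nng)%R m]_x f x)%E.
  apply: eq_measure_integral => A mA _.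
  by rewrite [RHS](_ : _ = `|(c ^+ n)%R|%:E * m A)%E // mE; exact: lebesgue_rV_affine.
rewrite ge0_integral_mscale //; congr (_ * _)%E.
by rewrite mE ge0_integral_pushforward.
Qed.

Lemma integrable_affrV c z (f : E -> R) :
  c != 0 -> mu.-integrable setT (EFin \o f) ->
  mu.-integrable setT (fun x : E => (f (c *: x + z))%:E).
Proof.
move=> c0 /integrableP[mf If]; have maff := @measurable_affrV R n c z.
have mf' : measurable_fun setT (fun x : E => (f (c *: x + z))%:E).
  exact: (measurableT_comp mf maff).
apply/integrableP; split => //.
have := @ge0_integral_affrV c z (fun x => `|(f x)%:E|%E) c0.
rewrite (_ : (\int[mu]_x _)%E = \int[mu]_x `|(EFin \o f) x|)%E // => h.
move: If; rewrite h; last 2 first.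
  exact: measurableT_comp.
  by move=> x; exact: abse_ge0.
have cn0 : 0 < `|c ^+ n| by rewrite normr_gt0 expf_neq0.
by rewrite -lte_pdivlMl // mulry gtr0_sg ?invr_gt0 // mul1e.
Qed.

Lemma Rintegral_affrV c z (f : E -> R) :
  c != 0 -> mu.-integrable setT (EFin \o f) ->
  \int[mu]_x f x = `|c ^+ n| * \int[mu]_x f (c *: x + z).
Proof.
move=> c0 fi; have maff := @measurable_affrV R n c z.
have mf := measurable_int _ fi.
have fi' := integrable_affrV z c0 fi.
have fin := integrable_fin_num measurableT fi'.
transitivity (fine (`|c ^+ n|%:E * \int[mu]_x (f (c *: (x : E) + z))%:E)%E).
  congr fine; rewrite integralE [in RHS]integralE muleBr //; last first.
    rewrite fin_num_adde_defr //.
    exact: integrable_pos_fin_num.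
  congr (_ - _)%E.
  - rewrite [in RHS](funepos_comp (EFin \o f) (affrV c z)).
    by apply: (@ge0_integral_affrV c z (EFin \o f)^\+%E) => //; exact: measurable_funepos.
  - rewrite [in RHS](funeneg_comp (EFin \o f) (affrV c z)).
    by apply: (@ge0_integral_affrV c z (EFin \o f)^\-%E) => //; exact: measurable_funeneg.
by rewrite fineM.
Qed.

End cov.

(** * Sup norm, Euclidean norm and cubes *)

Section norms.
Context {R : realType} (n : nat).
Local Notation mu := (lebesgue_rV R n).
Local Notation E := 'rV[R]_n.
Implicit Types (x y z : E) (r : R).

Lemma normrV_leP x r : 0 <= r -> (`|x| <= r) <-> (forall i, `|x ord0 i| <= r).
Proof.
move=> r0; rewrite [`|x|]mx_normrE; split.
  move=> /bigmax_leP[_ h] i; exact: (h (ord0, i)).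
by move=> h; apply/bigmax_leP; split => // -[i j] _ /=; rewrite (ord1 i).
Qed.

Lemma normrV_coord x i : `|x ord0 i| <= `|x|.
Proof. by move/normrV_leP : (lexx `|x|) => /(_ (normr_ge0 _)). Qed.

Lemma normr_delta_rV i : `|delta_mx ord0 i : E| <= 1.
Proof.
apply/normrV_leP => // j; rewrite mxE eqxx /=.
by case: (j == i); rewrite ?normr1 ?normr0.
Qed.

Lemma measurable_normrV : measurable_fun setT (fun x : E => `|x|).
Proof.
rewrite (_ : (fun x : E => _) =
    fun x => \big[Num.max/0]_ij `|x ij.1 ij.2|); last first.
  by apply/funext => x; exact: mx_normrE.
elim: (index_enum _) => [|ij s IH].
  by under eq_fun do rewrite big_nil; exact: measurable_cst.
under eq_fun do rewrite big_cons.
apply: measurable_maxr => //.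
apply: measurableT_comp => //; rewrite (ord1 ij.1).
exact: measurable_rV_coord.
Qed.

Lemma measurable_enorm : measurable_fun setT (@enorm R n).
Proof.
rewrite /enorm.
rewrite (_ : (fun x : E => _) = fun x =>
  (\sum_(i < n) x ord0 i ^+ 2) `^ (2^-1)); last first.
  apply/funext => x; rewrite powR12_sqrt //.
  by apply: sumr_ge0 => i _; exact: sqr_ge0.
apply: (measurableT_comp (measurable_powR _)).
elim: (index_enum _) => [|ij s IH].
  by under eq_fun do rewrite big_nil; exact: measurable_cst.
under eq_fun do rewrite big_cons.
apply: measurable_funD => //.
by apply: measurable_funX; exact: measurable_rV_coord.
Qed.

Lemma enorm_ge0 x : 0 <= enorm x.
Proof. exact: sqrtr_ge0. Qed.

Lemma normr_le_enorm x : `|x| <= enorm x.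
Proof.
apply/normrV_leP => [|i]; first exact: enorm_ge0.
rewrite -sqrtr_sqr ler_wsqrtr // (bigD1 i) //= lerDl.
by apply: sumr_ge0 => j _; exact: sqr_ge0.
Qed.

(** The constant [n] in place of the sharp [sqrt n] avoids a root; it rests on [n <= n ^ 2] for
    natural numbers. *)
Lemma enorm_le_normr x : enorm x <= n%:R * `|x|.
Proof.
have h0 : 0 <= n%:R * `|x| by rewrite mulr_ge0.
rewrite -[leRHS]ger0_norm // -sqrtr_sqr ler_wsqrtr //.
have h : \sum_(i < n) x ord0 i ^+ 2 <= n%:R * `|x| ^+ 2.
  rewrite -[X in X%:R * _]card_ord mulr_natl -sumr_const ler_sum // => i _.
  by rewrite -real_normK ?num_real // lerXn2r ?nnegrE // normrV_coord.
apply: le_trans h _; rewrite exprMn ler_wpM2r // ?sqr_ge0 //.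
by case: (n) => [|m]; rewrite ?expr0n // ler_eXnr // ler1n.
Qed.

Lemma enormZ r x : enorm (r *: x) = `|r| * enorm x.
Proof.
rewrite /enorm -sqrtr_sqr -sqrtrM ?sqr_ge0 // mulr_sumr.
by congr Num.sqrt; apply: eq_bigr => i _; rewrite mxE exprMn.
Qed.

Lemma enormN x : enorm (- x) = enorm x.
Proof. by rewrite -scaleN1r enormZ normrN1 mul1r. Qed.

Lemma enorm_gt0 x : (0 < enorm x) = (x != 0).
Proof.
apply/idP/idP.
  apply: contraTneq => ->; rewrite -leNgt (le_trans (enorm_le_normr _)) //.
  by rewrite normr0 mulr0.
by rewrite -normr_gt0 => /lt_le_trans; apply; exact: normr_le_enorm.
Qed.

Lemma enorm0 : enorm (0 : E) = 0.
Proof. by apply/eqP; rewrite eq_le enorm_ge0 andbT leNgt enorm_gt0 eqxx. Qed.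

Lemma measurable_cube r : measurable [set x : E | `|x| <= r].
Proof.
rewrite (_ : [set _ | _] = (fun x : E => `|x|) @^-1` `]-oo, r]%classic).
  by rewrite -[X in measurable X]setTI; apply: measurable_normrV.
by apply/seteqP; split => x /=; rewrite in_itv.
Qed.

End norms.

Lemma lebesgue_rV_cube (R : realType) n (r : R) : 0 <= r ->
  lebesgue_rV R n [set x | `|x| <= r] = ((2 * r) ^+ n)%:E.
Proof.
move=> r0; elim: n => [|n IH].
  rewrite expr0 /= diracE mem_set //=.
  by apply/normrV_leP => // -[].
rewrite /= /lebesgue_rV_step /pushforward.
rewrite (_ : _ @^-1` _ = `[- r, r]%classic `*` [set x | `|x| <= r]).
  rewrite product_measure1E //; last exact: measurable_cube.
  rewrite IH exprS EFinM; congr (_ * _)%E.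
  apply: (etrans (lebesgue_measure_itv _)); rewrite /= lte_fin.
  case: ltP => rr; first by rewrite -EFinB; congr (_)%:E; lra.
  by congr (_)%:E; lra.
apply/seteqP; split => -[t x] /=; rewrite in_itv /= -ler_norml.
  move=> /(normrV_leP _ r0) h; split.
    by have := h ord0; rewrite cons_rV0.
  by apply/normrV_leP => // i; have := h (lift ord0 i); rewrite cons_rVS.
move=> [tr /(normrV_leP _ r0) h]; apply/normrV_leP => // i.
by case: (unliftP ord0 i) => [j|] ->; rewrite ?cons_rVS ?cons_rV0.
Qed.

(** * Integrability of real-valued functions *)

Section rint.
Context d (T : measurableType d) (R : realType) (m : {measure set T -> \bar R}).
Implicit Types (f g : T -> R).

Definition rint f := m.-integrable setT (EFin \o f).

Lemma rint_meas f : rint f -> measurable_fun setT f.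
Proof. by move=> /integrableP[/measurable_EFinP]. Qed.

Lemma rint_dom g f : measurable_fun setT f -> (forall x, `|f x| <= g x) ->
  rint g -> rint f.
Proof.
move=> mf fg; apply: le_integrable => //; first exact/measurable_EFinP.
by move=> x _; rewrite /= lee_fin (le_trans (fg x)) // ler_norm.
Qed.

Lemma eq_rint f g : f =1 g -> rint f -> rint g.
Proof. by move=> /funext ->. Qed.

Lemma rintZl c f : rint f -> rint (fun x => c * f x).
Proof.
move=> fi; rewrite /rint (_ : _ \o _ = fun x => (c%:E * (EFin \o f) x)%E) //.
exact: integrableZl.
Qed.

Lemma rintD f g : rint f -> rint g -> rint (fun x => f x + g x).
Proof. by move=> fi gi; exact: (integrableD measurableT fi gi). Qed.

Lemma rintB f g : rint f -> rint g -> rint (fun x => f x - g x).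
Proof. by move=> fi gi; exact: (integrableB measurableT fi gi). Qed.

Lemma rint_norm f : rint f -> rint (fun x => `|f x|).
Proof. by move=> fi; exact: (integrable_abse fi). Qed.

Lemma rint_lty f : measurable_fun setT f -> (forall x, 0 <= f x) ->
  (\int[m]_x (f x)%:E < +oo)%E -> rint f.
Proof.
move=> mf f0 fi; apply/integrableP; split; first exact/measurable_EFinP.
rewrite (eq_integral (EFin \o f)) // => x _.
by rewrite /= ger0_norm.
Qed.

Lemma rint_EFin f : rint f -> (\int[m]_x (f x)%:E = (\int[m]_x f x)%:E)%E.
Proof. by move=> fi; rewrite fineK //; exact: integrable_fin_num. Qed.

Lemma Rint_le f g : rint f -> rint g -> (forall x, f x <= g x) ->
  \int[m]_x f x <= \int[m]_x g x.
Proof. by move=> fi gi fg; apply: le_Rintegral. Qed.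

Lemma Rint_norm_le f g : rint f -> rint g -> (forall x, `|f x| <= g x) ->
  `|\int[m]_x f x| <= \int[m]_x g x.
Proof.
move=> fi gi fg; apply: le_trans (le_normr_Rintegral _ fi) _ => //.
by apply: Rint_le => //; exact: rint_norm.
Qed.

Lemma RintZl c f : rint f -> \int[m]_x (c * f x) = c * \int[m]_x f x.
Proof. by move=> fi; exact: RintegralZl. Qed.

Lemma RintD f g : rint f -> rint g ->
  \int[m]_x (f x + g x) = \int[m]_x f x + \int[m]_x g x.
Proof. by move=> fi gi; exact: RintegralD. Qed.

Lemma RintB f g : rint f -> rint g ->
  \int[m]_x (f x - g x) = \int[m]_x f x - \int[m]_x g x.
Proof. by move=> fi gi; exact: RintegralB. Qed.

(** The series of the functions [c j * f * \1_(A j)] dominates [f * g], since at each point a single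
    term already does, and its integral is at most a geometric series. The sets [A j] may
    overlap. *)
Lemma rint_series (f g : T -> R) (A : nat -> set T) (c : nat -> R) (D rho : R) :
  measurable_fun setT f -> measurable_fun setT g ->
  (forall x, 0 <= f x) -> (forall x, 0 <= g x) ->
  (forall j, measurable (A j)) -> (forall j, 0 <= c j) ->
  0 <= rho < 1 ->
  (forall x, g x != 0 -> exists j, A j x /\ g x <= c j) ->
  (forall j, (\int[m]_(x in A j) (c j * f x)%:E <= (D * rho ^+ j)%:E)%E) ->
  rint (fun x => f x * g x).
Proof.
move=> mf mg f0 g0 mA c0 /andP[rho0 rho1] gA h.
apply: rint_lty => [|x|]; first exact: measurable_funM.
  exact: mulr_ge0.
pose F j x := ((c j * f x) * \1_(A j) x)%:E.
have F0 j x : (0 <= F j x)%E by rewrite lee_fin !mulr_ge0.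
have mF j : measurable_fun setT (F j).
  apply/measurable_EFinP; apply: measurable_funM; last exact: measurable_indic.
  exact: measurable_funM.
apply: (@le_lt_trans _ _ (\int[m]_x (\sum_(0 <= j <oo) F j x))%E).
  apply: ge0_le_integral => //.
  - by move=> x _; rewrite lee_fin mulr_ge0.
  - by apply/measurable_EFinP; exact: measurable_funM.
  - exact: ge0_emeasurable_sum.
  - move=> x _; have [gx0|/gA[j [Aj gc]]] := eqVneq (g x) 0.
      by rewrite gx0 mulr0; exact: nneseries_ge0.
    apply: (@le_trans _ _ (F j x)).
      by rewrite lee_fin indicE mem_set // mulr1 mulrC ler_wpM2r.
    by rewrite (@nneseriesD1 _ _ j) // leeDl // nneseries_ge0.
rewrite integral_nneseries //.
apply: (@le_lt_trans _ _ (\sum_(0 <= j <oo) (D * rho ^+ j)%:E)%E).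
  apply: lee_nneseries => [j _ _|j _]; first exact: integral_ge0.
  apply: le_trans (h j); rewrite le_eqVlt; apply/orP; left; apply/eqP.
  rewrite [RHS]integral_mkcond; apply: eq_integral => x _.
  rewrite /F patchE indicE; case: ifPn => _; first by rewrite mulr1.
  by rewrite mulr0.
have h2 : ((fun n => (series (geometric D rho) n)%:E) @ \oo --> (D * (1 - rho)^-1)%:E)%E.
  by apply: cvg_EFin; [exact: nearW|apply: cvg_geometric_series; rewrite ger0_norm].
rewrite (_ : limn _ = (D * (1 - rho)^-1)%:E) ?ltry //.
apply/cvg_lim => //; move: h2; apply: cvg_trans; apply: near_eq_cvg.
by near=> n; rewrite /series /= sumEFin.
Unshelve. all: by end_near. Qed.

End rint.

(** * Power weights and dyadic integrability *)

Section kernels.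
Context {R : realType}.

Lemma powR_lt1 (a x : R) : 1 < a -> x < 0 -> a `^ x < 1.
Proof.
move=> a1 x0; rewrite /powR gt_eqF ?(lt_trans _ a1) // expR_lt1.
by rewrite nmulr_rlt0 // ln_gt0.
Qed.

Lemma ler_powRN (x y e : R) : 0 < x -> x <= y -> 0 <= e -> y `^ (- e) <= x `^ (- e).
Proof.
move=> x0 xy e0; rewrite !powRN lef_pV2 ?posrE ?powR_gt0 ?(lt_le_trans x0) //.
by rewrite ge0_ler_powR // nnegrE ltW // (lt_le_trans x0).
Qed.

Lemma powR_invN (x y : R) : 0 <= x -> (x^-1) `^ (- y) = x `^ y.
Proof. by move=> x0; rewrite -powR_inv1 // -powRrM mulN1r opprK. Qed.

Lemma powR_expn (x y : R) j : 0 <= x -> (x ^+ j) `^ y = (x `^ y) ^+ j.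
Proof.
by move=> x0; rewrite -powR_mulrn // -powRrM mulrC powRrM powR_mulrn // powR_ge0.
Qed.

Lemma dyadic_bracket (r : R) : 1 <= r ->
  exists j : nat, 2 ^+ j <= r <= 2 ^+ j.+1.
Proof.
move=> r1; have ex : exists j : nat, r < 2 ^+ j.
  exists (Num.truncn r).+1; apply: (lt_trans (truncnS_gt r)).
  by rewrite -natrX ltr_nat ltn_expl.
case: (ex_minnP ex) => -[|j]; first by rewrite expr0 ltNge r1.
move=> rj jmin; exists j; rewrite (ltW rj) andbT leNgt; apply/negP => /jmin.
by rewrite ltnn.
Qed.

Variable n : nat.
Local Notation mu := (lebesgue_rV R n).
Local Notation E := 'rV[R]_n.

(** Stand-in for the Japanese bracket [(1 + |x|^2)^(1/2)], in the norm whose balls are cubes. *)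
Definition jb (x : E) : R := 1 + `|x|.

Lemma jb_ge1 x : 1 <= jb x. Proof. by rewrite lerDl. Qed.
Lemma jb_gt0 x : 0 < jb x. Proof. exact: lt_le_trans (jb_ge1 x). Qed.
Lemma jb_ge0 x : 0 <= jb x. Proof. exact: ltW (jb_gt0 x). Qed.

Lemma measurable_jb : measurable_fun setT jb.
Proof. by apply: measurable_funD => //; exact: measurable_normrV. Qed.

Lemma measurable_jb_powR e : measurable_fun setT (fun x => jb x `^ e).
Proof. exact: (measurableT_comp (measurable_powR _) measurable_jb). Qed.

Definition cube (r : R) : set E := [set x : E | `|x| <= r].

(** Where [jb x] lies between [2 ^ j] and [2 ^ (j + 1)] the weight is at most [2 ^ (- e j)], so
    growth of order [2 ^ (g j)] on cubes leaves the ratio [2 ^ (g - e) < 1]. The shell sits in the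
    cube of index [j + 1], which costs one factor [2 ^ g]. *)
Lemma rint_dyadic (f : E -> R) (C g e : R) :
  measurable_fun setT f -> (forall x, 0 <= f x) -> 0 <= e -> g < e ->
  (forall j : nat, \int[mu]_(x in cube (2 ^+ j)) (f x)%:E
       <= (C * (2 `^ g) ^+ j)%:E)%E ->
  rint mu (fun x => f x * jb x `^ (- e)).
Proof.
move=> mf f0 e0 ge h.
apply: (@rint_series _ _ _ _ f _ (fun j => cube (2 ^+ j.+1))
  (fun j => (2 `^ (- e)) ^+ j) (C * 2 `^ g) (2 `^ (g - e))) => //.
- exact: measurable_jb_powR.
- by move=> x; exact: powR_ge0.
- by move=> j; exact: measurable_cube.
- by apply/andP; split; [exact: powR_ge0|rewrite powR_lt1 ?ltr1n // subr_lt0].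
- move=> x _; have [j /andP[j1 j2]] := dyadic_bracket (jb_ge1 x).
  exists j; split; first by rewrite /cube /= (le_trans _ j2) // lerDr.
  by rewrite -powR_expn // ler_powRN // exprn_gt0.
- move=> j.
  rewrite (_ : (\int[mu]_(x in _) _)%E = ((2 `^ (- e)) ^+ j)%:E *
    \int[mu]_(x in cube (2 ^+ j.+1)) (f x)%:E)%E; last first.
    rewrite -ge0_integralZl_EFin //.
    + exact: measurable_cube.
    + by move=> x _; rewrite lee_fin.
    + by apply/measurable_EFinP; exact: measurable_funTS.
  apply: (@le_trans _ _ (((2 `^ (- e)) ^+ j)%:E * (C * 2 `^ g ^+ j.+1)%:E)%E).
    by apply: lee_wpmul2l => //; rewrite lee_fin exprn_ge0 // powR_ge0.
  rewrite -EFinM lee_fin powRD ?(@eqr_nat R 2 0) ?implybT // exprMn exprS.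
  by rewrite le_eqVlt; apply/orP; left; apply/eqP; ring.
Qed.

Lemma rint_jb d : 0 < d -> rint mu (fun x => jb x `^ (- (n%:R + d))).
Proof.
move=> d0; apply: (@eq_rint _ _ _ _ (fun x => 1 * jb x `^ (- (n%:R + d)))).
  by move=> x; rewrite mul1r.
apply: (@rint_dyadic _ (2 ^+ n) n%:R) => //.
- by rewrite addr_ge0 // ltW.
- by rewrite ltrDl.
- move=> j; rewrite integral_cst; last exact: measurable_cube.
  rewrite mul1e [leLHS]lebesgue_rV_cube // lee_fin powR_mulrn // exprMn.
  by rewrite -exprM -exprM mulnC.
Qed.

(** The dyadic argument at the origin: the cube of radius [2 ^ (- j)] has measure of order
    [2 ^ (- n j)] and on its outer shell the integrand is at most [2 ^ ((n - d) (j + 1))], which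
    leaves the ratio [2 ^ (- d)]. *)
Lemma rint_near0 d : 0 < d <= n%:R ->
  rint mu (fun z : E => `|z| `^ (d - n%:R) * \1_(cube 1) z).
Proof.
move=> /andP[d0 dn].
have mc r : measurable (cube r) by exact: measurable_cube.
apply: (@eq_rint _ _ _ _ (fun z : E => 1 * (`|z| `^ (d - n%:R) * \1_(cube 1) z))).
  by move=> x; rewrite mul1r.
apply: (@rint_series _ _ _ _ (cst 1) _ (fun j => cube ((2^-1) ^+ j))
  (fun j => (2 `^ (n%:R - d)) ^+ j.+1) (2 ^+ n * 2 `^ (n%:R - d)) (2 `^ (- d))) => //.
- apply: measurable_funM; last exact: measurable_indic.
  exact: (measurableT_comp (measurable_powR _) (@measurable_normrV R n)).
- by apply/andP; split; [exact: powR_ge0|rewrite powR_lt1 ?ltr1n // oppr_lt0].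
- move=> z; rewrite mulf_eq0 negb_or indicE pnatr_eq0 eqb0 negbK => /andP[h zc].
  move: (zc); rewrite inE /cube /= => z1; rewrite zc mulr1.
  have [->|z0] := eqVneq z 0.
    exists 0%N; split; first by rewrite /= normr0.
    (* A power of [0] is [1] when the exponent vanishes, here for [d = n], and [0] otherwise. *)
    rewrite normr0 expr1; have [->|dn'] := eqVneq (d - n%:R) 0.
      by rewrite powRr0 -[leLHS](powRr0 2) ler_powR ?ler1n // subr_ge0.
    by rewrite powR0 // powR_ge0.
  have [|j /andP[j1 j2]] := @dyadic_bracket (`|z|^-1).
    by rewrite invf_ge1 // normr_gt0.
  exists j; split.
    by rewrite -[leLHS]invrK exprVn lef_pV2 // posrE ?exprn_gt0 // invr_gt0 normr_gt0.
  rewrite -opprB -powR_expn // -[leRHS]powR_invN ?exprn_ge0 //.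
  rewrite ler_powRN ?invr_gt0 ?exprn_gt0 ?subr_ge0 //.
  by rewrite -[leRHS]invrK lef_pV2 // posrE ?exprn_gt0 // invr_gt0 normr_gt0.
- move=> j; rewrite (eq_integral (cst ((2 `^ (n%:R - d)) ^+ j.+1)%:E)); last first.
    by move=> x _; rewrite /= mulr1.
  rewrite integral_cst; last exact: mc.
  rewrite [X in (_ * X)%E]lebesgue_rV_cube ?exprn_ge0 // -EFinM lee_fin.
  rewrite exprMn -exprM [X in 2^-1 ^+ X]mulnC exprM.
  have -> : 2 `^ (- d) = 2 `^ (n%:R - d) * (2^-1) ^+ n.
    rewrite -[2^-1 ^+ n]powR_mulrn // -powR_inv1 // -powRrM mulN1r -powRD.
      by congr (_ `^ _); ring.
    by rewrite (@eqr_nat R 2 0) implybT.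
  rewrite exprMn exprS.
  by rewrite le_eqVlt; apply/orP; left; apply/eqP; ring.
Qed.

End kernels.

(** * The symmetrised fractional Laplacian *)

Section translation.
Context {R : realType} (n : nat).
Local Notation mu := (lebesgue_rV R n).
Local Notation E := 'rV[R]_n.
Implicit Types (x z : E) (f : E -> R).

Lemma measurable_addl x : measurable_fun setT (fun z : E => x + z).
Proof.
rewrite (_ : (fun z : E => _) = affrV 1 x); first exact: measurable_affrV.
by apply/funext => z; rewrite /affrV scale1r addrC.
Qed.

Lemma measurable_subl x : measurable_fun setT (fun z : E => x - z).
Proof.
rewrite (_ : (fun z : E => _) = affrV (-1) x); first exact: measurable_affrV.
by apply/funext => z; rewrite /affrV scaleN1r addrC.
Qed.

Lemma rint_addl x f : rint mu f -> rint mu (fun z => f (x + z)).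
Proof.
move=> /(integrable_affrV x (oner_neq0 _)); apply: eq_rint => z.
by rewrite scale1r addrC.
Qed.

Lemma rint_subl x f : rint mu f -> rint mu (fun z => f (x - z)).
Proof.
have h : (-1 : R) != 0 by rewrite oppr_eq0 oner_neq0.
move=> /(integrable_affrV x h); apply: eq_rint => z.
by rewrite scaleN1r addrC.
Qed.

Lemma Rint_addl x f : rint mu f -> \int[mu]_z f (x + z) = \int[mu]_z f z.
Proof.
move=> /(Rintegral_affrV x (oner_neq0 _)) ->.
rewrite expr1n normr1 mul1r; apply: eq_Rintegral => z _.
by rewrite scale1r addrC.
Qed.

Lemma Rint_subl x f : rint mu f -> \int[mu]_z f (x - z) = \int[mu]_z f z.
Proof.
have h : (-1 : R) != 0 by rewrite oppr_eq0 oner_neq0.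
move=> /(Rintegral_affrV x h) ->.
rewrite normrX normrN1 expr1n mul1r; apply: eq_Rintegral => z _.
by rewrite scaleN1r addrC.
Qed.

Lemma measurable_add_pair : measurable_fun setT (fun p : E * E => p.1 + p.2).
Proof.
apply: measurable_fun_rVP => i; under eq_fun do rewrite mxE.
by apply: measurable_funD;
  [exact: (measurableT_comp (measurable_rV_coord i) measurable_fst)|
   exact: (measurableT_comp (measurable_rV_coord i) measurable_snd)].
Qed.

Lemma measurable_sub_pair : measurable_fun setT (fun p : E * E => p.1 - p.2).
Proof.
apply: measurable_fun_rVP => i; under eq_fun do rewrite !mxE.
by apply: measurable_funB;
  [exact: (measurableT_comp (measurable_rV_coord i) measurable_fst)|
   exact: (measurableT_comp (measurable_rV_coord i) measurable_snd)].
Qed.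

End translation.

Section frac.
Context {R : realType} (n : nat) (al : R).
Hypothesis al0 : 0 < al.
Local Notation mu := (lebesgue_rV R n).
Local Notation E := 'rV[R]_n.
Implicit Types (x y z : E) (f : E -> R).

Definition fker (z : E) : R := (enorm z `^ (n%:R + al))^-1.

Definition sdiff f x z : R := 2 * f x - f (x + z) - f (x - z).

(** [(-Delta)^{al/2}] up to its constant: symmetrising in [z] replaces the
    principal value by an absolutely convergent integral. *)
Definition flap f x : R := 2^-1 * \int[mu]_z (sdiff f x z * fker z).

Definition jw f x : R := `|f x| * jb x `^ (- (n%:R + al)).

(** [L_alpha] with its weight rewritten in the sup norm. *)
Definition wint f := measurable_fun setT f /\ rint mu (jw f).

Let na0 : 0 < n%:R + al. Proof. by rewrite ltr_wpDl. Qed.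

Lemma fker_ge0 z : 0 <= fker z.
Proof. by rewrite invr_ge0 powR_ge0. Qed.

Lemma fkerN z : fker (- z) = fker z.
Proof. by rewrite /fker enormN. Qed.

Lemma measurable_fker : measurable_fun setT fker.
Proof.
rewrite (_ : fker = fun z => enorm z `^ (- (n%:R + al))); last first.
  by apply/funext => z; rewrite powRN.
exact: (measurableT_comp (measurable_powR _) (@measurable_enorm R n)).
Qed.

Lemma measurable_sdiff f x : measurable_fun setT f ->
  measurable_fun setT (sdiff f x).
Proof.
move=> mf; apply: measurable_funB; first apply: measurable_funB => //.
- exact: (measurableT_comp mf (measurable_addl x)).
- exact: (measurableT_comp mf (measurable_subl x)).
Qed.

(** Away from [z = 0] one has [1 + |x + z| <= 1 + |r| + |z| <= B |z|] with [B = (1 + |r|) / e + 1].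
    So the kernel is controlled by the weight of [L_alpha] at the shifted point, uniformly for [x]
    in a cube. *)
Lemma fker_far (e r : R) : 0 < e -> exists2 A, 0 <= A &
  forall x z, `|x| <= r -> e <= enorm z ->
    fker z <= A * jb (x + z) `^ (- (n%:R + al)).
Proof.
move=> e0; pose B := (1 + `|r|) / e + 1.
have B0 : 0 < B by rewrite ltr_wpDl // divr_ge0 ?addr_ge0 // ltW.
exists (B `^ (n%:R + al)); first exact: powR_ge0.
move=> x z xr ez; have z0 : 0 < enorm z by exact: lt_le_trans ez.
have h : jb (x + z) <= B * enorm z.
  apply: (@le_trans _ _ ((1 + `|r|) + enorm z)).
    rewrite /jb -addrA lerD2l (le_trans (ler_normD _ _)) // lerD //.
      by rewrite (le_trans xr) // ler_norm.
    exact: normr_le_enorm.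
  rewrite mulrDl mul1r lerD2r mulrAC ler_pdivlMr // ler_wpM2l //.
rewrite /fker powRN ler_pdivlMr ?powR_gt0 ?jb_gt0 //.
rewrite ler_pdivrMl ?powR_gt0 // mulrC -powRM ?(ltW B0) ?enorm_ge0 //.
by rewrite ge0_ler_powR ?nnegrE ?jb_ge0 ?(ltW na0) // mulr_ge0 ?enorm_ge0 // ltW.
Qed.

Definition near_ker (th : R) z : R := `|z| `^ th * fker z * \1_(@cube R n 1) z.

(** As [fker] is at most [|z| ^ (- (n + al))], the integrand is at most [|z| ^ (d - n)] with
    [d = th - al]; the two bounds on [th] are the conditions [0 < d <= n] of [rint_near0]. *)
Lemma rint_near_ker th : al < th <= n%:R + al -> rint mu (near_ker th).
Proof.
move=> /andP[t1 t2].
apply: (@rint_dom _ _ _ _ (fun z : E => `|z| `^ ((th - al) - n%:R) * \1_(cube 1) z)).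
- rewrite /near_ker; apply: measurable_funM; last first.
    by apply: measurable_indic; exact: measurable_cube.
  apply: measurable_funM; last exact: measurable_fker.
  exact: (measurableT_comp (measurable_powR _) (@measurable_normrV R n)).
- move=> z; rewrite ger0_norm; last by rewrite !mulr_ge0 ?powR_ge0 ?fker_ge0.
  rewrite /near_ker ler_wpM2r //.
  have [->|z0] := eqVneq z 0.
    by rewrite /fker enorm0 [X in X^-1]powR0 ?invr0 ?mulr0 ?powR_ge0 // gt_eqF.
  have nz0 : 0 < `|z| by rewrite normr_gt0.
  rewrite (_ : th - al - n%:R = th + - (n%:R + al)); last by ring.
  rewrite powRD; last by rewrite (gt_eqF nz0) implybT.
  rewrite ler_wpM2l ?powR_ge0 // /fker -powRN ler_powRN ?(ltW na0) //.
  exact: normr_le_enorm.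
- by apply: rint_near0; apply/andP; split; lra.
Qed.

Lemma jw_ge0 f x : 0 <= jw f x.
Proof. by rewrite mulr_ge0 ?powR_ge0. Qed.

Lemma sdiff_majorant (r : R) : exists2 A, 0 <= A & forall f (C M th : R) x,
  `|x| <= r -> `|f x| <= M ->
  (forall z, `|z| <= 1 -> `|sdiff f x z| <= C * `|z| `^ th) ->
  forall z, `|sdiff f x z * fker z| <= C * near_ker th z +
    A * (2 * M * jb z `^ (- (n%:R + al)) + jw f (x + z) + jw f (x - z)).
Proof.
have [A1 A10 h1] := @fker_far 1 r ltr01.
have [A2 A20 h2] := @fker_far 1 0 ltr01.
exists (A1 + A2); first exact: addr_ge0.
move=> f C M th x xr fM hC z.
have M0 : 0 <= M by apply: le_trans fM.
have tail0 : 0 <= 2 * M * jb z `^ (- (n%:R + al)).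
  by rewrite !mulr_ge0 ?powR_ge0.
rewrite normrM (ger0_norm (fker_ge0 z)) /near_ker indicE.
have [zc|zc] := boolP (z \in cube 1).
  rewrite mulr1 mulrA; apply: ler_wpDr.
    by rewrite mulr_ge0 ?addr_ge0 ?jw_ge0.
  rewrite ler_wpM2r ?fker_ge0 // hC //.
  by move: zc; rewrite inE.
rewrite !mulr0 add0r.
have z1 : 1 <= enorm z.
  have : 1 < `|z|.
    by rewrite ltNge; apply: contra zc => zz; rewrite inE.
  by move/ltW/le_trans; apply; exact: normr_le_enorm.
have k1 : fker z <= (A1 + A2) * jb (x + z) `^ (- (n%:R + al)).
  apply: le_trans (h1 x z xr z1) _; rewrite ler_wpM2r ?powR_ge0 //.
  by rewrite lerDl.
have k2 : fker z <= (A1 + A2) * jb (x - z) `^ (- (n%:R + al)).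
  rewrite -fkerN.
  apply: le_trans (h1 x (- z) xr _) _; first by rewrite enormN.
  by rewrite ler_wpM2r ?powR_ge0 // lerDl.
have k3 : fker z <= (A1 + A2) * jb z `^ (- (n%:R + al)).
  have := h2 0 z; rewrite normr0 add0r => /(_ (lexx _) z1) /le_trans; apply.
  by rewrite ler_wpM2r ?powR_ge0 // lerDr.
apply: (@le_trans _ _ ((2 * M + `|f (x + z)| + `|f (x - z)|) * fker z)).
  rewrite ler_wpM2r ?fker_ge0 // /sdiff.
  apply: le_trans (ler_normB _ _) _; rewrite lerD2r.
  apply: le_trans (ler_normB _ _) _; rewrite lerD2r.
  by rewrite normrM ger0_norm // ler_wpM2l.
move: (A1 + A2) k1 k2 k3 => A k1 k2 k3.
rewrite mulrDl [X in X + _ <= _]mulrDl mulrDr [in leRHS]mulrDr /jw.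
apply: lerD; first apply: lerD.
- apply: le_trans (ler_wpM2l _ k3) _; first by rewrite mulr_ge0.
  by rewrite mulrCA.
- by apply: le_trans (ler_wpM2l _ k1) _ => //; rewrite mulrCA.
- by apply: le_trans (ler_wpM2l _ k2) _ => //; rewrite mulrCA.
Qed.

Lemma rint_majorant f (C M th A : R) x : al < th <= n%:R + al -> wint f ->
  rint mu (fun z => C * near_ker th z +
    A * (2 * M * jb z `^ (- (n%:R + al)) + jw f (x + z) + jw f (x - z))).
Proof.
move=> hth [mf wf]; apply: rintD; first exact/rintZl/rint_near_ker.
apply: rintZl; apply: rintD; first apply: rintD.
- exact/rintZl/rint_jb.
- exact: rint_addl.
- exact: rint_subl.
Qed.

(** By translation invariance the right-hand side is free of [x]; the locally uniform bound on the
    integrals defining [flap] rests on this. *)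
Lemma Rint_majorant f (C M th A : R) x : al < th <= n%:R + al -> wint f ->
  \int[mu]_z (C * near_ker th z +
    A * (2 * M * jb z `^ (- (n%:R + al)) + jw f (x + z) + jw f (x - z))) =
  C * \int[mu]_z near_ker th z +
  A * (2 * M * (\int[mu]_z jb z `^ (- (n%:R + al))) + 2 * \int[mu]_z jw f z).
Proof.
move=> hth [mf wf].
have i1 := rint_near_ker hth.
have i2 := @rint_jb R n _ al0.
have i3 := rint_addl x wf.
have i4 := rint_subl x wf.
have j2 := rintZl (2 * M) i2.
have j3 := rintD j2 i3.
have j4 := rintD j3 i4.
rewrite (RintD (rintZl C i1) (rintZl A j4)) (RintZl C i1) (RintZl A j4).
rewrite (RintD j3 i4) (RintD j2 i3) (RintZl _ i2) (Rint_addl x wf) (Rint_subl x wf).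
by rewrite -addrA -mulr2n [2 * (Rintegral _ _ _)]mulr_natl.
Qed.

End frac.

(** * The principal value as an absolutely convergent integral *)

Section dct.
Context d (T : measurableType d) (R : realType) (m : {measure set T -> \bar R}).

Lemma Rint_dct (h : nat -> T -> R) (h' g : T -> R) :
  (forall k, measurable_fun setT (h k)) -> measurable_fun setT h' ->
  (forall x, h k x @[k --> \oo] --> h' x) ->
  (forall k x, `|h k x| <= g x) -> rint m g ->
  \int[m]_x h k x @[k --> \oo] --> \int[m]_x h' x.
Proof.
move=> mh mh' hh hg gi.
have h'g x : `|h' x| <= g x.
  by apply: (cvgr_to_le (cvg_norm (hh x))); exact: nearW.
have ih' : rint m h' by apply: rint_dom gi.
apply: fine_cvg; rewrite -rint_EFin //.
apply: (@dominated_cvg _ _ _ m setT measurableT (fun k x => (h k x)%:E) _ (EFin \o g)) => //.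
- by move=> k; exact/measurable_EFinP.
- by move=> x _; apply: cvg_EFin; [exact: nearW|exact: hh].
- by move=> k x _; rewrite lee_fin.
Qed.

End dct.

Section fraclapE.
Context {R : realType} (n : nat) (al : R).
Hypothesis al0 : 0 < al.
Local Notation mu := (lebesgue_rV R n).
Local Notation E := 'rV[R]_n.
Implicit Types (x y z : E) (f : E -> R).

Definition offball (e : R) : set E := [set z | e <= enorm z].

Lemma measurable_offball e : measurable (offball e).
Proof.
rewrite (_ : offball e = (@enorm R n) @^-1` `[e, +oo[%classic).
  by rewrite -[X in measurable X]setTI; apply: measurable_enorm.
by apply/seteqP; split => x /=; rewrite in_itv /= ?andbT.
Qed.

(** The truncated region is symmetric about [x]: the substitutions [y = x + z] and [y = x - z] give
    the same value, and their average is the second difference. *)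
Lemma truncated_fraclapE f x e : wint al f -> 0 < e ->
  truncated_fraclap al f x e =
  2^-1 * \int[mu]_z (sdiff f x z * fker al z * \1_(offball e) z).
Proof.
move=> [mf wf] e0.
pose G y := (f x - f y) * fker al (x - y) * \1_(offball e) (x - y).
have mG : measurable_fun setT G.
  apply: measurable_funM; first apply: measurable_funM.
  - exact: measurable_funB.
  - exact: (measurableT_comp (measurable_fker al) (measurable_subl x)).
  - apply: (measurableT_comp _ (measurable_subl x)).
    by apply: measurable_indic; exact: measurable_offball.
have [A A0 hA] := fker_far n al0 `|x| e0.
have iG : rint mu G.
  apply: (@rint_dom _ _ _ _ (fun y => A * `|f x| * jb y `^ (- (n%:R + al)) + A * jw al f y)) => //.
    move=> y; rewrite /G !normrM (ger0_norm (fker_ge0 _ _)) indicE.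
    have [xy|xy] := boolP (_ \in _); last first.
      by rewrite normr0 mulr0 addr_ge0 ?mulr_ge0 ?powR_ge0 ?jw_ge0.
    move: xy; rewrite inE /offball /= -enormN opprB => exy.
    have := hA x (y - x) (lexx _) exy; rewrite [x + _]addrC subrK -fkerN opprB => hk.
    rewrite normr1 mulr1; apply: (@le_trans _ _ ((`|f x| + `|f y|) * fker al (x - y))).
      by rewrite ler_wpM2r ?fker_ge0 // ler_normB.
    apply: le_trans (ler_wpM2l _ hk) _; first exact: addr_ge0.
    by rewrite /jw le_eqVlt; apply/orP; left; apply/eqP; ring.
  by apply: rintD; apply: rintZl => //; exact: rint_jb.
have tE : truncated_fraclap al f x e = \int[mu]_y G y.
  rewrite /truncated_fraclap Rintegral_mkcond; apply: eq_Rintegral => y _.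
  rewrite patchE /G indicE (_ : (y \in _) = (x - y \in offball e)).
    by case: ifP => _; rewrite ?mulr1 ?mulr0.
  by apply/idP/idP; rewrite !inE /offball /= -(enormN (x - y)) opprB.
have e1 : \int[mu]_z G (x + z) = \int[mu]_y G y by exact: Rint_addl.
have e2 : \int[mu]_z G (x - z) = \int[mu]_y G y by exact: Rint_subl.
have e12 : \int[mu]_z G (x + z) + \int[mu]_z G (x - z) = 2 * \int[mu]_y G y.
  by rewrite e1 e2 mulr_natl mulr2n.
have n2 : 2 != 0 :> R by rewrite pnatr_eq0.
apply: (etrans tE); apply: (etrans (esym (mulKf n2 _))).
apply: (congr1 (fun t => 2^-1 * t)).
apply: (etrans (esym e12)).
apply: (etrans (esym (RintD (rint_addl x iG) (rint_subl x iG)))).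
apply: eq_Rintegral => z _; rewrite /G /sdiff.
have -> : x - (x + z) = - z by rewrite opprD addrA subrr add0r.
have -> : x - (x - z) = z by rewrite opprB addrC subrK.
rewrite fkerN.
rewrite (_ : \1_(offball e) (- z) = \1_(offball e) z); first by ring.
rewrite !indicE; congr (_%:R); congr nat_of_bool.
by apply/idP/idP; rewrite !inE /offball /= enormN.
Qed.

(** Dominated convergence as the truncation radius tends to [0]. The order [th > al] of the second
    difference is what makes the symmetrised integrand absolutely integrable at the origin. *)
Lemma fraclapE f x (C th : R) : al < th <= n%:R + al -> wint al f ->
  (forall z, `|z| <= 1 -> `|sdiff f x z| <= C * `|z| `^ th) ->
  fraclap al f x = C_frac n al * flap al f x.
Proof.
move=> hth wf hC; congr (_ * _); apply: cvg_lim => //.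
apply/cvg_at_rightP => e [e0 ecvg].
under eq_fun do rewrite truncated_fraclapE //.
apply: cvgZr.
have [A A0 hA] := sdiff_majorant n al0 `|x|.
have {}hA := hA f C `|f x| th x (lexx _) (lexx _) hC.
have mdk : measurable_fun setT (fun z => sdiff f x z * fker al z).
  by apply: measurable_funM; [exact: measurable_sdiff wf.1|exact: measurable_fker].
apply: (Rint_dct _ _ _ _ (rint_majorant al0 C `|f x| A x hth wf)) => //.
- move=> k; apply: measurable_funM => //.
  by apply: measurable_indic; exact: measurable_offball.
(* At [z = 0] the indicator stays [0] for every positive radius, but the second difference vanishes
   there. *)
- move=> z; have [->|z0] := eqVneq z 0.
    rewrite /sdiff subr0 addr0 (_ : 2 * f x - f x - f x = 0); last by ring.
    under eq_fun do rewrite mul0r mul0r.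
    by rewrite mul0r; exact: cvg_cst.
  rewrite -[X in _ --> X]mulr1; apply: cvgZr.
  apply: cvg_near_cst; near=> k.
  rewrite indicE mem_set //= /offball /=; near: k.
  by apply: (cvgr_le 0 ecvg); rewrite enorm_gt0.
- move=> k z; apply: le_trans (hA z); rewrite normrM ler_piMr // indicE.
  by case: (_ \in _); rewrite ?normr1 ?normr0.
Unshelve. all: by end_near. Qed.

End fraclapE.

(** * Differentiation under the integral and integration by parts *)

Section lines.
Context {R : realType} (n : nat).
Local Notation mu := (lebesgue_rV R n).
Local Notation E := 'rV[R]_n.
Implicit Types (x y z v : E) (f g : E -> R).

Lemma line_quotient f x v (h : R) :
  (fun t : R => t^-1 *: (((fun s : R => f (x + s *: v)) \o shift h) (t *: 1) - f (x + h *: v)))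
  = (fun t : R => t^-1 *: ((f \o shift (x + h *: v)) (t *: v) - f (x + h *: v))).
Proof.
apply/funext => t /=; congr (_ *: (f _ - _)).
by rewrite scaler1 scalerDl addrCA.
Qed.

Lemma derivable_line f x v (h : R) :
  derivable (fun s : R => f (x + s *: v)) h 1 <-> derivable f (x + h *: v) v.
Proof. by rewrite /derivable line_quotient. Qed.

Lemma derive_line f x v (h : R) :
  'D_1 (fun s : R => f (x + s *: v)) h = 'D_v f (x + h *: v).
Proof. by rewrite /derive line_quotient. Qed.

Lemma shift_quotient f x y v :
  (fun t : R => t^-1 *: (((fun x => f (x + y)) \o shift x) (t *: v) - f (x + y)))
  = (fun t : R => t^-1 *: ((f \o shift (x + y)) (t *: v) - f (x + y))).
Proof. by apply/funext => t /=; rewrite addrA. Qed.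

Lemma derivable_shift f x y v :
  derivable (fun x => f (x + y)) x v <-> derivable f (x + y) v.
Proof. by rewrite /derivable shift_quotient. Qed.

Lemma derive_shift f x y v :
  'D_v (fun x => f (x + y)) x = 'D_v f (x + y).
Proof. by rewrite /derive shift_quotient. Qed.

(** Along the line through [x] in the direction [v] this is the theorem for one real parameter on
    []-1, 1[], whence hypotheses for [|h| < 1] only. *)
Lemma diff_under_integral d (Y : measurableType d) (m : {measure set Y -> \bar R})
    (F : E -> Y -> R) (G : Y -> R) x v :
  (forall h : R, `|h| < 1 -> rint m (F (x + h *: v))) ->
  (forall (h : R) w, `|h| < 1 -> derivable (F^~ w) (x + h *: v) v) ->
  (forall (h : R) w, `|h| < 1 -> `|'D_v (F^~ w) (x + h *: v)| <= G w) ->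
  rint m G ->
  derivable (fun x => \int[m]_w F x w) x v /\
  'D_v (fun x => \int[m]_w F x w) x = \int[m]_w 'D_v (F^~ w) x.
Proof.
move=> Fi Fd FG Gi.
pose f (h : R) w := F (x + h *: v) w.
have h01 : [set` `](-1 : R), 1[] 0 by rewrite /= in_itv /= ltrN10 ltr01.
have I1 h : [set` `](-1 : R), 1[] h -> `|h| < 1.
  by rewrite /= in_itv /= ltr_norml.
have fi h : [set` `](-1 : R), 1[] h -> m.-integrable setT (EFin \o f h).
  by move=> /I1; exact: Fi.
have fd h w : [set` `](-1 : R), 1[] h -> setT w -> derivable (f ^~ w) h 1.
  by move=> /I1 h1 _; apply/(derivable_line (F^~ w)); exact: Fd.
have G0 w : 0 <= G w.
  apply: le_trans (FG 0 w _); first exact: normr_ge0.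
  by rewrite normr0.
have fG h w : [set` `](-1 : R), 1[] h -> setT w -> `|partial1of2 f h w| <= G w.
  move=> /I1 h1 _; rewrite partial1of2E (derive_line (F^~ w)); exact: FG.
have := derivable_under_integral measurableT h01 fi fd G0 Gi fG.
rewrite (derivable_line (fun x => \int[m]_w F x w)) scale0r addr0 => der.
split => //.
have := differentiation_under_integral measurableT h01 fi fd G0 Gi fG.
rewrite derive1E (derive_line (fun x => \int[m]_w F x w)) scale0r addr0 => ->.
apply: eq_Rintegral => w _.
by rewrite partial1of2E (derive_line (F^~ w)) scale0r addr0.
Qed.

Definition lbounded f := forall r : R, exists M : R, forall x, `|x| <= r -> `|f x| <= M.

Definition mlb f := measurable_fun setT f /\ lbounded f.

(** Regularity in the form that passes through integrals: the iterated partials exist and are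
    measurable and locally bounded. Local boundedness, in place of continuity, is what a dominating
    function gives at once. *)
Fixpoint Reg (m : nat) f : Prop :=
  match m with
  | 0 => mlb f
  | m'.+1 => mlb f /\ forall i, (forall x, derivable f x (delta_mx ord0 i)) /\
                              Reg m' (partial i f)
  end.

Lemma Reg_mlb m f : Reg m f -> mlb f. Proof. by case: m => [|m] //= []. Qed.

Lemma RegS m f : Reg m.+1 f -> Reg m f.
Proof.
elim: m f => [|m IH] f /=; first by case.
move=> [h1 h2]; split => // i; have [h3 h4] := h2 i; split => //.
exact: IH.
Qed.

Lemma Reg_le m k f : (k <= m)%N -> Reg m f -> Reg k f.
Proof.
elim: m => [|m IH]; first by rewrite leqn0 => /eqP ->.
by rewrite leq_eqVlt => /orP[/eqP -> //|/IH h /RegS].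
Qed.

Lemma lbounded_ge0 f (r : R) : lbounded f ->
  exists2 M : R, 0 <= M & forall x, `|x| <= r -> `|f x| <= M.
Proof.
move=> /(_ r)[M hM]; exists `|M| => // x /hM /le_trans; apply; exact: ler_norm.
Qed.

Lemma mlbD f g : mlb f -> mlb g -> mlb (fun x => f x + g x).
Proof.
move=> [mf bf] [mg bg]; split; first exact: measurable_funD.
move=> r; have [M hM] := bf r; have [N hN] := bg r; exists (M + N) => x xr.
by apply: le_trans (ler_normD _ _) _; apply: lerD; [exact: hM|exact: hN].
Qed.

Lemma mlbZ (c : R) f : mlb f -> mlb (fun x => c * f x).
Proof.
move=> [mf bf]; split; first exact: measurable_funM.
move=> r; have [M hM] := bf r; exists (`|c| * M) => x xr.
by rewrite normrM ler_wpM2l // hM.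
Qed.

Lemma mlbM f g : mlb f -> mlb g -> mlb (fun x => f x * g x).
Proof.
move=> [mf bf] [mg bg]; split; first exact: measurable_funM.
move=> r; have [M hM] := bf r; have [N hN] := bg r; exists (M * N) => x xr.
by rewrite normrM ler_pM // ?hM ?hN.
Qed.

Lemma partialD i f g :
  (forall x, derivable f x (delta_mx ord0 i)) ->
  (forall x, derivable g x (delta_mx ord0 i)) ->
  partial i (fun x => f x + g x) = fun x => partial i f x + partial i g x.
Proof. by move=> df dg; apply/funext => x; exact: deriveD. Qed.

Lemma partialZ (c : R) i f : (forall x, derivable f x (delta_mx ord0 i)) ->
  partial i (fun x => c * f x) = fun x => c * partial i f x.
Proof. by move=> df; apply/funext => x; exact: deriveZ. Qed.

Lemma RegD m f g : Reg m f -> Reg m g -> Reg m (fun x => f x + g x).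
Proof.
elim: m f g => [|m IH] f g /=; first exact: mlbD.
move=> [bf hf] [bg hg]; split; first exact: mlbD.
move=> i; have [df Rf] := hf i; have [dg Rg] := hg i; split.
  by move=> x; exact: derivableD.
by rewrite partialD //; exact: IH.
Qed.

Lemma RegZ m (c : R) f : Reg m f -> Reg m (fun x => c * f x).
Proof.
elim: m f => [|m IH] f /=; first exact: mlbZ.
move=> [bf hf]; split; first exact: mlbZ.
move=> i; have [df Rf] := hf i; split.
  by move=> x; exact: derivableZ.
by rewrite partialZ //; exact: IH.
Qed.

Lemma mlb_cst (c : R) : mlb (fun=> c).
Proof. by split; [exact: measurable_cst|move=> r; exists `|c|]. Qed.

Lemma partial_cst i (c : R) : partial i (fun=> c : R) = (fun=> 0) :> (E -> R).
Proof. by apply/funext => x; rewrite /partial derive_cst. Qed.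

Lemma Reg_cst m (c : R) : Reg m (fun=> c).
Proof.
elim: m c => [|m IH] c /=; first exact: mlb_cst.
split; first exact: mlb_cst.
by move=> i; rewrite partial_cst; split.
Qed.

Lemma Reg_sum m (s : seq 'I_n) (F : 'I_n -> E -> R) :
  (forall i, Reg m (F i)) -> Reg m (fun x => \sum_(i <- s) F i x).
Proof.
move=> h; elim: s => [|i s IH].
  by under eq_fun do rewrite big_nil; exact: Reg_cst.
under eq_fun do rewrite big_cons.
exact: RegD.
Qed.

Lemma Reg_neglap m f : Reg m.+2 f -> Reg m (neglap f).
Proof.
move=> hf; rewrite /neglap.
rewrite (_ : (fun x => _) = fun x => (-1) * \sum_(i < n) partial i (partial i f) x).
  by apply: RegZ; apply: Reg_sum => i; have [_ /(_ i)[_ [_ /(_ i)[]]]] := hf.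
by apply/funext => x; rewrite mulN1r.
Qed.

Lemma rint_cube (r c : R) : rint mu (fun x => c * \1_(@cube R n r) x).
Proof.
apply: rintZl; apply: rint_lty => //.
  by apply: measurable_indic; exact: measurable_cube.
rewrite integral_indic //; last exact: measurable_cube.
rewrite setIT; have [r0|r0] := leP 0 r.
  by rewrite [X in (X < _)%E]lebesgue_rV_cube // ltry.
rewrite (_ : cube r = set0) ?measure0 // -subset0 => x /= xr.
by have := le_lt_trans xr r0; rewrite normr_lt0.
Qed.

Lemma rint_mlb_supp f (r : R) : mlb f -> (forall x, r < `|x| -> f x = 0) ->
  rint mu f.
Proof.
move=> [mf bf] f0; have [M hM] := bf r.
apply: (@rint_dom _ _ _ _ (fun x => M * \1_(cube r) x)) => // [x|]; last exact: rint_cube.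
rewrite indicE; case: (boolP (x \in _)).
  by rewrite inE /cube /= mulr1 => /hM.
move=> xr; rewrite f0 ?normr0 ?mulr0 // ltNge; apply: contra xr.
by rewrite inE.
Qed.

Lemma partial_out i f (r : R) x : (forall x, r < `|x| -> f x = 0) ->
  r < `|x| -> partial i f x = 0.
Proof.
move=> f0 xr; rewrite /partial (_ : 'D_ _ f x = 'D_(delta_mx ord0 i) (fun=> 0 : R) x).
  exact: derive_cst.
apply: near_eq_derive.
have op : open [set y : E | r < `|y|].
  apply: (@open_comp _ _ (fun y : E => `|y|) [set t | r < t]); last exact: open_gt.
  by move=> y _; exact: norm_continuous.
by near=> y; apply: f0; near: y; exact: (open_nbhs_nbhs (conj op xr)).
Unshelve. all: by end_near. Qed.

(** By translation invariance [\int P (x + y) dy] does not depend on [x], so the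
    integral of its derivative vanishes. *)
Lemma ibp i g phi (r : R) : mlb g -> mlb phi ->
  (forall x, derivable g x (delta_mx ord0 i)) ->
  (forall x, derivable phi x (delta_mx ord0 i)) ->
  mlb (partial i g) -> mlb (partial i phi) ->
  (forall x, r < `|x| -> phi x = 0) ->
  \int[mu]_x (partial i g x * phi x) = - \int[mu]_x (g x * partial i phi x).
Proof.
move=> bg bp dg dp bdg bdp phi0.
set v := delta_mx ord0 i : E.
have dphi0 x : r < `|x| -> partial i phi x = 0 by exact: partial_out.
pose P x := g x * phi x.
have bP : mlb P by exact: mlbM.
have P0 x : r < `|x| -> P x = 0 by move=> /phi0 h; rewrite /P h mulr0.
have iP : rint mu P by exact: (rint_mlb_supp bP P0).
have dP x : derivable P x v by apply: derivableM.
have DP x : 'D_v P x = g x * partial i phi x + phi x * partial i g x.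
  by rewrite /P deriveM.
have i1 : rint mu (fun x => partial i g x * phi x).
  by apply: (@rint_mlb_supp _ r) => [|x /phi0 ->]; [exact: mlbM|rewrite mulr0].
have i2 : rint mu (fun x => g x * partial i phi x).
  by apply: (@rint_mlb_supp _ r) => [|x /dphi0 ->]; [exact: mlbM|rewrite mulr0].
have bDP : mlb (fun x => 'D_v P x).
  rewrite (_ : (fun x => _) = fun x => g x * partial i phi x + phi x * partial i g x).
    by apply: mlbD; exact: mlbM.
  exact/funext.
have v1 : `|v| <= 1 by exact: normr_delta_rV.
have [M M0 hM] := lbounded_ge0 r bDP.2.
have [] := @diff_under_integral _ _ mu (fun x y => P (x + y)) (fun y => M * \1_(cube (r + 1)) y) 0 v.
- by move=> h _; exact: rint_addl.
- by move=> h y _; apply/derivable_shift; exact: dP.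
- move=> h y h1; rewrite derive_shift add0r indicE.
  have [hr|hr] := leP `|h *: v + y| r.
    rewrite mem_set ?mulr1 ?hM // /cube /=.
    rewrite -[y](addKr (h *: v)) addrC (le_trans (ler_normB _ _)) // lerD //.
    by rewrite normrZ (le_trans (ler_piMr _ v1)) // ltW.
  by rewrite DP phi0 // dphi0 // mulr0 mul0r addr0 normr0 mulr_ge0.
- exact: rint_cube.
move=> _; rewrite (_ : (fun x => _) = cst (\int[mu]_x P x)); last first.
  by apply/funext => x; rewrite Rint_addl.
rewrite derive_cst => /esym.
under eq_Rintegral do rewrite derive_shift add0r DP mulrC [phi _ * _]mulrC.
under eq_Rintegral do rewrite [X in X + _]mulrC addrC.
by rewrite RintD // => /eqP; rewrite addr_eq0 => /eqP.
Qed.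

End lines.

(** * Smooth radial kernels *)

Section glue.
Context {R : realType}.
Implicit Types (f g : R -> R) (r : R).

Definition glue f g (r : R) := if 1 <= r then f r else g r.

Lemma glue_is_derive f g f' g' :
  (forall r, 1 <= r -> is_derive r (1 : R) f (f' r)) ->
  (forall r, r <= 1 -> is_derive r (1 : R) g (g' r)) ->
  f 1 = g 1 -> f' 1 = g' 1 ->
  forall r, is_derive r (1 : R) (glue f g) (glue f' g' r).
Proof.
move=> df dg fg fg' r; have [r1|r1|->] := ltgtP r 1.
- rewrite /glue [in X in is_derive _ _ _ X]leNgt r1 /=.
  apply: (near_eq_is_derive _ (dg r (ltW r1))); near=> y.
  rewrite leNgt (_ : y < 1) //; near: y; exact: lt_nbhsl.
- rewrite /glue [in X in is_derive _ _ _ X](ltW r1) /=.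
  apply: (near_eq_is_derive _ (df r (ltW r1))); near=> y.
  rewrite (_ : 1 <= y) //; apply: ltW; near: y; exact: lt_nbhsr.
(* At the joint, [glue f g] is [g] plus a function equal to [f - g] on the right and to [0] on the
   left. The difference quotients of that function are dominated by those of [f - g], which tend to
   [f' 1 - g' 1 = 0]. *)
- pose D r := f r - g r.
  have dD : is_derive (1 : R) (1 : R) D (f' 1 - g' 1).
    exact: is_deriveB (df _ (lexx _)) (dg _ (lexx _)).
  have D1 : D 1 = 0 by rewrite /D fg subrr.
  pose D' r := if 1 <= r then D r else 0.
  have dD' : is_derive (1 : R) (1 : R) D' 0.
    have [exD DE] := dD.
    have lim0 : (fun h : R => h^-1 *: ((D \o shift 1) (h *: 1) - D 1)) @ 0^' --> (0 : R).
      rewrite [X in _ --> X](_ : _ = 'D_1 D 1); first exact: exD.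
      by rewrite DE fg' subrr.
    have lim0' : (fun h : R => h^-1 *: ((D' \o shift 1) (h *: 1) - D' 1)) @ 0^' --> (0 : R).
      apply/norm_cvg0P; apply: (squeeze_cvgr _ (cvg_cst 0) ((norm_cvg0P _).2 lim0)).
      near=> h; rewrite normr_ge0 /= !normrZ ler_wpM2l //.
      rewrite /D' lexx D1 !subr0 /=.
      by case: ifP => // _; rewrite normr0.
    apply: DeriveDef; first by apply/cvg_ex; exists 0.
    exact/cvg_lim.
  have -> : glue f g = g \+ D'.
    apply/funext => t; rewrite /glue /D' /D /=; case: ifP => _; last by rewrite addr0.
    by rewrite addrCA subrr addr0.
  rewrite /glue lexx fg' -[g' 1]addr0; exact: is_deriveD (dg _ (lexx _)) dD'.
Unshelve. all: by end_near. Qed.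

Lemma measurable_glue f g : measurable_fun setT f -> measurable_fun setT g ->
  measurable_fun setT (glue f g).
Proof.
by move=> mf mg; apply: measurable_fun_ifT => //; exact: measurable_fun_ler.
Qed.

(** A profile to be evaluated at [r = |z|^2], together with its derivatives [G j] up to order [M];
    each derivative gains one power of decay, as for [r ^ (- s)]. *)
Definition fam (M : nat) (s : R) (G : nat -> R -> R) :=
  [/\ (forall j r, (j < M)%N -> is_derive r (1 : R) (G j) (G j.+1 r)),
      (forall j, (j <= M)%N -> measurable_fun setT (G j)) &
      (forall j, (j <= M)%N -> exists2 C, 0 <= C &
         forall r, 0 <= r -> `|G j r| <= C * (1 + r) `^ (- (s + j%:R)))].

Lemma powR_one (x : R) : 1 `^ x = 1 :> R.
Proof. by rewrite powR1. Qed.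

Lemma glue_bound f g (A B e : R) : 0 <= e -> 0 <= A -> 0 <= B ->
  (forall r, 1 <= r -> `|f r| <= A * r `^ (- e)) ->
  (forall r, 0 <= r <= 1 -> `|g r| <= B) ->
  exists2 C, 0 <= C & forall r, 0 <= r -> `|glue f g r| <= C * (1 + r) `^ (- e).
Proof.
(* The factor [2 ^ e] compares [1 + r] with [r] on the right of the joint, and with [1] on its
   left. *)
move=> e0 A0 B0 hf hg; exists ((A + B) * 2 `^ e); first by rewrite mulr_ge0 ?addr_ge0 ?powR_ge0.
move=> r r0; rewrite /glue; case: ifPn => r1.
  apply: le_trans (hf _ r1) _; rewrite -mulrA ler_pM ?powR_ge0 ?lerDl //.
  rewrite -[2 `^ e]powR_invN // -powRM ?addr_ge0 //.
  by rewrite ler_powRN //; lra.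
rewrite -ltNge in r1.
apply: (@le_trans _ _ B); first by apply: hg; rewrite r0 ltW.
rewrite -[leLHS]mulr1 -mulrA ler_pM // ?lerDr //.
rewrite -[2 `^ e]powR_invN // -powRM ?addr_ge0 //.
rewrite -[leLHS](powR_one (- e)) ler_powRN //; lra.
Qed.

(** The product [(- s) (- s - 1) ... (- s - j + 1)] produced by differentiating [r ^ (- s)] [j]
    times. *)
Fixpoint pcoef (s : R) (j : nat) : R :=
  if j is j'.+1 then - (s + j'%:R) * pcoef s j' else 1.

Definition ppow (s : R) (j : nat) (r : R) := pcoef s j * r `^ (- (s + j%:R)).

Definition ptay (s : R) (k j : nat) (r : R) :=
  \sum_(i < k) pcoef s (j + i) / (i`!)%:R * (r - 1) ^+ i.

(** [r `^ (- s)] on [1 <= r], continued below [1] by its Taylor polynomial at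
    [1]; [j] counts derivatives. *)
Definition gpow (s : R) (M j : nat) : R -> R :=
  glue (ppow s j) (ptay s (M - j).+1 j).

Lemma ppow_is_derive s j r : 0 < r -> is_derive r (1 : R) (ppow s j) (ppow s j.+1 r).
Proof.
move=> r0; rewrite /ppow.
have -> : pcoef s j.+1 * r `^ (- (s + j.+1%:R)) =
    pcoef s j * (- (s + j%:R) * r `^ (- (s + j%:R) - 1)).
  rewrite /= -mulrA [pcoef s j * (_ * _)]mulrCA; congr (_ * (_ * _ `^ _)).
  by rewrite -natr1; ring.
exact: is_deriveZ (is_derive1_powR _ r0).
Qed.

Lemma ptay1 s k j : ptay s k.+1 j 1 = pcoef s j.
Proof.
rewrite /ptay big_ord_recl subrr expr0 mulr1 addn0 fact0 divr1 big1 ?addr0 // => i _.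
by rewrite expr0n mulr0.
Qed.

Lemma ptay_is_derive s k j r : is_derive r (1 : R) (ptay s k.+1 j) (ptay s k j.+1 r).
Proof.
elim: k => [|k IH].
  rewrite /ptay big_ord0 (_ : (fun x => _) = cst (pcoef s j)); first exact: is_derive_cst.
  by apply/funext => x; rewrite big_ord1 expr0 mulr1 addn0 divr1.
rewrite (_ : ptay s k.+2 j = ptay s k.+1 j \+
    (fun r => pcoef s (j + k.+1) / (k.+1`!)%:R * (r - 1) ^+ k.+1)); last first.
  by apply/funext => x; rewrite /ptay big_ord_recr.
rewrite [X in is_derive _ _ _ X](_ : _ = ptay s k j.+1 r +
  pcoef s (j + k.+1) / (k.+1`!)%:R * (k.+1%:R * (r - 1) ^+ k)); last first.
  rewrite /ptay big_ord_recr; congr (_ + _).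
  transitivity (pcoef s (j.+1 + k) / (k`!)%:R * (r - 1) ^+ k) => //.
  rewrite addSnnS mulrA; congr (_ * _).
  rewrite factS natrM; field.
  by rewrite -(natrD _ 1%N) !pnatr_eq0 -lt0n fact_gt0.
apply: is_deriveD IH _; apply: is_deriveZ.
have h : is_derive r (1 : R) (fun x => x - 1) 1.
  by rewrite -[X in is_derive _ _ _ X]subr0; exact: is_deriveB.
have := is_deriveX k.+1 h; rewrite exprfctE => hX.
by apply: is_derive_eq hX _; rewrite /= -[RHS]mulr1.
Qed.

Lemma measurable_ppow s j : measurable_fun setT (ppow s j).
Proof. by apply: measurable_funM => //; exact: measurable_powR. Qed.

Lemma measurable_ptay s k j : measurable_fun setT (ptay s k j).
Proof.
elim: k => [|k IH].
  rewrite (_ : ptay s 0 j = cst 0); first exact: measurable_cst.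
  by apply/funext => x; rewrite /ptay big_ord0.
rewrite (_ : ptay s k.+1 j = ptay s k j \+
    (fun r => pcoef s (j + k) / (k`!)%:R * (r - 1) ^+ k)); last first.
  by apply/funext => x; rewrite /ptay big_ord_recr.
apply: measurable_funD => //; apply: measurable_funM => //.
by apply: measurable_funX; exact: measurable_funB.
Qed.

Lemma ptay_bound s k j : exists2 B, 0 <= B & forall r, 0 <= r <= 1 -> `|ptay s k j r| <= B.
Proof.
exists (\sum_(i < k) `|pcoef s (j + i) / (i`!)%:R|); first exact: sumr_ge0.
move=> r /andP[r0 r1]; apply: le_trans (ler_norm_sum _ _ _) _.
apply: ler_sum => i _; rewrite normrM ler_piMr // normrX exprn_ile1 //.
by rewrite ler_norml; apply/andP; split; lra.
Qed.

(** The [j]-th derivative keeps [M - j + 1] Taylor terms: differentiation drops one, and the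
    constant term that survives for [j <= M] makes the two pieces agree at [1]. *)
Lemma fam_gpow s M : 0 <= s -> fam M s (gpow s M).
Proof.
move=> s0; split => [j r jM|j jM|j jM].
- rewrite /gpow subnSK // -[(M - j)%N]prednK ?subn_gt0 // -subnS.
  apply: glue_is_derive.
  + by move=> t t1; apply: ppow_is_derive; exact: lt_le_trans t1.
  + by move=> t _; exact: ptay_is_derive.
  + by rewrite ptay1 /ppow powR1 mulr1.
  + by rewrite ptay1 /ppow powR1 mulr1.
- by apply: measurable_glue; [exact: measurable_ppow|exact: measurable_ptay].
- have [B B0 hB] := ptay_bound s (M - j).+1 j.
  apply: (@glue_bound _ _ `|pcoef s j| B) => //; first exact: addr_ge0.
  by move=> r r1; rewrite /ppow normrM ler_wpM2l // ger0_norm // powR_ge0.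
Qed.

Lemma gpow0 s M r : 1 <= r -> gpow s M 0 r = r `^ (- s).
Proof. by move=> r1; rewrite /gpow /glue r1 /ppow mul1r addr0. Qed.

Definition pbump (N j : nat) (r : R) := (-1) ^+ j * (N ^_ j)%:R * (1 - r) ^+ (N - j).

(** The [j]-th derivative of [(1 - r)_+ ^+ M.+1]. *)
Definition gbump (M j : nat) : R -> R := glue (fun=> 0) (pbump M.+1 j).

Lemma pbump_is_derive N j r : (j < N)%N ->
  is_derive r (1 : R) (pbump N j) (pbump N j.+1 r).
Proof.
move=> jN; rewrite /pbump.
rewrite [X in is_derive _ _ _ X](_ : _ = (-1) ^+ j * (N ^_ j)%:R *
  - ((N - j)%:R * (1 - r) ^+ (N - j.+1))); last first.
  by rewrite ffactnSr natrM exprS; ring.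
apply: is_deriveZ.
have h : is_derive r (1 : R) (fun x => 1 - x) (-1).
  by rewrite -[X in is_derive _ _ _ X]add0r; exact: is_deriveB.
have := is_deriveX (N - j) h; rewrite exprfctE => hX.
apply: is_derive_eq hX _; rewrite -subnS /=.
by rewrite -[_ *: _]/(_ * _) mulrN1.
Qed.

Lemma pbump1 N j : (j < N)%N -> pbump N j 1 = 0.
Proof. by move=> jN; rewrite /pbump subrr expr0n subn_eq0 leqNgt jN mulr0. Qed.

Lemma fam_gbump s M : 0 <= s -> fam M s (gbump M).
Proof.
move=> s0; split => [j r jM|j jM|j jM].
- apply: (@glue_is_derive _ _ (fun=> 0) (pbump M.+1 j.+1)).
  + by move=> t _; apply: pbump_is_derive; exact: leqW.
  + by rewrite pbump1 // leqW.
  + by rewrite pbump1.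
- apply: measurable_glue => //; apply: measurable_funM => //.
  by apply: measurable_funX; exact: measurable_funB.
- apply: (@glue_bound _ _ 0 ((M.+1 ^_ j)%:R)) => //.
  + exact: addr_ge0.
  + by move=> r _; rewrite normr0 mul0r.
  + move=> r /andP[r0 r1]; rewrite !normrM normrX normrN1 expr1n mul1r normr_nat.
    rewrite ler_piMr // normrX exprn_ile1 // ler_norml.
    by apply/andP; split; lra.
Qed.

Lemma gbump_out M j r : 1 <= r -> gbump M j r = 0.
Proof. by rewrite /gbump /glue => ->. Qed.

Lemma gbump0 M r : gbump M 0 r = if 1 <= r then 0 else (1 - r) ^+ M.+1.
Proof. by rewrite /gbump /glue /pbump expr0 ffactn0 subn0 !mul1r. Qed.

End glue.

Section kernel_class.
Context {R : realType} (n : nat).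
Local Notation E := 'rV[R]_n.
Variables (M : nat) (s : R) (G : nat -> R -> R).
Hypotheses (s0 : 0 <= s) (famG : fam M s G).

Definition sqn (z : E) : R := \sum_(i < n) z ord0 i ^+ 2.

(** [kcl m d g]: [g] is a sum of products of coordinates with profiles [G j]
    of the squared norm, admits [m] derivatives, and decays at the rate
    [2 * s + d]. *)
Inductive kcl : nat -> nat -> (E -> R) -> Prop :=
| kcl_base m d j : (j + m <= M)%N -> (d <= j.*2)%N -> kcl m d (fun z => G j (sqn z))
| kcl_coord m d i g : kcl m d.+1 g -> kcl m d (fun z => z ord0 i * g z)
| kcl_add m d g h : kcl m d g -> kcl m d h -> kcl m d (fun z => g z + h z)
| kcl_scale m d c g : kcl m d g -> kcl m d (fun z => c * g z).

Lemma kcl_ext m d g h : kcl m d g -> g =1 h -> kcl m d h.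
Proof. by move=> ? /funext <-. Qed.

Lemma kcl_weak m d g : kcl m d g -> forall m' d', (m' <= m)%N -> (d' <= d)%N -> kcl m' d' g.
Proof.
elim=> {m d g} [m d j jm dj|m d i g _ IH|m d g h _ IHg _ IHh|m d c g _ IH] m' d' mm dd.
- apply: kcl_base; last exact: leq_trans dj.
  by apply: leq_trans jm; rewrite leq_add2l.
- by apply: kcl_coord; exact: IH.
- by apply: kcl_add; [exact: IHg|exact: IHh].
- by apply: kcl_scale; exact: IH.
Qed.

Lemma measurable_sqn : measurable_fun setT sqn.
Proof.
rewrite /sqn; elim: (index_enum _) => [|i l IH].
  by under eq_fun do rewrite big_nil; exact: measurable_cst.
under eq_fun do rewrite big_cons.
by apply: measurable_funD => //; apply: measurable_funX; exact: measurable_rV_coord.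
Qed.

Lemma sqn_enorm z : sqn z = enorm z ^+ 2.
Proof. by rewrite sqr_sqrtr //; apply: sumr_ge0 => i _; exact: sqr_ge0. Qed.

Lemma sqn_ge0 z : 0 <= sqn z. Proof. by rewrite sqn_enorm sqr_ge0. Qed.

Lemma kcl_measurable m d g : kcl m d g -> measurable_fun setT g.
Proof.
have [_ mG _] := famG.
elim=> {m d g} [m d j jm dj|m d i g _ IH|m d g h _ IHg _ IHh|m d c g _ IH].
- apply: (measurableT_comp _ measurable_sqn); apply: mG.
  exact: leq_trans (leq_addr _ _) jm.
- by apply: measurable_funM => //; exact: measurable_rV_coord.
- exact: measurable_funD.
- exact: measurable_funM.
Qed.

(** From [(1 + |z|)^2 <= 2 (1 + |z|^2)], the profile [G j] decays in [z] with the doubled exponent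
    [2 s + 2 j], and each coordinate factor costs one power. *)
Lemma kcl_bound m d g : kcl m d g ->
  exists2 C, 0 <= C & forall z, `|g z| <= C * jb z `^ (- (2 * s + d%:R)).
Proof.
have [_ _ bG] := famG.
elim=> {m d g} [m d j jm dj|m d i g _ [C C0 IH]|m d g h _ [C C0 IHg] _ [D D0 IHh]|m d c g _ [C C0 IH]].
- have [C C0 hC] := bG j (leq_trans (leq_addr _ _) jm).
  exists (C * 2 `^ (s + j%:R)); first by rewrite mulr_ge0 // powR_ge0.
  move=> z; apply: le_trans (hC _ (sqn_ge0 z)) _; rewrite -mulrA ler_wpM2l //.
  have h1 : jb z ^+ 2 <= 2 * (1 + sqn z).
    rewrite sqn_enorm; have := normr_le_enorm z; have := normr_ge0 z.
    rewrite /jb => z0 ze; have : `|z| ^+ 2 <= enorm z ^+ 2.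
      by rewrite lerXn2r ?nnegrE // enorm_ge0.
    have := sqr_ge0 (`|z| - 1); rewrite !expr2; nra.
  have sj : 0 <= s + j%:R by exact: addr_ge0.
  apply: (@le_trans _ _ (2 `^ (s + j%:R) * (jb z ^+ 2) `^ (- (s + j%:R)))).
    rewrite -[2 `^ _]powR_invN // -powRM ?sqr_ge0 //.
    rewrite ler_powRN // ?mulr_gt0 ?exprn_gt0 ?jb_gt0 //.
    by rewrite ler_pdivrMl.
  rewrite ler_wpM2l ?powR_ge0 // -powR_mulrn ?jb_ge0 // -powRrM.
  rewrite ler_powR ?jb_ge1 //.
  have : (d%:R : R) <= (j.*2)%:R by rewrite ler_nat.
  rewrite -muln2 natrM; lra.
- exists C => // z; rewrite normrM.
  apply: le_trans (ler_pM _ _ (normrV_coord z i) (IH z)) _ => //.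
  rewrite mulrCA ler_wpM2l //.
  apply: (@le_trans _ _ (jb z * jb z `^ (- (2 * s + d.+1%:R)))).
    by rewrite ler_wpM2r ?powR_ge0 // /jb lerDr.
  rewrite -{1}[jb z]powRr1 ?jb_ge0 // -powRD; last by rewrite (gt_eqF (jb_gt0 z)) implybT.
  by rewrite ler_powR ?jb_ge1 // -natr1; lra.
- exists (C + D) => [|z]; first exact: addr_ge0.
  by apply: le_trans (ler_normD _ _) _; rewrite mulrDl lerD.
- exists (`|c| * C) => [|z]; first exact: mulr_ge0.
  by rewrite normrM -mulrA ler_wpM2l.
Qed.

Lemma is_derive_line (f : E -> R) (z v : E) (df : R) :
  is_derive (0 : R) (1 : R) (fun t : R => f (z + t *: v)) df -> is_derive z v f df.
Proof.
move=> [h1 h2]; apply: DeriveDef.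
  by have := (derivable_line f z v 0).1 h1; rewrite scale0r addr0.
by rewrite -h2 derive_line scale0r addr0.
Qed.

Lemma is_derive_coord (l i : 'I_n) (z : E) :
  is_derive z (delta_mx ord0 i : E) (fun x : E => x ord0 l) (i == l)%:R.
Proof.
apply: is_derive_line.
rewrite (_ : (fun t : R => _) = fun t : R => z ord0 l + (i == l)%:R * t); last first.
  by apply/funext => t; rewrite !mxE eqxx /= eq_sym mulrC.
have h := @is_deriveZ _ _ _ (id : R -> R) (i == l)%:R (0 : R) 1 1 _.
have := is_deriveD (is_derive_cst (z ord0 l) (0 : R) 1) (h (is_derive_id _ _)).
move=> hX; apply: is_derive_eq hX _.
by rewrite add0r; exact: mulr1.
Qed.

Lemma is_derive_sqn (i : 'I_n) (z : E) (f : R -> R) (df : R) :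
  is_derive (sqn z) (1 : R) f df ->
  is_derive z (delta_mx ord0 i : E) (fun z => f (sqn z)) (2 * (z ord0 i * df)).
Proof.
move=> hf; apply: is_derive_line.
pose q (t : R) := sqn z + t * (2 * z ord0 i + t).
rewrite (_ : (fun t : R => _) = f \o q); last first.
  apply/funext => t /=; congr f.
  rewrite /q /sqn (bigD1 i) //= [in RHS](bigD1 i) //= !mxE !eqxx mulr1.
  rewrite (eq_bigr (fun j => z ord0 j ^+ 2)); first by rewrite !expr2; ring.
  by move=> j ji; rewrite !mxE eqxx /= (negPf ji) mulr0 addr0.
have hq : is_derive (0 : R) (1 : R) q (2 * z ord0 i).
  have h1 : is_derive (0 : R) (1 : R) (fun t : R => 2 * z ord0 i + t) (0 + 1).
    exact: is_deriveD (is_derive_cst _ _ _) (is_derive_id _ _).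
  have h2 := is_deriveM (is_derive_id (0 : R) 1) h1.
  have hX := is_deriveD (is_derive_cst (sqn z) (0 : R) 1) h2.
  apply: is_derive_eq hX _.
  by rewrite add0r scale0r add0r addr0; exact: mulr1.
have hf' : is_derive (q 0) (1 : R) f df by rewrite /q mul0r addr0.
have hX := is_derive1_comp hf' hq.
apply: is_derive_eq hX _.
by rewrite [RHS]mulrA mulrC.
Qed.

(** The derivative of [G j (|z|^2)] is [2 z_i G (j + 1) (|z|^2)]: two powers of decay are gained and
    one is lost to the coordinate, so the rate [d] survives differentiation. *)
Lemma kcl_derive m d g : kcl m d g -> forall m', m = m'.+1 -> forall i,
  (forall z, derivable g z (delta_mx ord0 i)) /\ kcl m' d (partial i g).
Proof.
have [dG _ _] := famG.
elim=> {m d g} [m d j jm dj|m d l g kg0 IH|m d g h _ IHg _ IHh|m d c g _ IH] m' mE i; subst.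
- have jM : (j < M)%N by apply: leq_trans jm; rewrite addnS ltnS leq_addr.
  have der z : is_derive z (delta_mx ord0 i : E) (fun z => G j (sqn z))
      (2 * (z ord0 i * G j.+1 (sqn z))).
    exact/is_derive_sqn/dG.
  split; first by move=> z; have [] := der z.
  apply: (@kcl_ext _ _ (fun z => 2 * (z ord0 i * G j.+1 (sqn z)))).
    apply: kcl_scale; apply: kcl_coord; apply: kcl_base; first by rewrite addSnnS.
    by rewrite doubleS; apply: leqW.
  by move=> z; have [_ <-] := der z.
- have [dg kg] := IH _ erefl i.
  have der z : is_derive z (delta_mx ord0 i : E) (fun z => z ord0 l * g z)
      (z ord0 l * partial i g z + (i == l)%:R * g z).
    have hg : is_derive z (delta_mx ord0 i : E) g (partial i g z) by apply: DeriveDef.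
    have hX := is_deriveM (is_derive_coord l i z) hg.
    by apply: is_derive_eq hX _; congr (_ + _); rewrite [RHS]mulrC.
  split; first by move=> z; have [] := der z.
  apply: (@kcl_ext _ _ (fun z => z ord0 l * partial i g z + (i == l)%:R * g z)).
    apply: kcl_add; first exact: kcl_coord.
    by apply: kcl_scale; apply: (kcl_weak kg0).
  by move=> z; have [_ <-] := der z.
- have [dg kg] := IHg _ erefl i; have [dh kh] := IHh _ erefl i.
  by split; [move=> z; exact: (derivableD (dg z) (dh z))|rewrite (partialD dg dh); exact: kcl_add].
- have [dg kg] := IH _ erefl i.
  by split; [move=> z; exact: derivableZ|rewrite partialZ //; exact: kcl_scale].
Qed.

Lemma kcl_mlb m d g : kcl m d g -> mlb g.
Proof.
move=> kg; split; first exact: kcl_measurable kg.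
have [C C0 hC] := kcl_bound kg.
move=> r; exists C => x _; apply: le_trans (hC x) _; rewrite ler_piMr //.
by rewrite -[leRHS](powRr0 (jb x)) ler_powR ?jb_ge1 // oppr_le0 addr_ge0 // mulr_ge0.
Qed.

Lemma kcl_Reg m d g : kcl m d g -> Reg m g.
Proof.
elim: m d g => [|m IH] d g kg; first exact: kcl_mlb kg.
split; first exact: kcl_mlb kg.
move=> i; have [h1 h2] := kcl_derive kg erefl i; split => //.
exact: IH h2.
Qed.

End kernel_class.

(** * Fubini for real-valued integrals *)

Section fubini_real.
Context d1 d2 (T1 : measurableType d1) (T2 : measurableType d2) (R : realType).
Variable m1 : {sigma_finite_measure set T1 -> \bar R}.
Variable m2 : {sigma_finite_measure set T2 -> \bar R}.
Implicit Types f : T1 * T2 -> R.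

Lemma measurable_Rint f : measurable_fun setT f ->
  measurable_fun setT (fun x => \int[m2]_y f (x, y)).
Proof.
move=> mf; apply: (measurableT_comp (fine_measurable _)) => //.
rewrite (_ : (fun x => _) = fun x =>
  (\int[m2]_y ((EFin \o f)^\+ (x, y)) - \int[m2]_y ((EFin \o f)^\- (x, y)))%E).
  apply: emeasurable_funB.
  - apply: (measurable_fun_fubini_tonelli_F (EFin \o f)^\+%E) => //.
    by apply: measurable_funepos; exact/measurable_EFinP.
  - apply: (measurable_fun_fubini_tonelli_F (EFin \o f)^\-%E) => //.
    by apply: measurable_funeneg; exact/measurable_EFinP.
apply/funext => x; rewrite integralE; congr (_ - _)%E.
- by rewrite [in LHS](funepos_comp (EFin \o f) (pair x)).
- by rewrite [in LHS](funeneg_comp (EFin \o f) (pair x)).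
Qed.

(** The integrable bound [M] on the inner integrals of the absolute value gives integrability on the
    product; the hypotheses on the sections turn the iterated extended integrals into real ones. *)
Lemma Rint_fubini f (M : T1 -> R) : measurable_fun setT f -> rint m1 M ->
  (forall x, rint m2 (fun y => f (x, y))) ->
  (forall x, \int[m2]_y `|f (x, y)| <= M x) ->
  (forall y, rint m1 (fun x => f (x, y))) ->
  rint m1 (fun x => \int[m2]_y f (x, y)) /\
  \int[m1]_x \int[m2]_y f (x, y) = \int[m2]_y \int[m1]_x f (x, y).
Proof.
move=> mf iM i2 hM i1; split.
  apply: (rint_dom (measurable_Rint mf) _ iM) => x.
  by apply: le_trans (hM x); apply: le_normr_Rintegral => //; exact: i2.
have mEf : measurable_fun setT (EFin \o f) by exact/measurable_EFinP.
have M0 x : 0 <= M x by apply: le_trans (hM x); apply: Rintegral_ge0.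
have intf : (m1 \x m2)%E.-integrable setT (EFin \o f).
  apply/(integrable12ltyP _ _ mEf).
  apply: (@le_lt_trans _ _ (\int[m1]_x (M x)%:E)%E); last first.
    by rewrite rint_EFin // ltry.
  apply: ge0_le_integral => //.
  - by move=> x _; exact: integral_ge0.
  - apply: (measurable_fun_fubini_tonelli_F (abse \o (EFin \o f))) => //=.
    exact: measurableT_comp.
  - by apply/measurable_EFinP; exact: rint_meas iM.
  - by move=> x _; rewrite [leLHS](rint_EFin (rint_norm (i2 x))) lee_fin.
have e1 : (\int[m1]_x \int[m2]_y (f (x, y))%:E =
           \int[m1]_x (\int[m2]_y f (x, y))%:E)%E.
  by apply: eq_integral => x _; exact: (rint_EFin (i2 x)).
have e2 : (\int[m2]_y \int[m1]_x (f (x, y))%:E =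
           \int[m2]_y (\int[m1]_x f (x, y))%:E)%E.
  by apply: eq_integral => y _; exact: (rint_EFin (i1 y)).
exact: (congr1 fine (etrans (esym e1) (etrans (Fubini intf) e2))).
Qed.

End fubini_real.

(** * Regularity of the fractional Laplacian *)

Section flap_regular.
Context {R : realType} (n : nat) (al th : R) (M : nat).
Hypotheses (al0 : 0 < al) (hth : al < th <= n%:R + al).
Local Notation mu := (lebesgue_rV R n).
Local Notation E := 'rV[R]_n.
Implicit Types (x y z : E) (f g : E -> R).

Let s : R := (n%:R + al) / 2.
Let s0 : 0 <= s. Proof. by rewrite divr_ge0 // addr_ge0 // ltW. Qed.
Let fG : fam M s (gpow s M). Proof. exact: fam_gpow. Qed.
Let s2 : 2 * s = n%:R + al. Proof. by rewrite /s; lra. Qed.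

(** The kernel is [ker0 + ker1] with [ker1] of class [C^M] and [ker0] supported
    in the unit ball: derivatives of [flap u] fall on [u] in the local part and
    on [ker1] far away, where the derivatives of [u] are not controlled. *)
Definition ker1 z : R := gpow s M 0 (sqn z).
Definition ker0 z : R := fker al z - ker1 z.

Lemma kcl_ker1 : kcl M (gpow s M) M 0 ker1.
Proof. exact: kcl_base. Qed.

Lemma ker1N z : ker1 (- z) = ker1 z.
Proof. by rewrite /ker1 !sqn_enorm enormN. Qed.

Lemma ker0_out z : 1 <= enorm z -> ker0 z = 0.
Proof.
move=> z1; rewrite /ker0 /ker1 gpow0; last first.
  by rewrite sqn_enorm -(expr1n _ 2) lerXn2r ?nnegrE // enorm_ge0.
by rewrite sqn_enorm -powR_mulrn ?enorm_ge0 // -powRrM mulrN s2 powRN subrr.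
Qed.

Lemma measurable_ker1 : measurable_fun setT ker1.
Proof. exact: kcl_measurable fG _ _ _ kcl_ker1. Qed.

Lemma measurable_ker0 : measurable_fun setT ker0.
Proof. by apply: measurable_funB; [exact: measurable_fker|exact: measurable_ker1]. Qed.

(** The weight [w] is chosen before [C] and [t], so it serves every function and base point at once.
    On the unit cube [fker] is tamed by the factor [|z| ^ th] and [ker1] is bounded; outside the
    cube [ker0] vanishes. *)
Lemma ker0_bound : exists2 w : E -> R, rint mu w &
  forall z, 0 <= w z /\ (forall (C t : R), 0 <= C ->
    (`|z| <= 1 -> `|t| <= C * `|z| `^ th) -> `|t * ker0 z| <= C * w z).
Proof.
have [B B0 hB] := kcl_bound s0 fG kcl_ker1.
exists (fun z => near_ker al th z + B * \1_(cube 1) z).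
  by apply: rintD; [exact: rint_near_ker|exact: rint_cube].
move=> z; split; first by rewrite addr_ge0 ?mulr_ge0 ?powR_ge0 ?fker_ge0.
move=> C t C0 ht; rewrite /near_ker indicE.
have [zc|zc] := boolP (z \in cube 1); last first.
  rewrite ker0_out ?mulr0 ?normr0 ?addr0 ?mulr0 //.
  apply: le_trans (normr_le_enorm z); apply: ltW; rewrite ltNge.
  by apply: contra zc => zz; rewrite inE.
have z1 : `|z| <= 1 by move: zc; rewrite inE.
rewrite !mulr1 normrM; apply: (@le_trans _ _ (C * `|z| `^ th * (fker al z + B))).
  rewrite ler_pM // ?ht // /ker0; apply: le_trans (ler_normB _ _) _.
  rewrite ger0_norm ?fker_ge0 // lerD2l; apply: le_trans (hB z) _.
  rewrite ler_piMr // -[leRHS](powRr0 (jb z)) ler_powR ?jb_ge1 //.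
  by rewrite oppr_le0 addr0 s2 addr_ge0 // ltW.
rewrite mulrDr -mulrA mulrDr lerD2l -mulrA ler_wpM2l // ler_piMl //.
rewrite -(powR_one th) ge0_ler_powR ?nnegrE //.
by case/andP: hth => h _; rewrite ltW // (lt_trans al0).
Qed.

Definition sdiff_lb f := forall r : R, exists C : R, forall x z,
  `|x| <= r -> `|z| <= 1 -> `|sdiff f x z| <= C * `|z| `^ th.

Definition smlb f := mlb f /\ sdiff_lb f.

(** The recursion of [Reg] with a second difference bound of order [th > al] at every level, so that
    the local part can be formed for each derivative of [f]. *)
Fixpoint Smo (m : nat) f : Prop :=
  match m with
  | 0 => smlb f
  | m'.+1 => smlb f /\ forall i, (forall x, derivable f x (delta_mx ord0 i)) /\
                              Smo m' (partial i f)
  end.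

Lemma Smo_smlb m f : Smo m f -> smlb f. Proof. by case: m => [|m] //= []. Qed.

Lemma Smo_Reg m f : Smo m f -> Reg m f.
Proof.
elim: m f => [|m IH] f /=; first by case.
move=> [[h1 h2] h3]; split => // i; have [h4 h5] := h3 i; split => //.
exact: IH.
Qed.

Definition npart f x : R := \int[mu]_z (sdiff f x z * ker0 z).

Lemma measurable_npart f : measurable_fun setT f -> measurable_fun setT (npart f).
Proof.
move=> mf; apply: (@measurable_Rint _ _ _ _ _ mu (fun p : E * E => sdiff f p.1 p.2 * ker0 p.2)).
apply: measurable_funM; last exact: (measurableT_comp measurable_ker0 measurable_snd).
apply: measurable_funB; first apply: measurable_funB.
- by apply: measurable_funM => //; exact: (measurableT_comp mf measurable_fst).
- exact: (measurableT_comp mf (@measurable_add_pair R n)).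
- exact: (measurableT_comp mf (@measurable_sub_pair R n)).
Qed.

Lemma sdiff_lb_ge0 f (r : R) : sdiff_lb f -> exists2 C : R, 0 <= C & forall x z,
  `|x| <= r -> `|z| <= 1 -> `|sdiff f x z| <= C * `|z| `^ th.
Proof.
move=> /(_ r)[C hC]; exists `|C| => // x z xr z1; apply: le_trans (hC x z xr z1) _.
by rewrite ler_wpM2r ?powR_ge0 // ler_norm.
Qed.

Lemma npart_int f : smlb f -> forall r : R, exists2 W : E -> R, rint mu W &
  forall x, `|x| <= r -> forall z, `|sdiff f x z * ker0 z| <= W z.
Proof.
move=> [mf df] r; have [w wi hw] := ker0_bound.
have [C C0 hC] := sdiff_lb_ge0 r df.
exists (fun z => C * w z); first exact: rintZl.
by move=> x xr z; have [_] := hw z; apply => // z1; exact: hC.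
Qed.

Lemma npart_rint f x : smlb f -> rint mu (fun z => sdiff f x z * ker0 z).
Proof.
move=> sf; have [W Wi hW] := npart_int sf `|x|.
apply: rint_dom Wi; last by move=> z; exact: hW.
apply: measurable_funM; last exact: measurable_ker0.
by apply: measurable_sdiff; exact: sf.1.1.
Qed.

Lemma npart_mlb f : smlb f -> mlb (npart f).
Proof.
move=> sf; split; first by apply: measurable_npart; exact: sf.1.1.
move=> r; have [W Wi hW] := npart_int sf r; exists (\int[mu]_z W z) => x xr.
by apply: Rint_norm_le => //; [exact: npart_rint|exact: hW].
Qed.

Lemma derive_sdiff f i x z : (forall x, derivable f x (delta_mx ord0 i)) ->
  derivable (fun x => sdiff f x z) x (delta_mx ord0 i) /\
  'D_(delta_mx ord0 i) (fun x => sdiff f x z) x = sdiff (partial i f) x z.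
Proof.
move=> df; set v := delta_mx ord0 i : E.
have d1 : is_derive x v f ('D_v f x) by exact: DeriveDef.
have d2 y : is_derive x v (fun x => f (x + y)) ('D_v f (x + y)).
  by apply: DeriveDef; [exact/derivable_shift|rewrite derive_shift].
have h := is_deriveB (is_deriveB (is_deriveZ 2 d1) (d2 z)) (d2 (- z)).
by have [] := h.
Qed.

Lemma npart_derive f i : smlb f -> (forall x, derivable f x (delta_mx ord0 i)) ->
  smlb (partial i f) ->
  (forall x, derivable (npart f) x (delta_mx ord0 i)) /\
  partial i (npart f) = npart (partial i f).
Proof.
move=> sf df sdf; set v := delta_mx ord0 i : E.
have v1 : `|v| <= 1 by exact: normr_delta_rV.
have der x z : is_derive x v (fun x => sdiff f x z * ker0 z) (sdiff (partial i f) x z * ker0 z).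
  have [h1 h2] := derive_sdiff x z df.
  have hX : is_derive x v (fun x => sdiff f x z) (sdiff (partial i f) x z) by exact: DeriveDef.
  rewrite (_ : (fun x => _) = fun x => ker0 z * sdiff f x z); last first.
    by apply/funext => y; rewrite mulrC.
  by rewrite mulrC; exact: is_deriveZ.
have H x : derivable (npart f) x v /\ 'D_v (npart f) x = npart (partial i f) x.
  have [W Wi hW] := npart_int sdf (`|x| + 1).
  have xh (h : R) : `|h| < 1 -> `|x + h *: v| <= `|x| + 1.
    move=> h1; rewrite (le_trans (ler_normD _ _)) // lerD2l normrZ.
    by rewrite (le_trans (ler_piMr _ v1)) // ltW.
  have [|||//|h1 h2] := @diff_under_integral R n _ _ mu (fun x z => sdiff f x z * ker0 z) W x v.
  - by move=> h _; exact: npart_rint.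
  - by move=> h z _; have [] := der (x + h *: v) z.
  - by move=> h z h1; have [_ ->] := der (x + h *: v) z; exact/hW/xh.
  split => //; rewrite h2; apply: eq_Rintegral => z _.
  by have [_ ->] := der x z.
by split; [move=> x; exact: (H x).1|apply/funext => x; exact: (H x).2].
Qed.

Lemma npart_Reg m f : Smo m f -> Reg m (npart f).
Proof.
elim: m f => [|m IH] f sf; first exact: npart_mlb.
have [sf0 hf] := sf.
split; first exact: npart_mlb.
move=> i; have [df Sf] := hf i.
have [h1 ->] := npart_derive sf0 df (Smo_smlb Sf).
by split => //; exact: IH.
Qed.

Variable u : E -> R.
Hypothesis wu : wint al u.

Definition fpart g x : R := \int[mu]_y (g (x - y) * u y).

Lemma jb_sub x y : jb y <= (1 + `|x|) * jb (x - y).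
Proof.
have h : `|y| <= `|x| + `|x - y|.
  by rewrite -{1}[y](subKr x) (le_trans (ler_normB _ _)).
have := normr_ge0 (x - y); have := normr_ge0 x; rewrite /jb => *; nra.
Qed.

(** For [x] in a cube, the decay of [g] at [x - y] is comparable to the decay at [y] by [jb_sub], so
    the integral condition on [u] alone bounds the far part and all its derivatives. *)
Lemma fpart_int m d g : kcl M (gpow s M) m d g -> forall r : R,
  exists2 W : E -> R, rint mu W &
  forall x, `|x| <= r -> forall y, `|g (x - y) * u y| <= W y.
Proof.
move=> kg r; have [C C0 hC] := kcl_bound s0 fG kg.
exists (fun y => (C * (1 + `|r|) `^ (n%:R + al)) * jw al u y); first exact/rintZl/wu.2.
move=> x xr y; rewrite normrM; apply: le_trans (ler_wpM2r _ (hC _)) _ => //.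
rewrite -!mulrA ler_wpM2l // /jw [leLHS]mulrC [leRHS]mulrCA ler_wpM2l //.
apply: (@le_trans _ _ (jb (x - y) `^ (- (n%:R + al)))).
  by rewrite ler_powR ?jb_ge1 // s2 lerN2 lerDl.
rewrite -[(1 + `|r|) `^ _]powR_invN ?addr_ge0 // -powRM ?invr_ge0 ?addr_ge0 ?jb_ge0 //.
have r0 : 0 < 1 + `|r| by rewrite ltr_pwDl.
rewrite ler_powRN //; last by rewrite addr_ge0 // ltW.
  by rewrite mulr_gt0 ?jb_gt0 // invr_gt0.
rewrite ler_pdivrMl //; apply: le_trans (jb_sub x y) _.
by rewrite ler_wpM2r ?jb_ge0 // lerD2l (le_trans xr) // ler_norm.
Qed.

Lemma fpart_rint m d g x : kcl M (gpow s M) m d g -> rint mu (fun y => g (x - y) * u y).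
Proof.
move=> kg; have [W Wi hW] := fpart_int kg `|x|.
apply: rint_dom Wi; last by move=> z; exact: hW.
apply: measurable_funM; last exact: wu.1.
exact: (measurableT_comp (kcl_measurable fG kg) (measurable_subl x)).
Qed.

Lemma fpart_mlb m d g : kcl M (gpow s M) m d g -> mlb (fpart g).
Proof.
move=> kg; split.
  apply: (@measurable_Rint _ _ _ _ _ mu (fun p : E * E => g (p.1 - p.2) * u p.2)).
  apply: measurable_funM; last exact: (measurableT_comp wu.1 measurable_snd).
  exact: (measurableT_comp (kcl_measurable fG kg) (@measurable_sub_pair R n)).
move=> r; have [W Wi hW] := fpart_int kg r; exists (\int[mu]_z W z) => x xr.
by apply: Rint_norm_le => //; [exact: fpart_rint kg|exact: hW].
Qed.

Lemma fpart_derive m d g i : kcl M (gpow s M) m.+1 d g ->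
  (forall x, derivable (fpart g) x (delta_mx ord0 i)) /\
  partial i (fpart g) = fpart (partial i g).
Proof.
move=> kg; set v := delta_mx ord0 i : E.
have [dg kdg] := kcl_derive fG kg erefl i.
have v1 : `|v| <= 1 by exact: normr_delta_rV.
have der x y : is_derive x v (fun x => g (x - y) * u y) (partial i g (x - y) * u y).
  have hX : is_derive x v (fun x => g (x - y)) (partial i g (x - y)).
    by apply: DeriveDef; [exact/derivable_shift|rewrite derive_shift].
  rewrite (_ : (fun x => _) = fun x => u y * g (x - y)); last first.
    by apply/funext => z; rewrite mulrC.
  by rewrite mulrC; exact: is_deriveZ.
have H x : derivable (fpart g) x v /\ 'D_v (fpart g) x = fpart (partial i g) x.
  have [W Wi hW] := fpart_int kdg (`|x| + 1).
  have xh (h : R) : `|h| < 1 -> `|x + h *: v| <= `|x| + 1.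
    move=> h1; rewrite (le_trans (ler_normD _ _)) // lerD2l normrZ.
    by rewrite (le_trans (ler_piMr _ v1)) // ltW.
  have [|||//|h1 h2] := @diff_under_integral R n _ _ mu (fun x y => g (x - y) * u y) W x v.
  - by move=> h _; exact: fpart_rint kg.
  - by move=> h z _; have [] := der (x + h *: v) z.
  - by move=> h z h1; have [_ ->] := der (x + h *: v) z; exact/hW/xh.
  split => //; rewrite h2; apply: eq_Rintegral => z _.
  by have [_ ->] := der x z.
by split; [move=> x; exact: (H x).1|apply/funext => x; exact: (H x).2].
Qed.

Lemma fpart_Reg m d g : kcl M (gpow s M) m d g -> Reg m (fpart g).
Proof.
elim: m d g => [|m IH] d g kg; first exact: fpart_mlb kg.
split; first exact: fpart_mlb kg.
move=> i; have [h1 ->] := fpart_derive i kg; split => //.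
by have [_ /IH] := kcl_derive fG kg erefl i.
Qed.

Lemma rint_ker1 : rint mu ker1.
Proof.
have [C C0 hC] := kcl_bound s0 fG kcl_ker1.
apply: (rint_dom measurable_ker1 hC).
by apply: rintZl; rewrite s2 addr0; exact: rint_jb.
Qed.

(** Against the integrable kernel [ker1] the three terms of the second difference may be integrated
    separately. As [ker1] is even, both translates give the same convolution, and the factor [2^-1]
    compensates for the two copies. *)
Lemma flapE x : smlb u ->
  flap al u x = 2^-1 * npart u x + (\int[mu]_z ker1 z) * u x - fpart ker1 x.
Proof.
move=> su; have i1 := npart_rint x su.
have i2 := rint_ker1.
have i3 := fpart_rint x kcl_ker1.
have i4 : rint mu (fun z => ker1 z * u (x - z)).
  by move/(rint_subl x) : i3; apply: eq_rint => z; rewrite subKr.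
have i5 : rint mu (fun z => ker1 z * u (x + z)).
  move/(rint_addl x) : i3; apply: eq_rint => z.
  by rewrite opprD addrA subrr add0r ker1N.
have e4 : \int[mu]_z (ker1 z * u (x - z)) = fpart ker1 x.
  by apply: etrans (Rint_subl x i3); apply: eq_Rintegral => z _; rewrite subKr.
have e5 : \int[mu]_z (ker1 z * u (x + z)) = fpart ker1 x.
  apply: etrans (Rint_addl x i3); apply: eq_Rintegral => z _.
  by rewrite opprD addrA subrr add0r ker1N.
have e : \int[mu]_z (sdiff u x z * fker al z) =
   \int[mu]_z (sdiff u x z * ker0 z + ((2 * u x) * ker1 z -
      (ker1 z * u (x + z) + ker1 z * u (x - z)))).
  by apply: eq_Rintegral => z _; rewrite /ker0 /sdiff; ring.
rewrite /flap e RintD //; last first.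
  by apply: rintB; [exact: rintZl|exact: rintD].
rewrite RintB; [|exact: rintZl|exact: rintD].
rewrite RintD // RintZl // e4 e5 -/(npart u x).
by field.
Qed.

Lemma flap_Reg m : (m <= M)%N -> Smo m u -> Reg m (flap al u).
Proof.
move=> mM Su.
have -> : flap al u = fun x => 2^-1 * npart u x +
    ((\int[mu]_z ker1 z) * u x + (-1) * fpart ker1 x).
  by apply/funext => x; rewrite (flapE x (Smo_smlb Su)) mulN1r addrA.
apply: RegD; first exact/RegZ/npart_Reg.
apply: RegD; first exact/RegZ/Smo_Reg.
by apply/RegZ/(Reg_le mM)/fpart_Reg/kcl_ker1.
Qed.

End flap_regular.

(** * From the solution class to second difference bounds *)

Section holder.
Context {R : realType} (n : nat).
Local Notation mu := (lebesgue_rV R n).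
Local Notation E := 'rV[R]_n.
Implicit Types (x y z : E) (f g : E -> R).

Lemma mvt0 (g : R -> R) (t : R) : (forall c, derivable g c 1) ->
  exists2 c, `|c| <= `|t| & g t - g 0 = 'D_1 g c * t.
Proof.
move=> dg.
have der c : is_derive c (1 : R) g ('D_1 g c) by exact: DeriveDef.
have cont (a b : R) : {within `[a, b], continuous g}.
  by apply: derivable_within_continuous => c _; exact: dg.
have [t0|t0|<-] := ltgtP 0 t; last by exists 0; rewrite ?subrr ?mulr0.
- have [c cin e] := MVT t0 (fun c _ => der c) (cont 0 t).
  exists c; last by rewrite e subr0.
  have [c1 c2] : 0 < c /\ c < t by move: cin; rewrite in_itv /= => /andP[].
  by rewrite !gtr0_norm // ltW.
- have [c cin e] := @MVT R g (fun c => 'D_1 g c) t 0 t0 (fun c _ => der c) (cont t 0).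
  exists c; last by rewrite -opprB e sub0r mulrN opprK.
  have [c1 c2] : t < c /\ c < 0 by move: cin; rewrite in_itv /= => /andP[].
  by rewrite !ltr0_norm // lerN2 ltW.
Qed.

(** The points [x + ctrunc k z] are the corners of a staircase from [x] to [x + z] that changes one
    coordinate at a time. *)
Definition ctrunc (k : nat) z : E := \row_j (if (j < k)%N then z ord0 j else 0).

Lemma ctruncS z (i : 'I_n) : ctrunc i.+1 z = ctrunc i z + z ord0 i *: delta_mx ord0 i.
Proof.
apply/rowP => j; rewrite !mxE eqxx /=.
have [->|ji] := eqVneq j i; first by rewrite ltnSn ltnn mulr1 add0r.
rewrite mulr0 addr0 ltnS leq_eqVlt.
by rewrite (_ : (j == i :> nat) = false) //; apply/negbTE.
Qed.

(** Existence of partial derivatives gives no total differential, so the one-variable mean value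
    theorem is applied on each step of the staircase. In the sup norm its points stay within [|z|]
    of [x]. *)
Lemma mvt_sum f x z :
  (forall i x, derivable f x (delta_mx ord0 i)) ->
  exists2 xi : 'I_n -> E, (forall i, `|xi i - x| <= `|z|) &
    f (x + z) - f x = \sum_(i < n) partial i f (xi i) * z ord0 i.
Proof.
move=> df.
have h (i : 'I_n) : exists y : E, `|y - x| <= `|z| /\
   f (x + ctrunc i.+1 z) - f (x + ctrunc i z) = partial i f y * z ord0 i.
  pose v : E := delta_mx ord0 i.
  pose g (t : R) := f (x + ctrunc i z + t *: v).
  have dg c : derivable g c 1 by apply/derivable_line; exact: df.
  have [c cz e] := mvt0 (z ord0 i) dg.
  exists (x + ctrunc i z + c *: v); split; last first.
    rewrite ctruncS addrA; move: e; rewrite /g scale0r addr0 => ->.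
    by rewrite (derive_line f).
  apply/normrV_leP => // j; rewrite !mxE eqxx /= addrAC.
  rewrite [X in X + _]addrAC subrr add0r.
  have [->|ji] := eqVneq j i.
    by rewrite ltnn mulr1 add0r (le_trans cz) // normrV_coord.
  rewrite mulr0 addr0; case: ifP => _; first exact: normrV_coord.
  by rewrite normr0.
have {h}[xi hxi] := choice h.
exists xi => [i|]; first by have [] := hxi i.
under eq_bigr => i _ do rewrite -(hxi i).2.
rewrite -(big_mkord xpredT (fun i => f (x + ctrunc i.+1 z) - f (x + ctrunc i z))).
rewrite telescope_sumr //; congr (f _ - f _).
  by congr (_ + _); apply/rowP => j; rewrite mxE ltn_ord.
by rewrite -[LHS]addr0; congr (_ + _); apply/rowP => j; rewrite !mxE.
Qed.

Lemma compact_cube (r : R) : compact (@cube R n r).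
Proof.
  apply: bounded_closed_compact.
    exists r; split; first exact: num_real.
    by move=> M rM x /= /le_trans; apply; exact: ltW.
  apply: (@preimage_closed _ _ (fun x : E => `|x|) [set t | t <= r]).
    by move=> x _; exact: norm_continuous.
  exact: closed_le.
Qed.

Lemma continuous_lbounded f : continuous f -> lbounded f.
Proof.
move=> cf r; have cc := @compact_cube r.
have /compact_bounded[M [_ hM]] := continuous_compact (continuous_subspaceT cf) cc.
exists (M + 1) => x xr; apply: (hM (M + 1)); first by rewrite ltrDl.
by exists x.
Qed.

Definition hol (g : R) f := forall r : R, exists2 C : R, 0 <= C &
  forall x y, `|x| <= r -> `|y| <= r -> `|f x - f y| <= C * `|x - y| `^ g.

Lemma holder_loc_hol (g : R) f : 0 <= g -> holder_loc g f -> hol g f.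
Proof.
move=> g0 h r; have [C hC] := h _ (@compact_cube r).
exists (`|C| * n%:R `^ g) => [|x y xr yr]; first by rewrite mulr_ge0 ?powR_ge0.
apply: le_trans (hC x y xr yr) _.
apply: (@le_trans _ _ (`|C| * enorm (x - y) `^ g)).
  by rewrite ler_wpM2r ?powR_ge0 // ler_norm.
rewrite -mulrA ler_wpM2l // -powRM // ge0_ler_powR ?nnegrE ?enorm_ge0 ?mulr_ge0 //.
exact: enorm_le_normr.
Qed.

Lemma lbounded_fin (F : 'I_n -> E -> R) (r : R) : (forall i, lbounded (F i)) ->
  exists2 B : R, 0 <= B & forall i x, `|x| <= r -> `|F i x| <= B.
Proof.
move=> h; have [B hB] := choice (fun i => h i r).
exists (\sum_i `|B i|) => [|i x xr]; first exact: sumr_ge0.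
apply: le_trans (hB i x xr) _; apply: le_trans (ler_norm _) _.
by rewrite (bigD1 i) //= lerDl sumr_ge0.
Qed.

(** The intermediate points lie within [|x - y| <= 2 r] of [y], hence the radius [3 * r]. *)
Lemma mvt_lip f (r B : R) :
  (forall i x, derivable f x (delta_mx ord0 i)) ->
  (forall i x, `|x| <= 3 * r -> `|partial i f x| <= B) ->
  forall x y, `|x| <= r -> `|y| <= r -> `|f x - f y| <= n%:R * B * `|x - y|.
Proof.
move=> df hB x y xr yr; have [xi hxi] := mvt_sum y (x - y) df.
rewrite [y + (x - y)]addrC subrK => ->.
have xy2 : `|x - y| <= 2 * r by have := ler_normB x y; lra.
apply: le_trans (ler_norm_sum _ _ _) _.
rewrite -mulrA -[X in X%:R * _]card_ord mulr_natl -sumr_const ler_sum // => i _.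
rewrite normrM ler_pM ?normrV_coord // hB //.
have := ler_normD (xi i - y) y; rewrite subrK; have := hxi i; lra.
Qed.

(** On a cube of radius [r], passing from a Lipschitz bound to exponent [g] costs the factor
    [(2 r) ^ (1 - g)]. *)
Lemma lbounded_hol (g : R) f : 0 <= g <= 1 ->
  (forall i x, derivable f x (delta_mx ord0 i)) ->
  (forall i, lbounded (partial i f)) -> hol g f.
Proof.
move=> /andP[g0 g1] df bf r.
have [B B0 hB] := lbounded_fin (3 * r) bf.
exists (n%:R * B * (2 * `|r|) `^ (1 - g)) => [|x y xr yr].
  by rewrite !mulr_ge0 ?powR_ge0.
apply: le_trans (mvt_lip df hB xr yr) _; rewrite -[leRHS]mulrA ler_wpM2l ?mulr_ge0 //.
have [->|xy] := eqVneq (x - y) 0; first by rewrite normr0 mulr_ge0 ?powR_ge0.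
have d0 : 0 < `|x - y| by rewrite normr_gt0.
rewrite -{1}[`|x - y|]powRr1 // -{1}(subrK g 1) powRD; last by rewrite (gt_eqF d0) implybT.
rewrite ler_wpM2r ?powR_ge0 // ge0_ler_powR ?nnegrE ?subr_ge0 ?mulr_ge0 //.
by have := ler_normB x y; have := ler_norm r; lra.
Qed.

Lemma normr_cube_add (r : R) x z : `|x| <= r -> `|z| <= 1 -> `|x + z| <= `|r| + 1.
Proof. by have := ler_normD x z; have := ler_norm r; lra. Qed.

Lemma hol_sdiff (g : R) f : 0 <= g -> hol g f -> sdiff_lb g f.
Proof.
move=> g0 hf r; have [C C0 hC] := hf (`|r| + 1).
exists (2 * C) => x z xr z1.
have xr' : `|x| <= `|r| + 1 by have := ler_norm r; lra.
have h1 : `|f x - f (x + z)| <= C * `|z| `^ g.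
  have := hC x (x + z) xr' (normr_cube_add xr z1).
  by rewrite opprD addrA subrr add0r normrN.
have h2 : `|f x - f (x - z)| <= C * `|z| `^ g.
  have := hC x (x - z) xr'; rewrite opprB [x + (z - x)]addrC subrK; apply.
  by apply: normr_cube_add; rewrite ?normrN.
rewrite (_ : sdiff f x z = (f x - f (x + z)) + (f x - f (x - z))); last first.
  by rewrite /sdiff; ring.
by apply: le_trans (ler_normD _ _) _; lra.
Qed.

(** The first-order terms cancel: staircases towards [x + z] and [x - z] express the second
    difference through increments of each partial derivative between points at distance at most
    [2 |z|], times a coordinate of [z]. *)
Lemma hol_sdiff1 (g : R) f : 0 <= g ->
  (forall i x, derivable f x (delta_mx ord0 i)) ->
  (forall i, hol g (partial i f)) -> sdiff_lb (1 + g) f.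
Proof.
move=> g0 df hf r.
have ex i : exists C : R, 0 <= C /\ forall x y, `|x| <= `|r| + 1 ->
    `|y| <= `|r| + 1 -> `|partial i f x - partial i f y| <= C * `|x - y| `^ g.
  by have [C C0 hC] := hf i (`|r| + 1); exists C.
have [C hC] := choice ex.
exists (\sum_i C i * 2 `^ g) => x z xr z1.
have [xi hxi e1] := mvt_sum x z df.
have [eta heta e2] := mvt_sum x (- z) df.
have -> : sdiff f x z = \sum_i (partial i f (eta i) - partial i f (xi i)) * z ord0 i.
  under eq_bigr => i _ do rewrite mulrBl.
  rewrite sumrB -e1 [X in X - _](_ : _ = - (f (x - z) - f x)); last first.
    by rewrite e2 -sumrN; apply: eq_bigr => i _; rewrite mxE mulrN opprK.
  by rewrite /sdiff; ring.
apply: le_trans (ler_norm_sum _ _ _) _; rewrite mulr_suml; apply: ler_sum => i _.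
have [Ci0 hCi] := hC i.
have inC y : `|y - x| <= `|z| -> `|y| <= `|r| + 1.
  move=> yx; have := ler_normD (y - x) x; rewrite subrK; have := ler_norm r; lra.
have yi : `|eta i - xi i| <= 2 * `|z|.
  have := ler_normB (eta i - x) (xi i - x); rewrite opprB addrA subrK.
  have := hxi i; have := heta i; rewrite normrN; lra.
have hd : `|partial i f (eta i) - partial i f (xi i)| <= C i * (2 * `|z|) `^ g.
  have := hCi _ _ (inC (eta i) _) (inC (xi i) (hxi i)).
  rewrite -(normrN z) => /(_ (heta i)) /le_trans; apply; rewrite ler_wpM2l //.
  by rewrite ge0_ler_powR ?nnegrE ?mulr_ge0 // normrN.
rewrite normrM; apply: le_trans (ler_pM _ _ hd (normrV_coord z i)) _ => //.
rewrite powRM // -!mulrA ler_wpM2l // ler_wpM2l ?powR_ge0 //.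
have [->|z0] := eqVneq z 0; first by rewrite normr0 mulr0 powR_ge0.
have nz : 0 < `|z| by rewrite normr_gt0.
rewrite powRD; last by rewrite (gt_eqF nz) implybT.
by rewrite powRr1 // mulrC.
Qed.

Lemma measurable_partial f i : measurable_fun setT f ->
  (forall x, derivable f x (delta_mx ord0 i)) -> measurable_fun setT (partial i f).
Proof.
move=> mf df; set v : E := delta_mx ord0 i.
pose q (k : nat) x : R := (k.+1%:R^-1 : R)^-1 * (f (x + (k.+1%:R^-1 : R) *: v) - f x).
apply: (measurable_fun_cvg (h := q)) => //.
- move=> k; apply: measurable_funM => //; apply: measurable_funB => //.
  apply: (measurableT_comp mf).
  rewrite (_ : (fun x => _) = (fun x => (k.+1%:R^-1 : R) *: v + x)); first exact: measurable_addl.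
  by apply/funext => x; rewrite addrC.
- move=> x _.
  have hd : (fun t : R => t^-1 *: ((f \o shift x) (t *: v) - f x)) @ 0^' --> ('D_v f x : R).
    exact: df.
  have hk : (forall k : nat, k.+1%:R^-1 != 0 :> R) /\ (k.+1%:R^-1 @[k --> \oo] --> (0 : R)).
    by split => [k|]; [rewrite invr_eq0 pnatr_eq0|exact: cvg_harmonic].
  have h := (cvgr_dnbhsP _ _ _).1 hd _ hk.
  rewrite (_ : q^~ x = fun k : nat => (k.+1%:R^-1 : R)^-1 *: ((f \o shift x) ((k.+1%:R^-1 : R) *: v) - f x)); first exact: h.
  by apply/funext => k; rewrite /q /= [x + _]addrC.
Qed.

(** The order is [th = al + eps]. If [al < 1], the Hoelder bound concerns [f] itself; if [1 <= al],
    it concerns the first partials and the second difference gains one order. Since [eps < 1 <= n],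
    the cap [n + al] is respected. *)
Lemma frac_regular_Smo (m : nat) (al : R) f : (0 < n)%N -> 0 < al < 2 ->
  measurable_fun setT f -> frac_regular m al f ->
  exists2 th, al < th <= n%:R + al & Smo th m f.
Proof.
move=> n0 /andP[al0 al2] mf [eps [e0 e1 [ck hk]]].
set t := Num.truncn al in e1 ck hk.
have [tal alt] : t%:R <= al /\ al < t%:R + 1.
  have /andP[h1 h2] := @truncn_itv R al (ltW al0).
  by split => //; rewrite natr1.
have g0 : 0 <= al - t%:R + eps by rewrite addr_ge0 ?subr_ge0 // ltW.
have n1 : 1 <= n%:R :> R by rewrite ler1n.
exists (al + eps); first by apply/andP; split; lra.
have der (s : seq 'I_n) : (size s < m + t)%N -> forall i x,
    derivable (partials s f) x (delta_mx ord0 i).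
  by move=> sm; have [_ /(_ sm)] := ck s (ltnW sm).
have lb (s : seq 'I_n) : (size s <= m + t)%N -> lbounded (partials s f).
  by move=> sm; have [/continuous_lbounded] := ck s sm.
have ho (s : seq 'I_n) : (size s <= m + t)%N -> hol (al - t%:R + eps) (partials s f).
  rewrite leq_eqVlt => /orP[/eqP sm|sm]; first exact: holder_loc_hol (hk _ sm).
  apply: lbounded_hol; first by rewrite g0 ltW.
    exact: der.
  by move=> i; exact: (lb (i :: s)).
have ms (s : seq 'I_n) : (size s <= m + t)%N -> measurable_fun setT (partials s f).
  elim: s => [//|i s IH] /= sm; apply: measurable_partial; first by apply: IH; exact: ltnW.
  by move=> x; exact: der.
have t01 : t = 0%N \/ t = 1%N.
  have : (t%:R : R) < 2%:R by exact: le_lt_trans al2.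
  by rewrite ltr_nat; case: (t) => [|[|]]; [left|right|].
have sm0 (s : seq 'I_n) : (size s <= m)%N -> smlb (al + eps) (partials s f).
  move=> sm; have sm' : (size s <= m + t)%N by exact: leq_trans (leq_addr _ _).
  split; first by split; [exact: ms|exact: lb].
  case: t01 => t1.
    rewrite (_ : al + eps = al - t%:R + eps); last by rewrite t1; ring.
    by apply: hol_sdiff => //; exact: ho.
  rewrite (_ : al + eps = 1 + (al - t%:R + eps)); last by rewrite t1; ring.
  apply: hol_sdiff1 => // i.
    by apply: der; rewrite t1 addn1 ltnS.
  by apply: (ho (i :: s)); rewrite t1 addn1 ltnS.
suff H (k : nat) (s : seq 'I_n) : (size s + k <= m)%N -> Smo (al + eps) k (partials s f).
  exact: (H m [::]).
elim: k s => [|k IH] s sk; first by apply: sm0; rewrite addn0 in sk.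
split; first by apply: sm0; exact: leq_trans (leq_addr _ _) sk.
move=> i; split; last by apply: (IH (i :: s)); rewrite /= addSnnS.
move=> x; apply: der; apply: leq_trans (leq_addr _ _); apply: leq_trans sk.
by rewrite addnS ltnS leq_addr.
Qed.

(** Measurability of [f] is recovered from that of the quotient by multiplying the positive weight
    back; the two weights are then compared through [enorm x <= n |x|]. *)
Lemma L_alpha_wint (al : R) f : 0 < al -> L_alpha al f -> wint al f.
Proof.
move=> al0 Lf; have na0 : 0 < n%:R + al by rewrite ltr_wpDl.
pose D x := 1 + enorm x `^ (n%:R + al) : R.
have D0 x : 0 < D x by rewrite ltr_pwDl ?powR_ge0.
have mD : measurable_fun setT D.
  apply: measurable_funD => //.
  exact: (measurableT_comp (measurable_powR _) (@measurable_enorm R n)).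
have iL : rint mu (fun x => f x / D x) by [].
have mf : measurable_fun setT f.
  rewrite (_ : f = fun x => (f x / D x) * D x); last first.
    by apply/funext => x; rewrite divfK // gt_eqF.
  by apply: measurable_funM => //; exact: rint_meas iL.
split => //.
apply: (@rint_dom _ _ _ _ (fun x => (1 + n%:R `^ (n%:R + al)) * `|f x / D x|)).
- apply: measurable_funM; first exact: measurableT_comp.
  exact: measurable_jb_powR.
- move=> x; rewrite ger0_norm ?jw_ge0 // /jw normrM mulrCA ler_wpM2l //.
  rewrite normfV gtr0_norm // powRN -ler_pdivrMr ?invr_gt0 // invrK.
  rewrite mulrC ler_pdivrMr ?powR_gt0 ?jb_gt0 // /D mulrDl mul1r.
  apply: lerD.
    rewrite -[leLHS](powRr0 (jb x)) ler_powR ?jb_ge1 // ltW //.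
  rewrite -powRM ?jb_ge0 // ge0_ler_powR ?nnegrE ?enorm_ge0 ?mulr_ge0 ?jb_ge0 ?(ltW na0) //.
  apply: le_trans (enorm_le_normr x) _; rewrite ler_wpM2l // /jb lerDr //.
- exact/rintZl/rint_norm.
Qed.

End holder.

(** * Duality *)

Section duality.
Context {R : realType} (n : nat) (al : R).
Hypothesis al0 : 0 < al.
Local Notation mu := (lebesgue_rV R n).
Local Notation E := 'rV[R]_n.
Implicit Types (x y z : E) (f g : E -> R).

Let na0 : 0 < n%:R + al. Proof. by rewrite ltr_wpDl. Qed.

Lemma mlb_shift f z : mlb f -> mlb (fun x => f (x + z)).
Proof.
move=> [mf bf]; split.
  apply: (measurableT_comp mf).
  rewrite (_ : (fun x => _) = (fun x => z + x)); first exact: measurable_addl.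
  by apply/funext => x; rewrite addrC.
move=> r; have [M hM] := bf (r + `|z|); exists M => x xr.
by apply: hM; rewrite (le_trans (ler_normD _ _)) // lerD2r.
Qed.

Lemma mlb_sdiff f z : mlb f -> mlb (fun x => sdiff f x z).
Proof.
move=> bf; rewrite (_ : (fun x => _) = fun x => 2 * f x +
   ((-1) * f (x + z) + (-1) * f (x - z))); last first.
  by apply/funext => x; rewrite /sdiff; ring.
by apply: mlbD; [exact: mlbZ|apply: mlbD; apply: mlbZ; exact: mlb_shift].
Qed.

Lemma mlb_norm f : mlb f -> mlb (fun x => `|f x|).
Proof.
move=> [mf bf]; split; first exact: measurableT_comp.
by move=> r; have [M hM] := bf r; exists M => x xr; rewrite normr_id; exact: hM.
Qed.

Lemma mlb_jb e : mlb (fun x : E => jb x `^ e).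
Proof.
split; first exact: measurable_jb_powR.
move=> r; exists ((1 + `|r|) `^ `|e|) => x xr.
have r1 : 1 <= 1 + `|r| by rewrite lerDl.
rewrite ger0_norm ?powR_ge0 //; apply: (@le_trans _ _ (jb x `^ `|e|)).
  by rewrite ler_powR ?jb_ge1 // ler_norm.
rewrite ge0_ler_powR ?nnegrE ?jb_ge0 ?addr_ge0 // /jb lerD2l.
by rewrite (le_trans xr) // ler_norm.
Qed.

Lemma wint_supp f (r : R) : mlb f -> (forall x, r < `|x| -> f x = 0) -> wint al f.
Proof.
move=> bf f0; split; first exact: bf.1.
apply: (@rint_mlb_supp _ _ _ r); first by apply: mlbM; [exact: mlb_norm|exact: mlb_jb].
by move=> x xr; rewrite /jw f0 // normr0 mul0r.
Qed.

Lemma sdiff_fker_int f th x : al < th <= n%:R + al -> wint al f -> sdiff_lb th f ->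
  rint mu (fun z => sdiff f x z * fker al z).
Proof.
move=> hth wf sf; have [A A0 hA] := sdiff_majorant n al0 `|x|.
have [C hC] := sf `|x|.
apply: (rint_dom _ _ (rint_majorant al0 C `|f x| A x hth wf)).
  by apply: measurable_funM; [exact: measurable_sdiff wf.1|exact: measurable_fker].
by apply: hA => // z z1; exact: hC.
Qed.

(** The integral of the majorant does not depend on the base point, so its value at [0] bounds the
    whole cube. *)
Lemma sdiff_fker_loc f th (r : R) : al < th <= n%:R + al -> wint al f -> smlb th f ->
  exists2 B, 0 <= B & forall x, `|x| <= r ->
    \int[mu]_z `|sdiff f x z * fker al z| <= B.
Proof.
move=> hth wf [[mf bf] sf]; have [A A0 hA] := sdiff_majorant n al0 r.
have [C C0 hC] := sdiff_lb_ge0 r sf; have [M M0 hM] := lbounded_ge0 r bf.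
set I := fun x => \int[mu]_z (C * near_ker al th z +
    A * (2 * M * jb z `^ (- (n%:R + al)) + jw al f (x + z) + jw al f (x - z))).
exists `|I 0| => // x xr.
have -> : I 0 = I x.
  by apply: etrans (esym (Rint_majorant al0 C M A x hth wf)); exact: Rint_majorant.
apply: le_trans (ler_norm _); apply: Rint_le.
- exact/rint_norm/(sdiff_fker_int x hth wf sf).
- exact: rint_majorant.
- by apply: hA => //; [exact: hM|move=> z z1; exact: hC].
Qed.

(** Far from the support [f x = 0], and only those [z] count for which [x + z] or [x - z] meets the
    support. Then [|z| >= |x| - r], the kernel has the announced size, and the integral of [|f|] is
    left over. *)
Lemma sdiff_fker_decay f th (r : R) : al < th <= n%:R + al -> 0 <= r ->
  smlb th f -> (forall x, r < `|x| -> f x = 0) ->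
  exists2 B, 0 <= B & forall x,
    \int[mu]_z `|sdiff f x z * fker al z| <= B * jb x `^ (- (n%:R + al)).
Proof.
move=> hth r0 sf f0.
have wf : wint al f by exact: (wint_supp sf.1 f0).
have fi : rint mu (fun x => `|f x|) by apply: rint_norm; exact: (rint_mlb_supp sf.1 f0).
have [B B0 hB] := sdiff_fker_loc (r + 1) hth wf sf.
set J := \int[mu]_z `|f z|.
have J0 : 0 <= J by apply: Rintegral_ge0.
(* The number [r + 2] serves twice: it bounds [1 + |x|] when [|x| <= r + 1], and otherwise
   [1 + |x| <= (r + 2) (|x| - r)]. *)
pose T : R := (r + 2) `^ (n%:R + al).
have T0 : 0 <= T by exact: powR_ge0.
exists (B * T + T * (2 * J)); first by rewrite addr_ge0 ?mulr_ge0.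
move=> x; have jx0 : 0 <= jb x `^ (- (n%:R + al)) by exact: powR_ge0.
have [xr|xr] := leP `|x| (r + 1).
  apply: le_trans (hB x xr) _; rewrite mulrDl; apply: ler_wpDr.
    by rewrite !mulr_ge0.
  rewrite -mulrA ler_peMr // powRN ler_pdivlMr ?powR_gt0 ?jb_gt0 // mul1r.
  rewrite /T ge0_ler_powR ?nnegrE ?jb_ge0 ?(ltW na0) ?addr_ge0 // /jb; lra.
have r2 : 0 < r + 2 by rewrite ltr_wpDl.
have ker z : `|x| - r <= `|z| -> fker al z <= T * jb x `^ (- (n%:R + al)).
  move=> zr; have z0 : 0 < enorm z by apply: lt_le_trans (normr_le_enorm z); lra.
  rewrite /fker -powRN /T -[(r + 2) `^ _]powR_invN ?(ltW r2) //.
  rewrite -powRM ?jb_ge0 ?invr_ge0 ?(ltW r2) // ler_powRN ?(ltW na0) //.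
    by rewrite mulr_gt0 ?jb_gt0 // invr_gt0.
  rewrite ler_pdivrMl //; apply: le_trans (_ : (r + 2) * `|z| <= _).
    rewrite /jb; nra.
  by rewrite ler_pM2l // normr_le_enorm.
have xr' : r < `|x| by lra.
have fx0 : f x = 0 by exact: f0.
have i1 : rint mu (fun z => `|f (x + z)|) by exact: rint_addl fi.
have i2 : rint mu (fun z => `|f (x - z)|) by exact: rint_subl fi.
apply: (@le_trans _ _ (\int[mu]_z
    ((T * jb x `^ (- (n%:R + al))) * (`|f (x + z)| + `|f (x - z)|)))).
  apply: Rint_le; [exact/rint_norm/(sdiff_fker_int x hth wf sf.2)|
                   exact/rintZl/rintD|].
  move=> z; rewrite /sdiff fx0 mulr0 sub0r normrM [X in _ * X]ger0_norm ?fker_ge0 //.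
  have h1 : `|f (x + z)| * fker al z <= T * jb x `^ (- (n%:R + al)) * `|f (x + z)|.
    have [xz|xz] := leP `|x + z| r; last by rewrite f0 // normr0 mul0r mulr0.
    rewrite [leRHS]mulrC ler_wpM2l // ker //.
    have := ler_normB (x + z) z; rewrite addrK; lra.
  have h2 : `|f (x - z)| * fker al z <= T * jb x `^ (- (n%:R + al)) * `|f (x - z)|.
    have [xz|xz] := leP `|x - z| r; last by rewrite f0 // normr0 mul0r mulr0.
    rewrite [leRHS]mulrC ler_wpM2l // ker //.
    have := ler_normD (x - z) z; rewrite subrK; lra.
  apply: le_trans (ler_wpM2r (fker_ge0 _ _) (ler_normB _ _)) _.
  by rewrite normrN mulrDl mulrDr lerD.
rewrite RintZl; last exact: rintD.
rewrite RintD // (Rint_addl x fi) (Rint_subl x fi) -/J.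
have -> : J + J = 2 * J by ring.
by rewrite [leRHS]mulrDl [leLHS]mulrAC lerDr !mulr_ge0.
Qed.

Lemma normr_far (r : R) x z : r + `|z| < `|x| ->
  [/\ r < `|x + z|, r < `|x - z| & r < `|x|].
Proof.
have := ler_normB (x + z) z; have := ler_normD (x - z) z; have := normr_ge0 z.
by rewrite addrK subrK => *; split; lra.
Qed.

(** Both sides are double integrals in [(x, z)]. For fixed [z], translating [x] by [z] and by [- z]
    carries the second difference from [f] to [g]. Fubini is justified on the left by the bounded
    support of [g], on the right by the decay of the integrals for [g] against the weight of [f]. *)
Lemma flap_duality f g th th' (r : R) : al < th <= n%:R + al -> al < th' <= n%:R + al ->
  wint al f -> smlb th f -> smlb th' g -> 0 <= r -> (forall x, r < `|x| -> g x = 0) ->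
  \int[mu]_x (flap al f x * g x) = \int[mu]_x (f x * flap al g x).
Proof.
move=> hth hth' wf sf sg r0 g0.
have wg : wint al g by exact: (wint_supp sg.1 g0).
have mp : measurable_fun setT (fun p : E * E => fker al p.2).
  exact: (measurableT_comp (measurable_fker al) measurable_snd).
have msd h : measurable_fun setT h -> measurable_fun setT (fun p : E * E => sdiff h p.1 p.2).
  move=> mh; apply: measurable_funB; first apply: measurable_funB.
  - by apply: measurable_funM => //; exact: (measurableT_comp mh measurable_fst).
  - exact: (measurableT_comp mh (@measurable_add_pair R n)).
  - exact: (measurableT_comp mh (@measurable_sub_pair R n)).
pose P1 (p : E * E) := g p.1 * (sdiff f p.1 p.2 * fker al p.2).
pose P2 (p : E * E) := f p.1 * (sdiff g p.1 p.2 * fker al p.2).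
have ig : rint mu g by exact: (rint_mlb_supp sg.1 g0).
have supp_prod h : mlb h -> rint mu (fun x => g x * h x).
  move=> bh; apply: (@rint_mlb_supp _ _ _ r); first exact: mlbM sg.1 bh.
  by move=> x xr; rewrite g0 // mul0r.
have [Q1 F1] : rint mu (fun x => \int[mu]_z P1 (x, z)) /\
  \int[mu]_x \int[mu]_z P1 (x, z) = \int[mu]_z \int[mu]_x P1 (x, z).
  have [B B0 hB] := sdiff_fker_loc r hth wf sf.
  apply: (@Rint_fubini _ _ _ _ _ mu mu P1 (fun x => B * `|g x|)).
  - apply: measurable_funM; first exact: (measurableT_comp sg.1.1 measurable_fst).
    exact: (measurable_funM (msd f sf.1.1) mp).
  - exact/rintZl/rint_norm.
  - by move=> x; exact: (rintZl (g x) (sdiff_fker_int x hth wf sf.2)).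
  - move=> x; rewrite /P1 /=; under eq_Rintegral do rewrite normrM.
    rewrite RintZl; last exact/rint_norm/(sdiff_fker_int x hth wf sf.2).
    have [xr|xr] := leP `|x| r; last by rewrite g0 // normr0 mul0r mulr0.
    by rewrite mulrC ler_wpM2r // hB.
  - move=> z; apply: supp_prod.
    rewrite (_ : (fun x => _) = fun x => fker al z * sdiff f x z).
      exact/mlbZ/mlb_sdiff/sf.1.
    by apply/funext => x; rewrite mulrC.
have [Q2 F2] : rint mu (fun x => \int[mu]_z P2 (x, z)) /\
  \int[mu]_x \int[mu]_z P2 (x, z) = \int[mu]_z \int[mu]_x P2 (x, z).
  have [B B0 hB] := sdiff_fker_decay hth' r0 sg g0.
  apply: (@Rint_fubini _ _ _ _ _ mu mu P2 (fun x => B * jw al f x)).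
  - apply: measurable_funM; first exact: (measurableT_comp sf.1.1 measurable_fst).
    exact: (measurable_funM (msd g sg.1.1) mp).
  - exact/rintZl/wf.2.
  - by move=> x; exact: (rintZl (f x) (sdiff_fker_int x hth' wg sg.2)).
  - move=> x; rewrite /P2 /=; under eq_Rintegral do rewrite normrM.
    rewrite RintZl; last exact/rint_norm/(sdiff_fker_int x hth' wg sg.2).
    by rewrite /jw mulrCA ler_wpM2l.
  - move=> z; apply: (@rint_mlb_supp _ _ _ (r + `|z|)).
      apply: mlbM; first exact: sf.1.
      rewrite (_ : (fun x => _) = fun x => fker al z * sdiff g x z).
        exact/mlbZ/mlb_sdiff/sg.1.
      by apply/funext => x; rewrite mulrC.
    move=> x xr; rewrite /P2 /sdiff /=.
    have [h1 h2 h3] := normr_far xr.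
    by rewrite (g0 _ h1) (g0 _ h2) (g0 _ h3) mulr0 !subr0 mul0r mulr0.
have swap z : \int[mu]_x P1 (x, z) = \int[mu]_x P2 (x, z).
  have k1 : rint mu (fun x => g x * f x) by apply: supp_prod; exact: sf.1.
  have k2 w : rint mu (fun x => g x * f (x + w)) by apply: supp_prod; exact: mlb_shift sf.1.
  have k3 w : rint mu (fun x => g (x + w) * f x).
    have := rint_addl w (k2 (- w)); apply: eq_rint => x.
    by rewrite [w + x]addrC addrK.
  have k4 w : \int[mu]_x (g x * f (x + w)) = \int[mu]_x (g (x - w) * f x).
    apply: etrans (Rint_addl w (k3 (- w))); apply: eq_Rintegral => x _.
    by rewrite [w + x]addrC addrK.
  have e1 : \int[mu]_x P1 (x, z) = fker al z * (2 * (\int[mu]_x (g x * f x)) -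
     (\int[mu]_x (g x * f (x + z)) + \int[mu]_x (g x * f (x - z)))).
    have j1 := rintZl 2 k1.
    have j2 := rintD (k2 z) (k2 (- z)).
    rewrite -(RintZl 2 k1) -(RintD (k2 z) (k2 (- z))) -(RintB j1 j2).
    rewrite -(RintZl (fker al z) (rintB j1 j2)).
    by apply: eq_Rintegral => x _; rewrite /P1 /sdiff /=; ring.
  have e2 : \int[mu]_x P2 (x, z) = fker al z * (2 * (\int[mu]_x (g x * f x)) -
     (\int[mu]_x (g (x + z) * f x) + \int[mu]_x (g (x - z) * f x))).
    have j1 := rintZl 2 k1.
    have j2 := rintD (k3 z) (k3 (- z)).
    rewrite -(RintZl 2 k1) -(RintD (k3 z) (k3 (- z))) -(RintB j1 j2).
    rewrite -(RintZl (fker al z) (rintB j1 j2)).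
    by apply: eq_Rintegral => x _; rewrite /P2 /sdiff /=; ring.
  by rewrite e1 e2 k4 k4 opprK [X in _ - X]addrC.
have L1 x : flap al f x * g x = 2^-1 * \int[mu]_z P1 (x, z).
  rewrite /P1 /= RintZl; last exact: (sdiff_fker_int x hth wf sf.2).
  by rewrite /flap; ring.
have L2 x : f x * flap al g x = 2^-1 * \int[mu]_z P2 (x, z).
  rewrite /P2 /= RintZl; last exact: (sdiff_fker_int x hth' wg sg.2).
  by rewrite /flap; ring.
transitivity (2^-1 * \int[mu]_x \int[mu]_z P1 (x, z)).
  rewrite -(RintZl _ Q1); apply: eq_Rintegral => x _; exact: L1.
transitivity (2^-1 * \int[mu]_x \int[mu]_z P2 (x, z)).
  apply: (congr1 (fun t => 2^-1 * t)); apply: (etrans F1); apply: etrans (esym F2).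
  by apply: eq_Rintegral => z _; exact: swap.
rewrite -(RintZl _ Q2); apply: eq_Rintegral => x _; apply/esym; exact: L2.
Qed.

End duality.

(** * Iterated Laplacians: integration by parts and scaling *)

Section scaling.
Context {R : realType} (n : nat).
Local Notation mu := (lebesgue_rV R n).
Local Notation E := 'rV[R]_n.
Implicit Types (x y z : E) (f g : E -> R).

Lemma is_derive_scale f (c : R) i x : (forall x, derivable f x (delta_mx ord0 i)) ->
  is_derive x (delta_mx ord0 i) (fun x => f (c *: x)) (c * partial i f (c *: x)).
Proof.
move=> df; set v : E := delta_mx ord0 i; apply: is_derive_line.
rewrite (_ : (fun t : R => _) = (fun s => f (c *: x + s *: v)) \o (fun t => c * t)); last first.
  by apply/funext => t /=; rewrite scalerDr scalerA.
have h1 : is_derive (c * 0) (1 : R) (fun s => f (c *: x + s *: v)) (partial i f (c *: x)).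
  apply: DeriveDef; first by apply/derivable_line; exact: df.
  by rewrite (derive_line f) mulr0 scale0r addr0.
have h2 : is_derive (0 : R) (1 : R) (fun t => c * t) c.
  have hX := is_deriveZ c (is_derive_id (0 : R) 1).
  by apply: is_derive_eq hX _; exact: mulr1.
by rewrite mulrC; exact: is_derive1_comp h1 h2.
Qed.

Lemma partial_scale f (a c : R) i : (forall x, derivable f x (delta_mx ord0 i)) ->
  partial i (fun x => a * f (c *: x)) = fun x => (a * c) * partial i f (c *: x).
Proof.
move=> df; apply/funext => x; rewrite -mulrA.
by have [_ h] := is_deriveZ a (is_derive_scale c x df); exact: h.
Qed.

Lemma neglap_scale f (a c : R) : Reg 2 f ->
  neglap (fun x => a * f (c *: x)) = fun x => (a * c ^+ 2) * neglap f (c *: x).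
Proof.
move=> [_ hf]; apply/funext => x; rewrite /neglap mulrN; congr (- _).
rewrite mulr_sumr; apply: eq_bigr => i _.
have [df [_ /(_ i)[ddf _]]] := hf i.
by rewrite partial_scale // partial_scale // expr2 mulrA.
Qed.

Lemma iter_neglap_Reg k j f : Reg (k.*2 + j) f -> Reg j (iter k (@neglap R n) f).
Proof.
elim: k j f => [//|k IH] j f; rewrite doubleS !addSn => hf.
by rewrite iterSr; apply: IH; exact: Reg_neglap.
Qed.

Lemma iter_neglap_scale k f (c : R) : Reg k.*2 f ->
  iter k (@neglap R n) (fun x => f (c *: x)) =
  fun x => c ^+ k.*2 * iter k (@neglap R n) f (c *: x).
Proof.
elim: k f => [|k IH] f hf; first by apply/funext => x; rewrite /= mul1r.
have hk : Reg k.*2 f by apply: Reg_le hf; rewrite leq_double.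
have h2 : Reg 2 (iter k (@neglap R n) f).
  by apply: iter_neglap_Reg; rewrite addn2 -doubleS.
rewrite iterS IH // neglap_scale //; apply/funext => x.
by rewrite -exprD addn2 -doubleS.
Qed.

Lemma Reg_scale m (c : R) f : Reg m f -> Reg m (fun x => f (c *: x)).
Proof.
have hm h : mlb h -> mlb (fun x => h (c *: x)).
  move=> [mh bh]; split.
    apply: (measurableT_comp mh).
    rewrite [X in measurable_fun _ X](_ : _ = affrV c 0); first exact: measurable_affrV.
    by apply/funext => x; rewrite /affrV addr0.
  move=> r; have [M hM] := bh (`|c| * r); exists M => x xr.
  by apply: hM; rewrite normrZ ler_wpM2l.
elim: m f => [|m IH] f; first exact: hm.
move=> [bf hf]; split; first exact: hm.
move=> i; have [df Rf] := hf i.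
have dE x : is_derive x (delta_mx ord0 i) (fun x => f (c *: x)) (c * partial i f (c *: x)).
  exact: is_derive_scale.
split; first by move=> x; have [] := dE x.
rewrite (_ : partial i _ = fun x => c * partial i f (c *: x)).
  exact/RegZ/IH.
by apply/funext => x; have [_ <-] := dE x.
Qed.

Lemma neglap_out f (r : R) x : (forall x, r < `|x| -> f x = 0) ->
  r < `|x| -> neglap f x = 0.
Proof.
move=> f0 xr; rewrite /neglap big1 ?oppr0 // => i _.
apply: (@partial_out _ _ i _ r) => // y yr; exact: (@partial_out _ _ _ f r _ f0).
Qed.

Lemma iter_neglap_out k f (r : R) : (forall x, r < `|x| -> f x = 0) ->
  forall x, r < `|x| -> iter k (@neglap R n) f x = 0.
Proof.
move=> f0; elim: k => [//|k IH] x xr; rewrite iterS.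
exact: (neglap_out IH).
Qed.

Lemma ibp_neglap f g (r : R) : Reg 2 f -> Reg 2 g -> (forall x, r < `|x| -> g x = 0) ->
  \int[mu]_x (neglap f x * g x) = \int[mu]_x (f x * neglap g x).
Proof.
move=> rf rg g0.
have [bf hf] := rf; have [bg hg] := rg.
pose F i x := partial i (partial i f) x * g x.
pose G i x := f x * partial i (partial i g) x.
have iF i : rint mu (F i).
  apply: (@rint_mlb_supp _ _ _ r); last by move=> x xr; rewrite /F g0 // mulr0.
  by apply: mlbM => //; have [_ [_ /(_ i)[_]]] := hf i.
have iG i : rint mu (G i).
  apply: (@rint_mlb_supp _ _ _ r); last first.
    move=> x xr; rewrite /G (@partial_out _ _ i _ r) ?mulr0 //.
    by move=> y yr; exact: (@partial_out _ _ _ g r _ g0).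
  by apply: mlbM => //; have [_ [_ /(_ i)[_]]] := hg i.
have FG i : \int[mu]_x F i x = \int[mu]_x G i x.
  have [df [bdf /(_ i)[ddf bddf]]] := hf i.
  have [dg [bdg /(_ i)[ddg bddg]]] := hg i.
  rewrite /F /G (ibp bdf bg ddf dg bddf bdg g0).
  rewrite (@ibp _ _ i f (partial i g) r bf bdg df ddg bdf bddg) ?opprK // => x.
  exact: (@partial_out _ _ _ g r _ g0).
have S (H : 'I_n -> E -> R) (s : seq 'I_n) : (forall i, rint mu (H i)) ->
    rint mu (fun x => \sum_(i <- s) H i x) /\
    \int[mu]_x (\sum_(i <- s) H i x) = \sum_(i <- s) \int[mu]_x H i x.
  move=> iH; elim: s => [|i s [IH1 IH2]].
    rewrite big_nil; under eq_fun do rewrite big_nil.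
    split; last by rewrite Rintegral_cst // mul0r.
    exact: integrable0.
  rewrite big_cons -IH2; under eq_fun do rewrite big_cons.
  split; first exact: rintD.
  rewrite -RintD //; apply: eq_Rintegral => x _; rewrite big_cons //.
have [_ SF] := S F (index_enum _) iF; have [_ SG] := S G (index_enum _) iG.
transitivity (- \int[mu]_x (\sum_i F i x)).
  rewrite -mulN1r -RintZl; last by have [] := S F (index_enum _) iF.
  by apply: eq_Rintegral => x _; rewrite /neglap /F mulNr mulN1r mulr_suml.
transitivity (- \int[mu]_x (\sum_i G i x)).
  by rewrite SF SG; congr (- _); apply: eq_bigr => i _; exact: FG.
rewrite -mulN1r -RintZl; last by have [] := S G (index_enum _) iG.
by apply: eq_Rintegral => x _; rewrite /neglap /G mulrN mulN1r mulr_sumr.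
Qed.

Lemma ibp_iter_neglap k f g (r : R) : Reg k.*2 f -> Reg k.*2 g ->
  (forall x, r < `|x| -> g x = 0) ->
  \int[mu]_x (iter k (@neglap R n) f x * g x) = \int[mu]_x (f x * iter k (@neglap R n) g x).
Proof.
elim: k g => [//|k IH] g rf rg g0.
have rf2 : Reg 2 (iter k (@neglap R n) f).
  by apply: iter_neglap_Reg; rewrite addn2 -doubleS.
have rf' : Reg k.*2 f by apply: Reg_le rf; rewrite leq_double.
have rg2 : Reg 2 g by apply: Reg_le rg; rewrite doubleS.
have rg' : Reg k.*2 (neglap g) by apply: Reg_neglap; rewrite -doubleS.
have g0' x : r < `|x| -> neglap g x = 0 by exact: (neglap_out g0).
apply: (etrans (ibp_neglap rf2 rg2 g0)).
by rewrite iterSr; exact: (IH _ rf' rg' g0').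
Qed.

(** The kernel is homogeneous of degree [- (n + al)] and the substitution [z -> c z] has Jacobian
    [c ^ n], which leaves [c ^ al]. *)
Lemma flap_scale (al c th : R) f x : 0 < al -> 0 < c -> al < th <= n%:R + al ->
  wint al f -> sdiff_lb th f ->
  flap al (fun y => f (c *: y)) x = c `^ al * flap al f (c *: x).
Proof.
move=> al0 c0 hth wf sf.
pose H z := sdiff f (c *: x) z * fker al z.
have iH : rint mu H by exact: (sdiff_fker_int al0 (c *: x) hth wf sf).
have cne : c != 0 by rewrite gt_eqF.
pose S z := sdiff (fun y => f (c *: y)) x z * fker al z.
have HS z : H (c *: z + 0) = c `^ (- (n%:R + al)) * S z.
  rewrite addr0 /H /S /sdiff /fker scalerDr scalerBr enormZ (gtr0_norm c0).
  by rewrite powRM ?(ltW c0) ?enorm_ge0 // invfM powRN mulrCA.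
have iS : rint mu S.
  have h := rintZl (c `^ (n%:R + al)) (integrable_affrV 0 cne iH).
  apply: eq_rint h => z; rewrite HS mulrA -powRD ?subrr ?powRr0 ?mul1r //.
  by rewrite cne implybT.
have e : \int[mu]_z H z = c `^ (- al) * \int[mu]_z S z.
  rewrite (Rintegral_affrV 0 cne iH) normrX (gtr0_norm c0).
  have -> : \int[mu]_z H (c *: (z : E) + 0) = \int[mu]_z (c `^ (- (n%:R + al)) * S z).
    by apply: eq_Rintegral => z _; exact: HS.
  rewrite (RintZl _ iS) mulrA -powR_mulrn ?(ltW c0) // -powRD; last by rewrite cne implybT.
  by congr (_ `^ _ * _); ring.
have e' : \int[mu]_z S z = c `^ al * \int[mu]_z H z.
  by rewrite e mulrA -powRD ?subrr ?powRr0 ?mul1r // cne implybT.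
apply: (etrans (congr1 (fun t => 2^-1 * t) e')).
by rewrite mulrCA.
Qed.

Lemma Reg_sdiff f : Reg 2 f -> sdiff_lb 2 f.
Proof.
move=> [_ hf]; have -> : 2 = 1 + 1 :> R by ring.
apply: hol_sdiff1 => // [i|i]; first by have [] := hf i.
have [_ [_ h]] := hf i; apply: lbounded_hol; first by rewrite ler01 lexx.
  by move=> j; have [] := h j.
by move=> j; have [_ []] := h j.
Qed.

Lemma sdiff_lb_weak (th th' : R) f : 0 < th -> th <= th' -> sdiff_lb th' f -> sdiff_lb th f.
Proof.
move=> t0 tt hf r; have [C C0 hC] := sdiff_lb_ge0 r hf; exists C => x z xr z1.
apply: le_trans (hC x z xr z1) _; rewrite ler_wpM2l //.
have [->|z0] := eqVneq z 0.
  by rewrite normr0 !powR0 // gt_eqF // (lt_le_trans t0).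
by rewrite ger_powR // normr_gt0 z0.
Qed.

End scaling.

(** * The main estimate *)

Section bump.
Context {R : realType} (n : nat).
Local Notation E := 'rV[R]_n.

Definition bump (M : nat) (x : E) : R := gbump M 0 (sqn x).

Lemma bump_ge0 M x : 0 <= bump M x.
Proof.
rewrite /bump gbump0; case: ifPn => // h.
by rewrite exprn_ge0 // subr_ge0 ltW // ltNge.
Qed.

Lemma bump_out M x : 1 < `|x| -> bump M x = 0.
Proof.
move=> x1; rewrite /bump gbump_out // sqn_enorm -(expr1n _ 2).
by rewrite lerXn2r ?nnegrE ?enorm_ge0 // (le_trans (ltW x1)) // normr_le_enorm.
Qed.

(** The hypothesis puts [x] in the Euclidean ball of radius [1/2], where [1 - |x|^2 >= 3/4]. *)
Lemma bump_lower M x : n%:R * `|x| <= 2^-1 -> (3 / 4) ^+ M.+1 <= bump M x.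
Proof.
move=> xn; have e2 : enorm x <= 2^-1 by apply: le_trans xn; exact: enorm_le_normr.
have s4 : sqn x <= 4^-1.
  rewrite sqn_enorm (_ : 4^-1 = 2^-1 ^+ 2); last by rewrite expr2; field.
  by rewrite lerXn2r ?nnegrE ?enorm_ge0 // invr_ge0.
rewrite /bump gbump0 ifF; last by apply/negbTE; rewrite -ltNge; lra.
by rewrite lerXn2r ?nnegrE //; lra.
Qed.

Lemma bump_Reg M : Reg M (bump M).
Proof.
have f := @fam_gbump R 0 M (lexx _).
have k : kcl M (gbump M) M 0 (bump M) by exact: kcl_base.
exact: (kcl_Reg (lexx 0) f k).
Qed.

End bump.

Section main_estimate.
Context {R : realType} (n : nat) (al : R) (k : nat).
Hypotheses (n0 : (0 < n)%N) (al0 : 0 < al) (al2 : al < 2).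
Local Notation mu := (lebesgue_rV R n).
Local Notation E := 'rV[R]_n.
Implicit Types (x y z : E) (f g : E -> R).

Lemma hfraclapE u th : al < th <= n%:R + al -> wint al u -> sdiff_lb th u ->
  hfraclap k al u = iter k (@neglap R n) (fun x => C_frac n al * flap al u x).
Proof.
move=> hth wu su; rewrite /hfraclap; congr (iter k _ _); apply/funext => x.
have [C hC] := su `|x|.
by apply: (@fraclapE _ _ _ al0 _ _ C th) => // z z1; exact: hC.
Qed.

Variables (th : R) (u : E -> R).
Hypotheses (hth : al < th <= n%:R + al) (wu : wint al u) (su : Smo th k.*2 u).

Lemma hfraclap_mlb : mlb (hfraclap k al u).
Proof.
rewrite (hfraclapE hth wu (Smo_smlb su).2).
apply: (@Reg_mlb _ _ 0); apply: iter_neglap_Reg; rewrite addn0; apply: RegZ.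
exact: (flap_Reg al0 hth wu (leqnn _) su).
Qed.

Let psi : E -> R := bump k.*2.+2.
Let Psi : E -> R := iter k (@neglap R n) psi.
(** The order [2] of the second differences of a function in [Reg 2], capped at the largest order
    that [rint_near_ker] accepts; the cap is active for [n = 1] and [al < 1]. *)
Let th' : R := Num.min 2 (n%:R + al).

Let hth' : al < th' <= n%:R + al.
Proof. by rewrite /th' lt_min al2 ge_min lexx orbT andbT /= ltrDr ltr0n. Qed.

Let psi_Reg : Reg k.*2 psi.
Proof. by apply: Reg_le (bump_Reg _ _); rewrite -addn2 leq_addr. Qed.

Let Psi_Reg : Reg 2 Psi.
Proof. by apply: iter_neglap_Reg; rewrite addn2; exact: bump_Reg. Qed.

Let Psi_out x : 1 < `|x| -> Psi x = 0.
Proof. by apply: iter_neglap_out => y; exact: bump_out. Qed.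

Let smlb2 f : Reg 2 f -> smlb th' f.
Proof.
move=> rf; split; first exact: Reg_mlb rf.
apply: (@sdiff_lb_weak _ _ _ 2); last exact: Reg_sdiff.
- by case/andP: hth' => h _; exact: lt_trans h.
- by rewrite ge_min lexx.
Qed.

Let Psi_smlb : smlb th' Psi. Proof. exact: smlb2. Qed.

Let Psi_wint : wint al Psi.
Proof. exact: (wint_supp al Psi_smlb.1 Psi_out). Qed.

(** Each operator that reaches the rescaled bump releases its order as a power of [c]: [2k] for the
    Laplacians and [al] for the fractional part. *)
Lemma hfraclap_test c : 0 < c ->
  \int[mu]_x (hfraclap k al u x * psi (c *: x)) =
  C_frac n al * c ^+ k.*2 * \int[mu]_x (u x * (c `^ al * flap al Psi (c *: x))).
Proof.
move=> c0; have su0 := Smo_smlb su.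
have fR : Reg k.*2 (flap al u) by exact: (flap_Reg al0 hth wu (leqnn _) su).
have cR : Reg k.*2 (fun x => psi (c *: x)) by exact: Reg_scale.
have supp (h : E -> R) : (forall x, 1 < `|x| -> h x = 0) -> forall x, c^-1 < `|x| -> h (c *: x) = 0.
  move=> h0 x xc; apply: h0; rewrite normrZ gtr0_norm //.
  by rewrite -ltr_pdivrMl // mulr1.
have Psi0 := supp Psi Psi_out.
have Rc : Reg 2 (fun x => Psi (c *: x)) by exact: Reg_scale.
have Sc := smlb2 Rc.
have ci0 : 0 <= c^-1 by rewrite invr_ge0 ltW.
have i1 : rint mu (fun x => flap al u x * Psi (c *: x)).
  apply: (@rint_mlb_supp _ _ _ c^-1).
    by apply: mlbM; [exact: Reg_mlb fR|exact: Sc.1].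
  by move=> x xc; rewrite Psi0 // mulr0.
rewrite (hfraclapE hth wu su0.2).
have e1 := @ibp_iter_neglap _ _ k _ _ c^-1 (RegZ (C_frac n al) fR) cR (supp psi (@bump_out _ _ _)).
apply: (etrans e1).
transitivity (\int[mu]_x ((C_frac n al * c ^+ k.*2) * (flap al u x * Psi (c *: x)))).
  apply: eq_Rintegral => x _; rewrite (iter_neglap_scale c psi_Reg).
  by rewrite mulrACA mulrA.
apply: (etrans (RintZl _ i1)); apply: (congr1 (fun t => (C_frac n al * c ^+ k.*2) * t)).
apply: (etrans (flap_duality al0 hth hth' wu su0 Sc ci0 Psi0)).
apply: eq_Rintegral => x _; congr (_ * _).
exact: (flap_scale x al0 c0 hth' Psi_wint Psi_smlb.2).
Qed.

(** Part of the decay [n + al] is given up so as to land on the weight in which [u] is known to be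
    integrable; the price of undoing the dilation is [t ^ g]. *)
Lemma jb_scale (t g : R) x : 1 <= t -> 0 <= g <= n%:R + al ->
  jb (t^-1 *: x) `^ (- (n%:R + al)) <= t `^ g * jb x `^ (- g).
Proof.
move=> t1 /andP[g0 gn]; have t0 : 0 < t by exact: lt_le_trans t1.
apply: (@le_trans _ _ (jb (t^-1 *: x) `^ (- g))).
  by rewrite ler_powR ?jb_ge1 // lerN2.
rewrite -[t `^ g]powR_invN ?(ltW t0) // -powRM ?jb_ge0 ?invr_ge0 ?(ltW t0) //.
have ti : 0 < t^-1 by rewrite invr_gt0.
rewrite ler_powRN ?mulr_gt0 ?jb_gt0 // /jb normrZ gtr0_norm // mulrDr mulr1 lerD2r.
by rewrite invf_le1.
Qed.

Lemma main_estimate (g : R) : (forall x, 0 <= hfraclap k al u x) ->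
  0 <= g <= n%:R + al -> rint mu (fun x => `|u x| * jb x `^ (- g)) ->
  exists2 C, 0 <= C & forall t : R, 1 <= t ->
    (\int[mu]_(x in @cube R n t) (hfraclap k al u x)%:E <=
       (C * t `^ (g - (2 * k%:R + al)))%:E)%E.
Proof.
move=> f0 hg iu; set f := hfraclap k al u in f0 *.
have [mf bf] : mlb f by exact: hfraclap_mlb.
have [B B0 hB] := sdiff_fker_decay al0 hth' ler01 Psi_smlb Psi_out.
have flapB x : `|flap al Psi x| <= B * jb x `^ (- (n%:R + al)).
  rewrite /flap normrM ger0_norm ?invr_ge0 //; apply: le_trans (hB x).
  apply: (@le_trans _ _ `|\int[mu]_z (sdiff Psi x z * fker al z)|).
    by rewrite ler_piMl // invf_le1 // ler1n.
  by apply: le_normr_Rintegral => //; exact: (sdiff_fker_int al0 x hth' Psi_wint Psi_smlb.2).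
set U := \int[mu]_x (`|u x| * jb x `^ (- g)).
have U0 : 0 <= U by apply: Rintegral_ge0 => x _; rewrite mulr_ge0 ?powR_ge0.
set q : R := (3 / 4) ^+ k.*2.+3.
have q0 : 0 < q by rewrite exprn_gt0 // divr_gt0.
(* The bump is dilated by [T = 2 n t], so that [|x| <= t] gives [n |x / T| <= 1/2] and hence the
   lower bound [q] on the cube of radius [t]. *)
pose N : R := 2 * n%:R.
have N1 : 1 <= N by rewrite /N -natrM ler1n muln_gt0.
pose e := g - (2 * k%:R + al).
exists (q^-1 * (`|C_frac n al| * B * U * N `^ e)).
  by rewrite !mulr_ge0 ?invr_ge0 ?powR_ge0 ?(ltW q0).
move=> t t1; pose T := N * t.
have T1 : 1 <= T by rewrite -[1]mulr1 ler_pM.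
have T0 : 0 < T by exact: lt_le_trans T1.
have Ti0 : 0 < T^-1 by rewrite invr_gt0.
have ipsi : rint mu (fun x => f x * psi (T^-1 *: x)).
  apply: (@rint_mlb_supp _ _ _ T).
    apply: mlbM => //; apply: (Reg_mlb (m := k.*2)); exact: Reg_scale.
  move=> x xT; rewrite /psi bump_out ?mulr0 // normrZ gtr0_norm //.
  by rewrite ltr_pdivlMl ?mulr1.
(* The operators contribute the exponent [- (2k + al)] of [T], and the change of weight contributes
   [g]. *)
have upper : \int[mu]_x (f x * psi (T^-1 *: x)) <= `|C_frac n al| * B * U * T `^ e.
  rewrite (hfraclap_test Ti0); apply: le_trans (ler_norm _) _.
  rewrite normrM normrM [`|T^-1 ^+ _|]ger0_norm ?exprn_ge0 ?(ltW Ti0) //.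
  have b1 x : `|u x * (T^-1 `^ al * flap al Psi (T^-1 *: x))| <=
      (T^-1 `^ al * B * T `^ g) * (`|u x| * jb x `^ (- g)).
    rewrite normrM [`|T^-1 `^ _ * _|]normrM [`|T^-1 `^ _|]ger0_norm ?powR_ge0 // [leRHS]mulrCA ler_wpM2l //.
    rewrite -!mulrA ler_wpM2l ?powR_ge0 //; apply: le_trans (flapB _) _.
    by rewrite ler_wpM2l // jb_scale.
  have b2 : `|\int[mu]_x (u x * (T^-1 `^ al * flap al Psi (T^-1 *: x)))| <=
      (T^-1 `^ al * B * T `^ g) * U.
    rewrite /U -(RintZl _ iu); apply: Rint_norm_le; last exact: b1.
      apply: rint_dom b1 _; last exact: rintZl.
      apply: measurable_funM; first exact: wu.1.
      apply: measurable_funM => //.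
      have r0 : Reg 0 (flap al Psi).
        exact: (flap_Reg al0 hth' Psi_wint (leqnn 0) (Psi_smlb : Smo th' 0 Psi)).
      by have [] : mlb (fun x => flap al Psi (T^-1 *: x)) by exact: (Reg_scale _ r0).
    exact: rintZl.
  apply: (@le_trans _ _ (`|C_frac n al| * T^-1 ^+ k.*2 * ((T^-1 `^ al * B * T `^ g) * U))).
    by rewrite ler_wpM2l // mulr_ge0 // exprn_ge0 // ltW.
  rewrite le_eqVlt; apply/orP; left; apply/eqP.
  have -> : T `^ e = T^-1 ^+ k.*2 * T^-1 `^ al * T `^ g.
    rewrite -powR_mulrn ?(ltW Ti0) // -powR_inv1 ?(ltW T0) // -!powRrM !mulN1r.
    rewrite -!powRD ?(gt_eqF T0) ?implybT //; congr (_ `^ _).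
    by rewrite /e -muln2 natrM; ring.
  ring.
apply: (@le_trans _ _ (\int[mu]_x (q^-1 * (f x * psi (T^-1 *: x)))%:E)%E).
  rewrite integral_mkcond; apply: ge0_le_integral => //.
  - by move=> x _; apply: erestrict_ge0 => y _; rewrite lee_fin.
  - apply/(measurable_restrictT _ _).1; first exact: measurable_cube.
    by apply/measurable_EFinP; exact: measurable_funTS.
  - by apply/measurable_EFinP; apply: measurable_funM => //; exact: rint_meas ipsi.
  - move=> x _; rewrite patchE; case: ifPn => xt; rewrite lee_fin; last first.
      by rewrite !mulr_ge0 ?invr_ge0 ?(ltW q0) ?bump_ge0.
    rewrite mulrCA ler_peMr // ler_pdivlMl // mulr1.
    apply: bump_lower; rewrite normrZ gtr0_norm //.
    move: xt; rewrite inE /cube /= => xt.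
    have n0' : n%:R != 0 :> R by rewrite pnatr_eq0 -lt0n.
    have t0' : t != 0 by rewrite gt_eqF // (lt_le_trans _ t1).
    apply: (@le_trans _ _ (n%:R * (T^-1 * t))); first by rewrite !ler_wpM2l // ltW.
    rewrite le_eqVlt; apply/orP; left; apply/eqP; rewrite /T /N.
    by field; rewrite n0' t0'.
rewrite (rint_EFin (rintZl _ ipsi)) lee_fin (RintZl _ ipsi) -[leRHS]mulrA ler_wpM2l ?invr_ge0 ?(ltW q0) //.
apply: le_trans upper _.
by rewrite /T powRM ?(le_trans _ N1) ?(le_trans _ t1) // mulrA.
Qed.

End main_estimate.

(** * Bootstrap *)

Section vanishing.
Context {R : realType} (n : nat).
Hypothesis n0 : (0 < n)%N.
Local Notation mu := (lebesgue_rV R n).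
Local Notation E := 'rV[R]_n.
Implicit Types (x y z : E) (u v : E -> R).

Lemma continuous_near v x (e : R) : continuous v -> 0 < e ->
  exists2 d : R, 0 < d & forall y, `|y - x| <= d -> `|v y - v x| < e.
Proof.
move=> cv e0; have /cvgrPdist_lt/(_ e e0)/nbhs_ballP[d /= d0 hd] := cv x.
exists (d / 2) => [|y yx]; first by rewrite divr_gt0.
have : ball x d y.
  rewrite -ball_normE /= distrC; apply: le_lt_trans yx _.
  by rewrite ltr_pdivrMr // ltr_pMr // ltr1n.
by move/hd; rewrite /= distrC.
Qed.

(** The factor [|x| ^ a] in the equations may vanish at the origin, so they are exploited elsewhere
    and continuity supplies the remaining value. *)
Lemma continuous_zero v : continuous v -> (forall x, x != 0 -> v x = 0) ->
  forall x, v x = 0.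
Proof.
move=> cv h x; have [->|] := eqVneq x 0; last exact: h.
apply/eqP; apply: contraT => v0.
have v0' : 0 < `|v 0| by rewrite normr_gt0.
have [d d0 hd] := continuous_near 0 cv v0'.
pose i := Ordinal n0; pose y : E := d *: delta_mx ord0 i.
have vn : `|delta_mx ord0 i : E| <= 1 by exact: normr_delta_rV.
have y0 : y != 0.
  apply/eqP => /matrixP/(_ ord0 i); rewrite !mxE !eqxx mulr1 => /eqP.
  by rewrite gt_eqF.
have := hd y; rewrite subr0 normrZ gtr0_norm // => /(_ (ler_piMr (ltW d0) vn)).
by rewrite (h _ y0) sub0r normrN ltxx.
Qed.

Lemma measurable_ball_rV (x : E) (r : R) : measurable [set y : E | `|y - x| <= r].
Proof.
rewrite (_ : [set _ | _] = affrV 1 (- x) @^-1` (@cube R n r)).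
  rewrite -[X in measurable X]setTI; apply: measurable_affrV => //.
  exact: measurable_cube.
by apply/seteqP; split => y /=; rewrite /affrV /cube /= scale1r.
Qed.

Lemma lebesgue_rV_ball (x : E) (r : R) : 0 <= r ->
  mu [set y | `|y - x| <= r] = ((2 * r) ^+ n)%:E.
Proof.
move=> r0; rewrite -(lebesgue_rV_cube n r0).
have mB := measurable_ball_rV x r.
rewrite (lebesgue_rV_affine x (oner_neq0 _) mB) expr1n normr1 mul1e.
congr (mu _); apply/seteqP; split => y /=; rewrite /affrV /= scale1r addrK //.
Qed.

(** A positive value of [v] away from the origin keeps the integrand above a constant on a small
    ball, so integrals over large cubes stay above a positive number and cannot decay. *)
Lemma growth_vanish v (a p C e : R) : continuous v -> (forall x, 0 <= v x) ->
  0 <= a -> 1 <= p -> 0 <= C -> 0 < e ->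
  measurable_fun setT (fun x => enorm x `^ a * v x `^ p) ->
  (forall t : R, 1 <= t -> (\int[mu]_(x in @cube R n t) (enorm x `^ a * v x `^ p)%:E <=
       (C * t `^ (- e))%:E)%E) ->
  forall x, v x = 0.
Proof.
move=> cv v0 a0 p1 C0 e0 mf hC; apply: (continuous_zero cv) => x x0.
apply/eqP; apply: contraT => vx; have {}vx : 0 < v x by rewrite lt_def vx v0.
have nx : 0 < `|x| by rewrite normr_gt0.
have v2 : 0 < v x / 2 by rewrite divr_gt0.
have [d d0 hd] := continuous_near x cv v2.
(* The second entry keeps the ball away from the origin: on it [|y| >= |x| / 2], which bounds the
   factor [|y| ^ a] from below. *)
pose r := Num.min d (`|x| / 2).
have r0 : 0 < r by rewrite lt_min d0 divr_gt0.
pose c := (`|x| / 2) `^ a * (v x / 2) `^ p.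
have c0 : 0 < c by rewrite mulr_gt0 ?powR_gt0 ?divr_gt0.
have p0 : 0 <= p by lra.
have fc y : `|y - x| <= r -> c <= enorm y `^ a * v y `^ p.
  rewrite le_min => /andP[yd yx]; rewrite /c ler_pM ?powR_ge0 //.
    rewrite ge0_ler_powR ?nnegrE ?enorm_ge0 ?divr_ge0 //.
    apply: le_trans (normr_le_enorm y).
    by have := ler_normB y (y - x); rewrite subKr; lra.
  rewrite ge0_ler_powR ?nnegrE ?v0 ?divr_ge0 //.
  have := hd y yd; rewrite ltr_norml => /andP[h _]; lra.
pose c1 := c * (2 * r) ^+ n.
have c10 : 0 < c1 by rewrite mulr_gt0 // exprn_gt0 // mulr_gt0.
(* The first entry makes the cube contain the ball, the second makes [C * t ^ (- e)] smaller than
   [c1]. *)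
pose t := Num.max (1 + `|x| + r) ((C / c1 + 1) `^ e^-1).
have Cc : 0 < C / c1 + 1 by rewrite ltr_wpDl // divr_ge0 // ltW.
have t1 : 1 <= t by rewrite le_max; apply/orP; left; lra.
have tp : 0 < t by exact: lt_le_trans t1.
have te : C / c1 + 1 <= t `^ e.
  have -> : C / c1 + 1 = ((C / c1 + 1) `^ e^-1) `^ e.
    by rewrite -powRrM mulVf ?gt_eqF // powRr1 // ltW.
  by rewrite ge0_ler_powR ?nnegrE ?powR_ge0 ?(ltW e0) ?(ltW tp) // le_max lexx orbT.
have small : C * t `^ (- e) < c1.
  rewrite powRN ltr_pdivrMr ?powR_gt0 //; apply: lt_le_trans (ler_wpM2l (ltW c10) te).
  by rewrite mulrDr mulrCA divff ?gt_eqF // !mulr1 ltrDl.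
have : (\int[mu]_(x in @cube R n t) (enorm x `^ a * v x `^ p)%:E < c1%:E)%E.
  by apply: le_lt_trans (hC t t1) _; rewrite lte_fin.
rewrite ltNge => /negP[].
pose B := [set y : E | `|y - x| <= r].
have mB : measurable B by exact: measurable_ball_rV.
apply: (@le_trans _ _ (\int[mu]_(y in B) (c%:E))%E).
  by rewrite integral_cst // [X in (_ <= _ * X)%E](lebesgue_rV_ball x (ltW r0)) -EFinM.
apply: (@le_trans _ _ (\int[mu]_(y in B) (enorm y `^ a * v y `^ p)%:E)%E).
  apply: ge0_le_integral => //.
  - by move=> y _; rewrite lee_fin ltW.
  - by apply/measurable_EFinP; exact: measurable_funTS.
apply: ge0_subset_integral => //.
- exact: measurable_cube.
- by apply/measurable_EFinP; exact: measurable_funTS.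
- by move=> y _; rewrite lee_fin mulr_ge0 ?powR_ge0.
- move=> y yB; rewrite /cube /= le_max; apply/orP; left.
  have : `|y - x| <= r by [].
  have := ler_normD (y - x) x; rewrite subrK; lra.
Qed.

(** A pointwise substitute for Hoelder's inequality that includes [p = 1]. The room [d] makes
    [jb ^ (- (n + d))] integrable; on the unit cube, where [|x| ^ a] may degenerate, local
    boundedness of [v] is used. *)
Lemma weight_transfer v (a p e g d : R) : mlb v -> (forall x, 0 <= v x) ->
  0 <= a -> 1 <= p -> 0 < d -> e + (n%:R + d) * (p - 1) <= p * g + a ->
  rint mu (fun x => (enorm x `^ a * v x `^ p) * jb x `^ (- e)) ->
  rint mu (fun x => `|v x| * jb x `^ (- g)).
Proof.
move=> [mv bv] v0 a0 p1 d0 hg fi; have [M M0 hM] := lbounded_ge0 1 bv.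
have [M' M'0 hM'] := lbounded_ge0 1 (@mlb_jb R n (- g)).2.
apply: (@rint_dom _ _ _ _ (fun x => (M * M') * \1_(cube 1) x +
   (2 `^ a * ((enorm x `^ a * v x `^ p) * jb x `^ (- e)) + jb x `^ (- (n%:R + d))))).
- apply: measurable_funM; [exact: measurableT_comp|exact: measurable_jb_powR].
- move=> x; rewrite normrM normr_id (ger0_norm (v0 x)) ger0_norm ?powR_ge0 //.
  have tail0 : 0 <= 2 `^ a * (enorm x `^ a * v x `^ p * jb x `^ (- e)) by rewrite !mulr_ge0 ?powR_ge0.
  have tail1 : 0 <= jb x `^ (- (n%:R + d)) by exact: powR_ge0.
  rewrite indicE; have [xc|xc] := boolP (x \in cube 1).
    have x1 : `|x| <= 1 by move: xc; rewrite inE.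
    have h1 := hM x x1; have h2 := hM' x x1.
    rewrite ger0_norm // in h1; rewrite ger0_norm ?powR_ge0 // in h2.
    rewrite mulr1; apply: ler_wpDr; first exact: addr_ge0.
    by rewrite ler_pM ?powR_ge0.
  have x1 : 1 < `|x| by rewrite ltNge; apply: contra xc => xx; rewrite inE.
  (* Either [v <= jb ^ tau], which is integrable against the weight, or
     [v <= v ^ p * jb ^ (tau * (1 - p))]. *)
  rewrite mulr0 add0r; pose tau := g - (n%:R + d).
  have [vt|vt] := leP (v x) (jb x `^ tau).
    apply: ler_wpDl => //; apply: le_trans (ler_wpM2r (powR_ge0 _ _) vt) _.
    by rewrite -powRD ?(gt_eqF (jb_gt0 x)) ?implybT // ler_powR ?jb_ge1 // /tau; lra.
  apply: ler_wpDr => //.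
  have vp : 0 < v x by apply: le_lt_trans vt; exact: powR_ge0.
  have jx := jb_gt0 x.
  have k1 : v x <= v x `^ p * jb x `^ (tau * (1 - p)).
    rewrite -{1}[v x]powRr1 // -{1}(subrK p 1) addrC powRD ?(gt_eqF vp) ?implybT //.
    rewrite ler_wpM2l ?powR_ge0 // powRrM -(opprB p 1) ler_powRN ?powR_gt0 //; first exact: ltW.
    by rewrite subr_ge0.
  have k2 : 1 <= 2 `^ a * enorm x `^ a * jb x `^ (- a).
    rewrite powRN ler_pdivlMr ?powR_gt0 // mul1r -powRM ?enorm_ge0 //.
    rewrite ge0_ler_powR ?nnegrE ?jb_ge0 ?mulr_ge0 ?enorm_ge0 //.
    by have := normr_le_enorm x; rewrite /jb; lra.
  apply: (@le_trans _ _ ((v x `^ p * jb x `^ (tau * (1 - p))) *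
     (2 `^ a * enorm x `^ a * jb x `^ (- a)) * jb x `^ (- g))).
    rewrite ler_wpM2r ?powR_ge0 // -[leLHS]mulr1 ler_pM //.
  rewrite (_ : _ * _ * _ = 2 `^ a * (enorm x `^ a * v x `^ p *
    (jb x `^ (tau * (1 - p)) * jb x `^ (- a) * jb x `^ (- g)))); last by ring.
  rewrite !ler_wpM2l ?mulr_ge0 ?powR_ge0 // -!powRD ?(gt_eqF jx) ?implybT //.
  rewrite ler_powR ?jb_ge1 // /tau.
  have -> : (g - (n%:R + d)) * (1 - p) - a - g = (n%:R + d) * (p - 1) - (p * g + a) by ring.
  lra.
- apply: rintD; first exact: rint_cube.
  by apply: rintD; [exact: rintZl|exact: rint_jb].
Qed.

End vanishing.

Section bootstrap.
Context {R : realType} (n : nat).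
Hypothesis n0 : (0 < n)%N.
Local Notation mu := (lebesgue_rV R n).
Local Notation E := 'rV[R]_n.
Implicit Types (u v : E -> R).

Definition wjb u (g : R) := rint mu (fun x => `|u x| * jb x `^ (- g)).

Definition admissible (al : R) (k : nat) u :=
  [/\ 0 < al < 2, wint al u,
      exists2 th, al < th <= n%:R + al & Smo th k.*2 u,
      continuous u & forall x, 0 <= u x].

Lemma admissible_mlb al k u : admissible al k u -> mlb u.
Proof. by case=> _ _ [th _ /Smo_smlb[]]. Qed.

(** In the second alternative [d] is paid twice: once to sum the dyadic growth bound strictly above
    its exponent, once for the integrable tail in [weight_transfer]. *)
Lemma exponent_step (al : R) k u v (a p g : R) : admissible al k u ->
  mlb v -> continuous v -> (forall x, 0 <= v x) -> 0 <= a -> 1 <= p ->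
  (forall x, hfraclap k al u x = enorm x `^ a * v x `^ p) ->
  0 <= g <= n%:R + al -> wjb u g ->
  (g < 2 * k%:R + al -> forall x, v x = 0) /\
  (forall d g', 0 < d -> 2 * k%:R + al <= g ->
     g - (2 * k%:R + al) + d + (n%:R + d) * (p - 1) <= p * g' + a -> wjb v g').
Proof.
move=> [/andP[al0 al2] wu [th hth su] cu u0] bv cv v0 a0 p1 eqn hg iu.
have f0 x : 0 <= hfraclap k al u x by rewrite eqn mulr_ge0 ?powR_ge0.
have fE : hfraclap k al u = fun x => enorm x `^ a * v x `^ p by apply/funext.
have [mf _] := hfraclap_mlb al0 hth wu su.
have [C C0 hC] := main_estimate n0 al0 al2 hth wu su f0 hg iu.
rewrite fE in mf hC f0; split.
  move=> gs; apply: (@growth_vanish _ _ n0 v a p C (2 * k%:R + al - g)) => //.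
  - by rewrite subr_gt0.
  - by move=> t t1; rewrite opprB; exact: hC.
move=> d g' d0 gs hg'.
apply: (@weight_transfer _ _ v a p (g - (2 * k%:R + al) + d) g' d) => //.
apply: (@rint_dyadic _ _ _ C (g - (2 * k%:R + al))) => //.
- by rewrite addr_ge0 ?subr_ge0 // ltW.
- by rewrite ltrDl.
- move=> j; rewrite -powR_expn //; apply: hC.
  by rewrite exprn_ege1 // ler1n.
Qed.

(** If one round without losses sends [g] to [h], the gain [p q (g - h)] is nondecreasing in [g]
    because [p q >= 1], so over [g >= s] it is smallest at [g = s]. There it equals the [D] of the
    proof, and the last hypothesis says [D > 0]. *)
Lemma one_component_vanishes (al be : R) (k l : nat) (a b p q : R) u v :
  admissible al k u -> admissible be l v ->
  0 <= a -> 0 <= b -> 1 <= p -> 1 <= q ->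
  (forall x, hfraclap k al u x = enorm x `^ a * v x `^ p) ->
  (forall x, hfraclap l be v x = enorm x `^ b * u x `^ q) ->
  p * q * (n%:R - 2 * k%:R - al) < a + p * (2 * l%:R + be + b) + n%:R ->
  (forall x, v x = 0) \/ (forall x, u x = 0).
Proof.
move=> au av a0 b0 p1 q1 eu ev cond.
have [/andP[al0 al2] [mu_ wu] _ cu u0] := au.
have [/andP[be0 be2] _ _ cv v0] := av.
have bu := admissible_mlb au; have bv := admissible_mlb av.
set s := 2 * k%:R + al; set s' := 2 * l%:R + be.
have kk : 0 <= k%:R :> R by []; have ll : 0 <= l%:R :> R by [].
have nn : 0 <= n%:R :> R by [].
have s0 : 0 < s by rewrite /s; lra.
have s'0 : 0 < s' by rewrite /s'; lra.
have p0 : 0 < p by lra.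
have q0 : 0 < q by lra.
pose D := a + p * (s' + b) + n%:R - p * q * (n%:R - s).
have D0 : 0 < D by rewrite /D subr_gt0 /s opprD addrA.
(* The losses of both half steps add up to [d (p q + p)], which this choice keeps at most [D / 2];
   the other half of [D] yields [eta]. The bounds by [al] and [be] keep [G <= n + be] and
   [H <= n + al]. *)
pose d := Num.min (Num.min al be) (D / (2 * (p * q + p))).
have pq0 : 0 < p * q by exact: mulr_gt0.
have pqp : 0 < 2 * (p * q + p) by rewrite mulr_gt0 // addr_gt0.
have d0 : 0 < d by rewrite !lt_min al0 be0 divr_gt0.
have dal : d <= al by rewrite !ge_min lexx.
have dbe : d <= be by rewrite !ge_min lexx orbT.
have dD : d * (2 * (p * q + p)) <= D by rewrite -ler_pdivlMr // /d !ge_min lexx orbT.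
pose eta := D / (2 * (p * q)).
have eta0 : 0 < eta by rewrite divr_gt0 // mulr_gt0.
have etaE : eta * (2 * (p * q)) = D by rewrite /eta divfK // gt_eqF // mulr_gt0.
(* Both half steps together lower the exponent by [eta]; the maxima with [0]
   below only serve to keep the exponents admissible. *)
have round (g : R) : s <= g <= n%:R + al -> wjb u g ->
  ((forall x, v x = 0) \/ (forall x, u x = 0)) \/
  exists g' : R, [/\ s <= g' <= n%:R + al, g' <= g - eta & wjb u g'].
  move=> /andP[sg gn] ug.
  have g0 : 0 <= g <= n%:R + al by apply/andP; split=> //; exact: le_trans (ltW s0) sg.
  have [_ hv] := exponent_step au bv cv v0 a0 p1 eu g0 ug.
  pose G := (g - s + d - a + (n%:R + d) * (p - 1)) / p.
  have pG : p * G = g - s + d - a + (n%:R + d) * (p - 1) by rewrite /G mulrC divfK // gt_eqF.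
  have Gn : G <= n%:R + be.
    rewrite -(ler_pM2l p0) pG /s; nra.
  have vG (h : R) : G <= h -> wjb v h.
    move=> Gh; apply: (hv d) => //.
    have : p * G <= p * h by rewrite ler_pM2l.
    rewrite pG -/s; lra.
  (* Below [s'] the equation for [v] has a right-hand side whose integrals decay, so [u] vanishes
     and the iteration stops. *)
  have [Gs|Gs] := ltP G s'.
    have m0 : 0 <= Num.max 0 G <= n%:R + be.
      rewrite le_max lexx /= ge_max Gn andbT addr_ge0 // ltW //.
    have Gm : G <= Num.max 0 G by rewrite le_max lexx orbT.
    have [h _] := exponent_step av bu cu u0 b0 q1 ev m0 (vG _ Gm).
    left; right; apply: h.
    by rewrite gt_max s'0.
  have G0 : 0 <= G <= n%:R + be by rewrite Gn andbT (le_trans (ltW s'0)).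
  have [_ hu] := exponent_step av bu cu u0 b0 q1 ev G0 (vG _ (lexx _)).
  pose H := (G - s' + d - b + (n%:R + d) * (q - 1)) / q.
  have qH : q * H = G - s' + d - b + (n%:R + d) * (q - 1) by rewrite /H mulrC divfK // gt_eqF.
  have uH (h : R) : H <= h -> wjb u h.
    move=> Hh; apply: (hu d) => //.
    have : q * H <= q * h by rewrite ler_pM2l.
    rewrite qH -/s'; lra.
  have Hn : H <= n%:R + al.
    rewrite -(ler_pM2l q0) qH /s'; nra.
  have Heta : H <= g - eta.
    rewrite -(ler_pM2l pq0) -mulrA qH.
    have pq1 : 0 <= p * q - 1 by rewrite subr_ge0 -[1]mulr1 ler_pM.
    have := ler_wpM2l pq1 sg.
    have -> : p * (G - s' + d - b + (n%:R + d) * (q - 1)) =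
      p * G + p * (d - s' - b + (n%:R + d) * (q - 1)) by ring.
    rewrite pG; move: dD etaE; rewrite /D; clear; lra.
  have [Hs|Hs] := ltP H s.
    have m0 : 0 <= Num.max 0 H <= n%:R + al.
      rewrite le_max lexx /= ge_max Hn andbT addr_ge0 // ltW //.
    have Hm : H <= Num.max 0 H by rewrite le_max lexx orbT.
    have [h _] := exponent_step au bv cv v0 a0 p1 eu m0 (uH _ Hm).
    left; left; apply: h.
    by rewrite gt_max s0.
  right; exists H; split => //; first by rewrite Hs.
  exact: uH.
have iter (N : nat) (g : R) : s <= g <= n%:R + al -> g <= s + N%:R * eta -> wjb u g ->
    (forall x, v x = 0) \/ (forall x, u x = 0).
  (* A round is played even for [N = 0]: then [g <= s], and an exponent lowered by [eta] would
     contradict [s <= g']. *)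
  elim: N g => [|N IH] g sg gN ug; have [//|[g' [h1 h2 h3]]] := round g sg ug.
    by move: h1 => /andP[h1 _]; rewrite mul0r in gN; lra.
  apply: (IH g') => //; apply: le_trans h2 _.
  by move: gN; rewrite -natr1 mulrDl mul1r; lra.
(* If [n + al < s], the exponent granted by [L_alpha] is already below [s]. *)
have [ns|ns] := ltP (n%:R + al) s.
  have m0 : 0 <= n%:R + al <= n%:R + al by rewrite lexx andbT addr_ge0 // ltW.
  by have [h _] := exponent_step au bv cv v0 a0 p1 eu m0 wu; left; exact: h.
pose N := (Num.truncn ((n%:R + al - s) / eta)).+1.
apply: (iter N (n%:R + al)) => //; first by rewrite ns lexx.
rewrite -lerBlDl -ler_pdivrMr //; apply: ltW; exact: truncnS_gt.
Qed.

Lemma hfraclap0 al k u : admissible al k u -> (forall x, u x = 0) ->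
  forall x, hfraclap k al u x = 0.
Proof.
move=> [/andP[al0 _] wu [th hth su] _ _] u0 x.
rewrite (hfraclapE k al0 hth wu (Smo_smlb su).2).
have -> : (fun x => C_frac n al * flap al u x) = fun=> 0.
  apply/funext => y; rewrite /flap (_ : (fun z => _) = fun=> 0).
    by rewrite Rintegral_cst // mul0r !mulr0.
  by apply/funext => z; rewrite /sdiff !u0 mulr0 !subr0 mul0r.
elim: k {su} x => [//|k IH] x; rewrite iterS.
rewrite (_ : iter k _ _ = fun=> 0); last exact/funext.
by rewrite /neglap big1 ?oppr0 // => i _; rewrite partial_cst partial_cst.
Qed.

Lemma weight_zero v (a p : R) : continuous v -> 1 <= p ->
  (forall x, enorm x `^ a * v x `^ p = 0) -> forall x, v x = 0.
Proof.
move=> cv p1 h; apply: (continuous_zero n0 cv) => x x0.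
have /eqP := h x; rewrite mulf_eq0 => /orP[|].
  by rewrite powR_eq0 gt_eqF // enorm_gt0.
by rewrite powR_eq0 => /andP[/eqP].
Qed.

Lemma frac_regular_admissible al k u : 0 < al < 2 -> frac_regular (2 * k) al u ->
  L_alpha al u -> (forall x, 0 <= u x) -> admissible al k u.
Proof.
move=> hal fr Lu u0; have /andP[al0 _] := hal.
have wu := L_alpha_wint al0 Lu; split => //.
  by apply: frac_regular_Smo => //; [exact: wu.1|rewrite -mul2n].
by have [eps [_ _ [ck _]]] := fr; have [] := ck [::] isT.
Qed.

End bootstrap.

Theorem theorem1p3 (R : realType) (n : nat) (hn : (1 <= n)%N)
  (alpha beta : R)
  (halpha : 0 < alpha < Num.min 2 n%:R) (hbeta : 0 < beta < Num.min 2 n%:R)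
  (k l : nat) (a b p q : R)
  (ha : 0 <= a) (hb : 0 <= b) (hp : 1 <= p) (hq : 1 <= q)
  (u v : 'rV[R]_n -> R)
  (huv : is_solution k l alpha beta a b p q u v)
  (hcond :
    [\/ p = 1 /\ q = 1,
        1 < p * q /\
        (2 * k%:R + alpha + a + p * (2 * l%:R + beta + b)) / (p * q - 1)
          > n%:R - 2 * k%:R - alpha
      | 1 < p * q /\
        (2 * l%:R + beta + b + q * (2 * k%:R + alpha + a)) / (p * q - 1)
          > n%:R - 2 * l%:R - beta]) :
  (forall x, u x = 0) /\ (forall x, v x = 0).
Proof.
case: huv => -[fu Lu] [fv Lv] eu ev uv0.
have lt2 (g : R) : 0 < g < Num.min 2 n%:R -> 0 < g < 2.
  by rewrite lt_min => /andP[-> /andP[->]].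
have u0 x : 0 <= u x by have [] := uv0 x.
have v0 x : 0 <= v x by have [] := uv0 x.
have au := frac_regular_admissible hn (lt2 _ halpha) fu Lu u0.
have av := frac_regular_admissible hn (lt2 _ hbeta) fv Lv v0.
have [_ _ _ cu _] := au; have [_ _ _ cv _] := av.
have one0 : (forall x, v x = 0) \/ (forall x, u x = 0).
  have kk : 0 <= k%:R :> R by []; have ll : 0 <= l%:R :> R by [].
  move: halpha hbeta => /andP[al0 _] /andP[be0 _].
  case: hcond => [[p1 q1]|[pq]|[pq]].
  (* For [p = q = 1] the condition reduces to [0 < 2k + alpha + a + 2l + beta + b]. *)
  - apply: (one_component_vanishes hn au av ha hb hp hq eu ev).
    by rewrite p1 q1; lra.
  (* After clearing the denominator, adding [n - 2k - alpha] to both sides gives the required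
     inequality. *)
  - rewrite ltr_pdivlMr ?subr_gt0 // => h.
    apply: (one_component_vanishes hn au av ha hb hp hq eu ev); move: h; clear; lra.
  - rewrite ltr_pdivlMr ?subr_gt0 // => h.
    have [||] := one_component_vanishes hn av au hb ha hq hp ev eu _; last 2 first.
    + by right.
    + by left.
    + move: h; clear; lra.
(* The equation of the vanishing component has left-hand side [0], and its right-hand side is a
   power of the other component times a factor that is positive off the origin. *)
case: one0 => [vz|uz]; split => //.
- by apply: (@weight_zero _ _ hn u b q cu hq) => x; rewrite -ev; exact: (hfraclap0 av).
- by apply: (@weight_zero _ _ hn v a p cv hp) => x; rewrite -eu; exact: (hfraclap0 au).
Qed.
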